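(* Assume $h$ is $\mu$-strongly convex relative to the Bregman divergence with $\mu>0$ (see context). Let $\delta\in(0,1)$, $\epsilon>0$, let $D_0$ be a constant with $\|D^\pi_{\hat\pi_0}\|_\infty\le D_0$ for every policy $\pi$, and let $u_k=2^{-k}\max\{\frac{1+\bar h}{1-\gamma},\mu D_0\}$. Run the strongly convex SVMD algorithm (described in the context) with $$K=\left\lceil\log_2\tfrac{u_0}{\epsilon}\right\rceil,\quad T=\left\lceil\tfrac{18}{1-\gamma}\right\rceil,\quad \eta_{k,t}=\tfrac{2}{\mu(t+1)}\ \ (t=0,\dots,T-1),$$ $$m_{k,1}\ge200\max\left\{\tfrac{64(1+\bar h)^2}{\mu}(1-\gamma)^{-5}u_k^{-1}(\ln T+1),\,1\right\}\ln(24K|\mathbb S||\mathbb A|\delta^{-1}),$$ $$m_{k,2}\ge\left[\tfrac{400(1+\bar h+\mu D_0)}{\mu}(\ln T+1)+16\right](1-\gamma)^{-4}\ln[4K(T-1)|\mathbb S||\mathbb A|\delta^{-1}]$$ for $k=0,\dots,K-1$. Then with probability at least $1-\delta$, the output $\hat\pi_K$ is $\epsilon$-optimal, i.e. $\|V^{\hat\pi_K}-V^*\|_\infty\le\epsilon$, and $\|D^{\pi^*}_{\hat\pi_K}\|_\infty\le\frac{\epsilon}{\mu(1-\gamma)}$.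
   Context: MDP. $(\mathbb S,\mathbb A,\mathbb P,c,\gamma)$ is a discounted Markov decision process with finite $\mathbb S,\mathbb A$, transition kernel $\mathbb P(s'|s,a)$, cost $c(s,a)\in[0,1]$, $\gamma\in(0,1)$. For any kernel $Q$ on $\mathbb S\times\mathbb A$ and $V\in\mathbb R^{|\mathbb S|}$: $Q_{s,a}=Q(\cdot|s,a)$, $(QV)_{s,a}=Q_{s,a}^\top V$, and $Q_sV\in\mathbb R^{|\mathbb A|}$ is the row of $QV$ at $s$. $\Delta_{\mathbb A}$ is the probability simplex over $\mathbb A$; a policy $\pi$ assigns $\pi(\cdot|s)\in\Delta_{\mathbb A}$ to each $s$. $h:\Delta_{\mathbb A}\to[0,\bar h]$ is a continuous convex regularizer. $V^\pi(s)=\mathbb E[\sum_{t\ge0}\gamma^t(c(s_t,a_t)+h(\pi(\cdot|s_t)))\mid s_0=s,\ a_t\sim\pi(\cdot|s_t),\ s_{t+1}\sim\mathbb P(\cdot|s_t,a_t)]$. $\pi^*$ is an optimal policy ($V^{\pi^*}\le V^\pi$ componentwise for all $\pi$), $V^*=V^{\pi^*}$. Bregman divergence. $\omega:\Delta_{\mathbb A}\to\mathbb R$ is continuously differentiable and $1$-strongly convex with respect to the $\ell_1$-norm; $D(x_1,x_2)=\omega(x_2)-\omega(x_1)-\langle\nabla\omega(x_1),x_2-x_1\rangle$; $D^{\pi}_{\pi'}\in\mathbb R^{|\mathbb S|}$ has entries $D^{\pi}_{\pi'}(s)=D(\pi'(\cdot|s),\pi(\cdot|s))$. $h$ is $\mu$-strongly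 convex, $\mu>0$, meaning $h(\pi(\cdot|s))-[h(\pi'(\cdot|s))+\langle h'(\pi'(\cdot|s)),\pi(\cdot|s)-\pi'(\cdot|s)\rangle]\ge\mu D^{\pi}_{\pi'}(s)$ for all $s$ and policies $\pi,\pi'$, with $h'$ denoting a (Clarke) subgradient. Sampling. $\hat{\mathbb P}^{(m)}$ is the empirical kernel: for each $(s,a)$, $m$ independent samples $s_1,\dots,s_m\sim\mathbb P(\cdot|s,a)$ are drawn and $\hat{\mathbb P}^{(m)}_{s,a}(s')=\frac1m\sum_i\mathbb I\{s_i=s'\}$. Samples are independent across $(s,a)$, and fresh samples are used each time an estimator is formed. Strongly convex SVMD algorithm. Input: positive integers $K,T,m_{k,1},m_{k,2}$, positive stepsizes $\eta_{k,t}$; $\hat\pi_0(\cdot|s)$ uniform on $\mathbb A$ for all $s$; $\hat V_0=\frac{1+\bar h}{1-\gamma}\mathbf 1_{\mathbb S}$. For each epoch $k=0,\dots,K-1$: set $\pi_0=\hat\pi_k$, $\eta_t=\eta_{k,t}$, draw $\tilde{\mathbb P}^0=\hat{\mathbb P}^{(m_{k,1})}$. If $k=0$ set $V_0=\hat V_0$; otherwise let $V_0$ be the solution of $V_0(s)=\langle c(s,\cdot)+\gamma\tilde{\mathbb P}^0_sV_0,\pi_0(\cdot|s)\rangle+h(\pi_0(\cdot|s))$ for all $s$. For $t=0,\dots,T-1$: if $t>0$, draw a fresh $\hat{\mathbb P}^{(m_{k,2})}$ and set $(\tilde{\mathbb P}^tV_t)_{s,a}=(\tilde{\mathbb P}^0V_0)_{s,a}+(\hat{\mathbb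 P}^{(m_{k,2})}_{s,a})^\top(V_t-V_0)$; then for all $s$, $$\pi_{t+1}(\cdot|s)=\arg\min_{\pi(\cdot|s)\in\Delta_{\mathbb A}}\{\eta_t[\langle c(s,\cdot)+\gamma\tilde{\mathbb P}^t_sV_t,\pi(\cdot|s)\rangle+h(\pi(\cdot|s))]+D^{\pi}_{\pi_t}(s)\},$$ $$V_{t+1}(s)=\min\{\langle c(s,\cdot)+\gamma\tilde{\mathbb P}^t_sV_t,\pi_{t+1}(\cdot|s)\rangle+h(\pi_{t+1}(\cdot|s)),\,V_t(s)\}.$$ At the end of the epoch set $\hat\pi_{k+1}=\pi_T$. Output $\hat\pi_K$. *)

(* Defs.v *)
From HB Require Import structures.
From mathcomp Require Import all_boot all_order all_algebra.
From mathcomp Require Import all_classical all_reals all_analysis.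
Import numFieldNormedType.Exports.
Import Order.TTheory GRing.Theory Num.Theory.

Set Implicit Arguments.
Unset Strict Implicit.
Unset Printing Implicit Defensive.

Local Open Scope classical_set_scope.
Local Open Scope ring_scope.

Section Simplex.
Context {R : realType} {A : finType}.
Implicit Types (x y g q : A -> R) (f h omega : (A -> R) -> R).

Definition simplex : set (A -> R) :=
  [set x | (forall a, 0 <= x a) /\ \sum_a x a = 1].

Definition dotp x y : R := \sum_a x a * y a.

Definition l1norm x : R := \sum_a `|x a|.

(* R^A carries the product topology, i.e. its Euclidean topology. *)
Definition continuous_on_simplex f :=
  {within (simplex : set {ptws A -> R}),
     continuous (f : {ptws A -> R} -> R)}.

Definition convex_on_simplex h :=
  @convex_function R (A -> R^o) simplex h.

(* A function on the simplex is differentiated within the simplex, so a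
   gradient matters only through its products with feasible directions
   y - x; for a function that is C^1 around the simplex, its usual gradient
   is one. *)
Definition is_gradient_on_simplex omega (gomega : (A -> R) -> (A -> R)) :=
  forall x, simplex x -> forall e : R, 0 < e ->
    \forall y \near within (simplex : set {ptws A -> R})
                      (nbhs (x : {ptws A -> R})),
      `|omega y - omega x - dotp (gomega x) (y \- x)| <= e * l1norm (y \- x).

Definition continuously_differentiable_on_simplex omega
    (gomega : (A -> R) -> (A -> R)) :=
  is_gradient_on_simplex omega gomega /\
  forall a, continuous_on_simplex (fun x => gomega x a).

Definition l1_strongly_convex omega (gomega : (A -> R) -> (A -> R)) :=
  forall x y, simplex x -> simplex y ->
    omega x + dotp (gomega x) (y \- x) + 2^-1 * l1norm (y \- x) ^+ 2
      <= omega y.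

Definition bregman omega (gomega : (A -> R) -> (A -> R)) x1 x2 : R :=
  omega x2 - omega x1 - dotp (gomega x1) (x2 \- x1).

Definition subgradient h x g :=
  forall y, simplex y -> h x + dotp g (y \- x) <= h y.

(* A minimizer of f on the simplex, and x0 if there is none. *)
Definition argmin_simplex (x0 : A -> R) f : A -> R :=
  xget x0 [set x | simplex x /\ forall y, simplex y -> f x <= f y].

End Simplex.

Section MDP.
Context {R : realType} {S A : finType}.

Definition linfty (V : S -> R) : R := \big[Num.max/0]_(s : S) `|V s|.

Record mdp := Mdp {
  trans : S -> A -> S -> R ;
  cost : S -> A -> R ;
  discount : R ;
  trans_simplex : forall s a, simplex (trans s a) ;
  cost_itv : forall s a, 0 <= cost s a <= 1 ;
  discount_itv : 0 < discount < 1 }.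

Definition is_policy (pi : S -> A -> R) := forall s, simplex (pi s).

Definition uniform_policy : S -> A -> R := fun _ _ => #|A|%:R^-1.

(* [bregman_policy omega gomega pi' pi] is the vector D^pi_pi'. *)
Definition bregman_policy (omega : (A -> R) -> R)
    (gomega : (A -> R) -> (A -> R)) (pi' pi : S -> A -> R) : S -> R :=
  fun s => bregman omega gomega (pi' s) (pi s).

Definition strongly_convex_wrt_bregman (h : (A -> R) -> R)
    (h' : (A -> R) -> (A -> R)) (mu : R) (omega : (A -> R) -> R)
    (gomega : (A -> R) -> (A -> R)) :=
  (forall x, simplex x -> subgradient h x (h' x)) /\
  forall pi pi' : S -> A -> R, is_policy pi -> is_policy pi' -> forall s,
    mu * bregman_policy omega gomega pi' pi s <=
      h (pi s) - (h (pi' s) + dotp (h' (pi' s)) (pi s \- pi' s)).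

(* The law of s_0, a_0, s_1, a_1, ... when s_0 = s, a_t ~ pi(.|s_t) and
   s_(t+1) ~ trans(.|s_t, a_t), given by its finite-dimensional marginals. *)
Definition trajectory_law (M : mdp) d (Om : measurableType d)
    (Pr : probability Om R) (st : nat -> Om -> S) (ac : nat -> Om -> A)
    (pi : S -> A -> R) (s : S) :=
  [/\ forall t x, measurable [set w | st t w = x],
      forall t b, measurable [set w | ac t w = b] &
      forall (n : nat) (x : nat -> S) (b : nat -> A),
        Pr [set w | forall t, (t <= n)%N -> st t w = x t /\ ac t w = b t] =
        ((x 0%N == s)%:R * (\prod_(0 <= t < n.+1) pi (x t) (b t)) *
         \prod_(0 <= t < n) trans M (x t) (b t) (x t.+1))%:E].

Definition value (M : mdp) (h : (A -> R) -> R) d (Om : measurableType d)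
    (Pr : (S -> A -> R) -> S -> probability Om R)
    (st : nat -> Om -> S) (ac : nat -> Om -> A)
    (pi : S -> A -> R) (s : S) : R :=
  fine ('E_(Pr pi s)[fun w => limn (series (fun t : nat =>
    discount M ^+ t * (cost M (st t w) (ac t w) + h (pi (st t w)))))%R])%E.

Definition optimal_policy (V : (S -> A -> R) -> S -> R)
    (pistar : S -> A -> R) :=
  is_policy pistar /\
  forall pi, is_policy pi -> forall s, V pistar s <= V pi s.

Definition kernel_mul (Q : S -> A -> S -> R) (V : S -> R) (s : S) (a : A) : R :=
  \sum_(s' : S) Q s a s' * V s'.

Definition empirical_kernel (m : nat) (xi : S -> A -> nat -> S) :
    S -> A -> S -> R :=
  fun s a s' => m%:R^-1 * \sum_(i < m) (xi s a i == s')%:R.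

(* The solution of the Bellman equation of pi under the kernel Q, which is
   unique when Q is stochastic. *)
Definition policy_evaluation (M : mdp) (h : (A -> R) -> R)
    (Q : S -> A -> S -> R) (pi : S -> A -> R) : S -> R :=
  xget (fun=> 0) [set V : S -> R | forall s,
    V s = dotp (fun a => cost M s a + discount M * kernel_mul Q V s a) (pi s)
          + h (pi s)].

End MDP.

Arguments mdp : clear implicits.
Arguments strongly_convex_wrt_bregman {R} S {A}.

Section SVMD.
Context {R : realType} {S A : finType}.
Variables (M : mdp R S A) (h : (A -> R) -> R) (hbar : R).
Variables (omega : (A -> R) -> R) (gomega : (A -> R) -> (A -> R)).
Variables (T : nat) (m1 m2 : nat -> nat) (eta : nat -> nat -> R).
(* [xi k t s a i] is the i-th next state sampled at (s, a) in iteration t of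
   epoch k; the samples with t = 0 are those of the kernel drawn at the
   beginning of the epoch. *)
Variable xi : nat -> nat -> S -> A -> nat -> S.

Definition svmd_kernel0 (k : nat) : S -> A -> S -> R :=
  empirical_kernel (m1 k) (xi k 0%N).

Definition svmd_estimate (k : nat) (V0 : S -> R) (t : nat) (V : S -> R) :
    S -> A -> R :=
  if t == 0%N then kernel_mul (svmd_kernel0 k) V0
  else fun s a => kernel_mul (svmd_kernel0 k) V0 s a +
         kernel_mul (empirical_kernel (m2 k) (xi k t)) (V \- V0) s a.

(* The pair (pi_t, V_t) of epoch k. *)
Fixpoint svmd_inner (k : nat) (pi0 : S -> A -> R) (V0 : S -> R) (t : nat) :
    (S -> A -> R) * (S -> R) :=
  if t is t'.+1 then
    let: (pi, V) := svmd_inner k pi0 V0 t' in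
    let G := svmd_estimate k V0 t' V in
    let obj (s : S) (p : A -> R) :=
      dotp (fun a => cost M s a + discount M * G s a) p + h p in
    let pi' (s : S) := argmin_simplex (pi s)
      (fun p => eta k t' * obj s p + bregman omega gomega (pi s) p) in
    (pi', fun s => Num.min (obj s (pi' s)) (V s))
  else (pi0, V0).

(* The policy hat pi_k. *)
Fixpoint svmd (k : nat) : S -> A -> R :=
  if k is k'.+1 then
    let pi0 := svmd k' in
    let V0 := if k' == 0%N then fun=> (1 + hbar) / (1 - discount M)
              else policy_evaluation M h (svmd_kernel0 k') pi0 in
    (svmd_inner k' pi0 V0 T).1
  else uniform_policy.

End SVMD.

Definition mutually_independent {R : realType} d (Om : measurableType d)
    (Pr : probability Om R) (I : choiceType) (E : Type)
    (D : set I) (X : I -> Om -> E) :=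
  forall (r : seq I) (B : I -> set E),
    uniq r -> (forall i, i \in r -> D i) ->
    Pr (\bigcap_(i in [set` r]) (X i @^-1` B i)) =
    (\prod_(i <- r) Pr (X i @^-1` B i))%E.

Definition fresh_samples {R : realType} {S A : finType} (M : mdp R S A)
    d (Om : measurableType d) (Pr : probability Om R)
    (K T : nat) (m1 m2 : nat -> nat)
    (xi : nat -> nat -> S -> A -> nat -> Om -> S) :=
  let drawn (k t i : nat) :=
    [/\ (k < K)%N, (t < T)%N & (i < if t == 0%N then m1 k else m2 k)%N] in
  [/\ forall k t s a i, drawn k t i ->
        forall s', measurable [set w | xi k t s a i w = s'],
      forall k t s a i, drawn k t i ->
        forall s', Pr [set w | xi k t s a i w = s'] = (trans M s a s')%:E &
      mutually_independent Pr
        [set j : nat * nat * S * A * nat |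
          let: (k, t, _, _, i) := j in drawn k t i]
        (fun j => let: (k, t, s, a, i) := j in xi k t s a i)].

(* Main.v *)
(* Within an epoch the samples drawn at its beginning perturb the cost by the
   fixed vector [noise0].  Comparing with the value [Vt] of the optimal policy
   for the perturbed cost, instead of with the optimal value, has two effects.
   Strong convexity absorbs the change of the advantages caused by [noise0], so
   that it costs only a term quadratic in [noise0]; and the errors made along the
   epoch only involve the fresh samples applied to the drift [V_t - V_0], which
   is of the order of the current accuracy [u].  Summing the three-point
   inequalities of mirror descent with the weights [t + 2] then makes
   [V_T - Vt] small.  Passing from [V_T] to the value of the last policy, the
   errors telescope, except for products with [pi_t - pi_(t+1)], which are again
   absorbed by strong convexity and add up to a harmonic sum.

   The value [V_0] that multiplies the first samples is computed from these same
   samples.  But it depends on the row of the empirical kernel at a state [s]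
   only through the scalar [V_0 s], affinely, so that the deviations of two
   vectors that are independent of this row control [noise0] at [s]. *)

Require Import Defs.
From HB Require Import structures.
From mathcomp Require Import all_boot all_order all_algebra.
From mathcomp Require Import all_classical all_reals all_analysis.
From mathcomp Require Import measurable_realfun ring lra.
Import numFieldNormedType.Exports.
Import Order.TTheory GRing.Theory Num.Theory.

Set Implicit Arguments.
Unset Strict Implicit.
Unset Printing Implicit Defensive.

Local Open Scope classical_set_scope.
Local Open Scope ring_scope.

(** * Convex functions on the simplex *)

(** The requirement on [m1 k] grows only like [1 / u k], so the first samples determine costs up to
    some [d0] of order [sqrt (u k)]. A bound linear in [d0] would never reach accuracy [u k]; this
    is why the noise has to enter quadratically, with [z = u k / 500] in the role of
    [d0 ^+ 2 / (mu * (1 - g) ^+ 3)]. The requirement on [m2 k] does not depend on [k]: fresh samples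
    only have to be accurate up to a fixed fraction [(1 - g) ^+ 2 / 20] of the drift. Two bounds by
    [u k] pass from epoch to epoch, one on the value gap and one on [mu] times the divergence to the
    optimal policy. An epoch halves both: the weights add up to about [T ^ 2 / 2], while the initial
    errors count with weight of order [T], and [T] is at least [18 / (1 - g)]. The samples are used
    adaptively: an empirical row is applied to functions that depend on other samples. As finitely
    many samples are drawn, their joint law is a product weight on a finite function space. There
    conditioning becomes resampling of one coordinate, and independence becomes the deterministic
    statement that changing one sample leaves a function unchanged. *)

Section Simplex.
Context {R : realType} {A : finType}.
Implicit Types (x y p g : A -> R).

Lemma dotpDl g1 g2 p : dotp (g1 \+ g2) p = dotp g1 p + dotp g2 p.
Proof. by rewrite /dotp -big_split; apply: eq_bigr => a _; rewrite mulrDl. Qed.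

Lemma dotpBl g1 g2 p : dotp (g1 \- g2) p = dotp g1 p - dotp g2 p.
Proof. by rewrite /dotp -sumrB; apply: eq_bigr => a _; rewrite mulrBl. Qed.

Lemma dotpBr g p q : dotp g (p \- q) = dotp g p - dotp g q.
Proof. by rewrite /dotp -sumrB; apply: eq_bigr => a _; rewrite mulrBr. Qed.

Lemma dotpZl c g p : dotp (fun a => c * g a) p = c * dotp g p.
Proof. by rewrite /dotp mulr_sumr; apply: eq_bigr => a _; rewrite mulrA. Qed.

Lemma dotpZr c g p : dotp g (fun a => c * p a) = c * dotp g p.
Proof. by rewrite /dotp mulr_sumr; apply: eq_bigr => a _; rewrite mulrCA. Qed.

Lemma ler_dotp g1 g2 p : simplex p -> (forall a, g1 a <= g2 a) ->
  dotp g1 p <= dotp g2 p.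
Proof. by move=> [p0 _] le12; apply: ler_sum => a _; apply: ler_wpM2r. Qed.

Lemma dotp_cst c p : simplex p -> dotp (fun=> c) p = c.
Proof. by move=> [_ p1]; rewrite /dotp -mulr_sumr p1 mulr1. Qed.

Lemma dotp_le g p c : simplex p -> (forall a, g a <= c) -> dotp g p <= c.
Proof. by move=> sp gc; rewrite -[leRHS](dotp_cst c sp); exact: ler_dotp. Qed.

Lemma dotp_ge g p c : simplex p -> (forall a, c <= g a) -> c <= dotp g p.
Proof. by move=> sp gc; rewrite -[leLHS](dotp_cst c sp); exact: ler_dotp. Qed.

Lemma l1norm_ge0 x : 0 <= l1norm x.
Proof. exact: sumr_ge0. Qed.

Lemma l1normZ c x : l1norm (fun a => c * x a) = `|c| * l1norm x.
Proof. by rewrite /l1norm mulr_sumr; apply: eq_bigr => a _; rewrite normrM. Qed.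

Lemma ler_dotp_l1norm g x c : (forall a, `|g a| <= c) ->
  dotp g x <= c * l1norm x.
Proof.
move=> gc; rewrite /dotp /l1norm mulr_sumr; apply: ler_sum => a _.
by rewrite (le_trans (ler_norm _))// normrM ler_wpM2r.
Qed.

Definition segment (l : R) x y : A -> R := fun a => (1 - l) * x a + l * y a.

Lemma simplex_segment l x y : 0 <= l <= 1 -> simplex x -> simplex y ->
  simplex (segment l x y).
Proof.
move=> /andP[l0 l1] [x0 x1] [y0 y1]; split=> [a|].
  by rewrite addr_ge0 ?mulr_ge0 ?subr_ge0.
by rewrite /segment big_split/= -!mulr_sumr x1 y1; ring.
Qed.

Lemma dotp_segment g l x y :
  dotp g (segment l x y) = (1 - l) * dotp g x + l * dotp g y.
Proof.
rewrite /dotp !mulr_sumr -big_split; apply: eq_bigr => a _.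
by rewrite /segment /=; ring.
Qed.

(** Convexity of [f - kappa * omega], that is, strong convexity relative to [omega]. No derivative
    of [f] occurs, so a nonsmooth regularizer is covered and adding a linear term changes
    nothing. *)
Definition convex_relative kappa (omega f : (A -> R) -> R) :=
  forall x y l, simplex x -> simplex y -> 0 <= l <= 1 ->
    f (segment l x y) - kappa * omega (segment l x y) <=
    (1 - l) * (f x - kappa * omega x) + l * (f y - kappa * omega y).

End Simplex.
Lemma cvg_sumr (R : realType) (I T : Type) (F : set_system T) (r : seq I)
    (f : I -> T -> R) (l : I -> R) : Filter F ->
  (forall i, f i x @[x --> F] --> l i) ->
  \sum_(i <- r) f i x @[x --> F] --> \sum_(i <- r) l i.
Proof.
move=> FF fl; elim: r => [|i r IH].
  under eq_fun do rewrite big_nil; rewrite big_nil; exact: cvg_cst.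
by under eq_fun do rewrite big_cons; rewrite big_cons; exact: cvgD.
Qed.

(** * Topology of the simplex and optimality conditions on it *)

Section SimplexTopology.
Context {R : realType} {A : finType}.
Implicit Types (x y p g : A -> R) (omega f h : (A -> R) -> R).

Lemma continuous_eval (a : A) : continuous (fun p : {ptws A -> R} => p a).
Proof. exact: (@proj_continuous _ (fun=> R) a). Qed.

Lemma continuous_dotp g : continuous (fun p : {ptws A -> R} => dotp g p).
Proof.
move=> p; apply: (@cvg_sumr R A _ (nbhs p) _ (fun a q => g a * q a)) => a.
by apply: cvgM; [exact: cvg_cst|exact: continuous_eval].
Qed.

Lemma simplex_compact : compact (simplex : set {ptws A -> R}).
Proof.
have cb : compact [set p : {ptws A -> R} | forall a, p a \in `[0, 1]].
  apply: (@tychonoff A (fun=> R) (fun=> [set` `[0 : R, 1]])) => _.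
  exact: segment_compact.
apply: (subclosed_compact _ cb) => [|p [p0 p1] a]; last first.
  rewrite in_itv/= p0 /= -p1 (bigD1 a)//= lerDl; exact: sumr_ge0.
have -> : (simplex : set {ptws A -> R}) =
    (\bigcap_a [set p : {ptws A -> R} | 0 <= p a]) `&`
    [set p : {ptws A -> R} | \sum_a p a = 1].
  apply/seteqP; split=> p /= [p0 p1]; split=> // a; [by move=> _; exact: p0|].
  exact: p0.
apply: closedI; first apply: closed_bigI => a _.
  apply: (@preimage_closed _ _ (fun p : {ptws A -> R} => p a) [set z | 0 <= z]).
    by move=> p _; exact: continuous_eval.
  exact: closed_ge.
have sc : continuous (fun p : {ptws A -> R} => \sum_a p a).
  move=> p; apply: (@cvg_sumr R A _ (nbhs p) _ (fun a q => q a)) => a.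
  exact: continuous_eval.
apply: (@preimage_closed _ _ (fun p : {ptws A -> R} => \sum_a p a) [set 1]).
  by move=> p _; exact: sc.
exact: closed_eq.
Qed.

(** Compactness and continuity provide a minimizer, so [argmin_simplex] never falls back on [x0]. *)
Lemma argmin_simplexP x0 f : (exists x, simplex x) -> continuous_on_simplex f ->
  simplex (argmin_simplex x0 f : A -> R) /\
  forall y, simplex y -> f (argmin_simplex x0 f) <= f y.
Proof.
move=> ex cf.
have [c cin cmin] := @compact_EVT_min {ptws A -> R} R f simplex ex simplex_compact cf.
apply: (@xgetPex _ x0 [set x | simplex x /\ forall y, simplex y -> f x <= f y]).
by exists c; split=> [|y sy]; [rewrite inE in cin|apply: cmin; rewrite inE].
Qed.

Lemma continuous_l1normB x :
  continuous (fun p : {ptws A -> R} => l1norm (p \- x)).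
Proof.
move=> p.
apply: (@cvg_sumr R A _ (nbhs p) _ (fun a q => `|q a - x a|)) => a.
apply: cvg_norm.
by apply: cvgB; [exact: continuous_eval|exact: cvg_cst].
Qed.

Lemma within_simplex_filter x :
  Filter (within simplex (nbhs (x : {ptws A -> R}))).
Proof. exact: (@within_filter _ _ _ (nbhs_filter (x : {ptws A -> R}))). Qed.

Lemma continuous_onT f : continuous (f : {ptws A -> R} -> R) ->
  continuous_on_simplex f.
Proof. exact: continuous_subspaceT. Qed.

Lemma continuous_onD f1 f2 : continuous_on_simplex f1 ->
  continuous_on_simplex f2 -> continuous_on_simplex (f1 \+ f2).
Proof.
by move=> c1 c2 x; apply: (@cvgD _ _ _ (nbhs x)); [exact: c1|exact: c2].
Qed.

Lemma continuous_onZ c f : continuous_on_simplex f ->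
  continuous_on_simplex (fun x => c * f x).
Proof.
by move=> cf x; apply: (@cvgM _ _ (nbhs x)); [exact: cvg_cst|exact: cf].
Qed.

(** Precision 1 in the first-order expansion is enough: the linear term and the remainder
    [l1norm (y \- x)] both tend to 0. *)
Lemma gradient_continuous omega gomega :
  is_gradient_on_simplex omega gomega -> continuous_on_simplex omega.
Proof.
move=> grad; apply/subspace_continuousP => x sx; have FF := within_simplex_filter x.
pose F := nbhs (x : {ptws A -> R}).
have FX : Filter F by exact: nbhs_filter.
have cg := @cvg_within_filter {ptws A -> R} R (dotp (gomega x)) F FX _ simplex
  (@continuous_dotp (gomega x) x).
have cl := @cvg_within_filter {ptws A -> R} R (fun y => l1norm (y \- x)) F FX _
  simplex (@continuous_l1normB x x).
have l0 : l1norm (x \- x) = 0.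
  by rewrite /l1norm big1// => a _; rewrite /= subrr normr0.
apply/cvgrPdist_le => e e0.
have e20 : 0 < e / 2 by lra.
move/cvgrPdist_le: cg => /(_ _ e20) cg.
move/cvgrPdist_le: cl => /(_ _ e20) cl.
near=> y.
have h1 : `|dotp (gomega x) x - dotp (gomega x) y| <= e / 2.
  by near: y.
have h2 : `|l1norm (x \- x) - l1norm (y \- x)| <= e / 2 by near: y.
have h3 : `|omega y - omega x - dotp (gomega x) (y \- x)|
    <= 1 * l1norm (y \- x).
  by near: y; exact: grad.
suff : `|omega x - omega y| <= e by [].
move: h1 h2 h3; rewrite l0 sub0r normrN (ger0_norm (l1norm_ge0 _)) mul1r dotpBr.
by rewrite !ler_norml => /andP[? ?] h2 /andP[? ?]; apply/andP; split; lra.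
Unshelve. all: by end_near. Qed.

Lemma bregman_continuous omega gomega x :
  is_gradient_on_simplex omega gomega ->
  continuous_on_simplex (bregman omega gomega x).
Proof.
move=> /gradient_continuous co.
have -> : bregman omega gomega x = omega \+
    ((fun y => -1 * dotp (gomega x) y) \+ cst (dotp (gomega x) x - omega x)).
  by apply/funext => y; rewrite /bregman dotpBr /=; ring.
apply: continuous_onD => //; apply: continuous_onD.
  by apply: continuous_onZ; apply: continuous_onT; exact: continuous_dotp.
by apply: continuous_onT; exact: (@cst_continuous {ptws A -> R} R).
Qed.

Lemma continuous_segment x y : continuous (fun l : R =>
  segment l x y : {ptws A -> R}).
Proof.
move=> l; apply/cvg_sup => a; apply/cvg_image.
  by apply/seteqP; split=> // z _; exists (fun=> z).
have ca : (fun l => segment l x y a) @ l --> (segment l x y a : R).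
  rewrite /segment; apply: cvgD; apply: cvgM; try exact: cvg_cst.
    by apply: cvgB; [exact: cvg_cst|exact: cvg_id].
  exact: cvg_id.
move=> W /= Wa; rewrite nbhs_simpl; exists (@^~ a @^-1` W); first exact: ca.
by apply/seteqP; split=> [z [? + <-//]|z Wz]; exists (fun=> z).
Qed.

(* The directional derivative of [omega] at [x] is all the optimality condition
   needs, so one point of the segment per precision [e] suffices. *)
Lemma gradient_segment omega gomega x y (e : R) :
  is_gradient_on_simplex omega gomega -> simplex x -> simplex y -> 0 < e ->
  exists2 l : R, 0 < l <= 1 &
    omega (segment l x y) - omega x <=
    l * (dotp (gomega x) (y \- x) + e * l1norm (y \- x)).
Proof.
move=> grad sx sy e0.
have s0 : segment 0 x y = x.
  by apply/funext => a; rewrite /segment subr0 mul1r mul0r addr0.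
have Ne : \forall l \near (0 : R), 0 <= l <= 1 ->
    `|omega (segment l x y) - omega x - dotp (gomega x) (segment l x y \- x)|
    <= e * l1norm (segment l x y \- x).
  have cs : (fun l : R => segment l x y : {ptws A -> R}) @ (0 : R) -->
      (x : {ptws A -> R}).
    by have := @continuous_segment x y 0; rewrite /continuous_at s0.
  have := cs _ (grad x sx e e0).
  apply: (@filterS _ (nbhs (0 : R)) (nbhs_filter _)) => l /= H l01.
  by apply: H; exact: simplex_segment.
move: Ne => /nbhs_ballP[r /= r0 /= Br].
pose l := Num.min (r / 2) 1.
have l0 : 0 < l by rewrite lt_min ltr01 andbT divr_gt0.
have l1 : l <= 1 by rewrite ge_min lexx orbT.
exists l; first by rewrite l0.
have : ball (0 : R) r l.
  rewrite /ball /= sub0r normrN gtr0_norm//.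
  rewrite (@le_lt_trans _ _ (r / 2)) ?ge_min ?lexx//; lra.
move=> /Br; rewrite (ltW l0) l1 => /(_ isT).
have -> : segment l x y \- x = (fun a => l * (y \- x) a).
  by apply/funext => a; rewrite /segment /=; ring.
rewrite dotpZr l1normZ (ger0_norm (ltW l0)) ler_norml => /andP[_]; lra.
Qed.

(** The three-point inequality of mirror descent. Minimality is tested at a point of the segment
    towards [y], relative convexity bounds [F] there, and the expansion of [omega] at [x] bounds
    what remains; dividing by [l] leaves an error proportional to an arbitrary [e]. [F] itself is
    never differentiated. *)
Lemma minimizer_bregman omega gomega (F : (A -> R) -> R) kappa x y :
  is_gradient_on_simplex omega gomega -> 0 <= kappa ->
  convex_relative kappa omega F ->
  simplex x -> (forall z, simplex z -> F x <= F z) -> simplex y ->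
  F x + kappa * bregman omega gomega x y <= F y.
Proof.
move=> grad k0 cF sx xmin sy.
have main (e : R) : 0 < e -> F x + kappa * (bregman omega gomega x y -
    e * l1norm (y \- x)) <= F y.
  move=> e0; have [l /andP[l0 l1] ol] := gradient_segment grad sx sy e0.
  have l01 : 0 <= l <= 1 by rewrite (ltW l0).
  have := xmin _ (simplex_segment l01 sx sy).
  have := cF x y l sx sy l01.
  have := ler_wpM2l k0 ol.
  rewrite -(ler_pM2l l0) /bregman.
  nra.
rewrite -lerBrDl; apply/ler_addgt0Pr => e e0.
have n0 := l1norm_ge0 (y \- x).
have d0 : 0 < kappa * l1norm (y \- x) + 1 by rewrite ltr_wpDl// mulr_ge0.
(* Chosen so that the error [kappa * l1norm (y \- x)] times it stays below [e]; the 1 keeps the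
   denominator positive. *)
have := main (e / (kappa * l1norm (y \- x) + 1)) (divr_gt0 e0 d0).
have : kappa * (e / (kappa * l1norm (y \- x) + 1) * l1norm (y \- x)) <= e.
  rewrite mulrCA [leLHS]mulrC mulrA mulrAC.
  by rewrite -[leRHS]mul1r ler_wpM2r ?(ltW e0)// ler_pdivrMr//; lra.
nra.
Qed.

Lemma bregman_ge omega gomega x y : l1_strongly_convex omega gomega ->
  simplex x -> simplex y ->
  2^-1 * l1norm (y \- x) ^+ 2 <= bregman omega gomega x y.
Proof. by move=> sc sx sy; rewrite /bregman; have := sc x y sx sy; lra. Qed.

Lemma bregman_ge0 omega gomega x y : l1_strongly_convex omega gomega ->
  simplex x -> simplex y -> 0 <= bregman omega gomega x y.
Proof.
move=> sc sx sy; apply: le_trans (bregman_ge sc sx sy).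
by rewrite mulr_ge0// ?sqr_ge0// invr_ge0.
Qed.

Lemma convex_relativeD kappa omega f g : convex_relative kappa omega f ->
  convex_relative kappa omega (fun p => dotp g p + f p).
Proof.
move=> cf x y l sx sy l01; have := cf x y l sx sy l01.
by rewrite dotp_segment; nra.
Qed.

(** Up to an affine function [bregman omega gomega x] is [omega], which adds 1 to the modulus. *)
Lemma convex_relative_prox kappa omega gomega f eta x : 0 <= eta ->
  convex_relative kappa omega f ->
  convex_relative (1 + eta * kappa) omega
    (fun p => eta * f p + bregman omega gomega x p).
Proof.
move=> eta0 cf z y l sz sy l01; have := ler_wpM2l eta0 (cf z y l sz sy l01).
rewrite /bregman !dotpBr dotp_segment; nra.
Qed.

(** The subgradient inequalities at the point of the segment, towards [x] and towards [y], are
    averaged, and the subgradient terms cancel. Constant policies carry the assumption from policies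
    to points. *)
Lemma strongly_convex_relative (S : finType) (s : S) h
    (h' : (A -> R) -> (A -> R)) mu omega gomega :
  strongly_convex_wrt_bregman S h h' mu omega gomega ->
  convex_relative mu omega h.
Proof.
move=> [_ sc] x y l sx sy l01; have sz := simplex_segment l01 sx sy.
have sc' p : simplex p -> _ :=
  fun sp => sc (fun=> p) (fun=> segment l x y) (fun=> sp) (fun=> sz) s.
have /andP[l0 l1] := l01; have l1' : 0 <= 1 - l by rewrite subr_ge0.
have := ler_wpM2l l1' (sc' x sx); have := ler_wpM2l l0 (sc' y sy).
rewrite /bregman_policy /bregman !dotpBr !dotp_segment; nra.
Qed.

End SimplexTopology.

(** * Bellman equations *)

Section Substochastic.
Context {R : realType} {S : finType}.
Implicit Types (Q : S -> S -> R) (V r f : S -> R) (g : R).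

(** Row sums below 1 are allowed because leaving out a state replaces its row by 0. *)
Definition substochastic Q :=
  (forall s s', 0 <= Q s s') /\ forall s, \sum_s' Q s s' <= 1.

Definition bellman g Q r V : S -> R := fun s => r s + g * \sum_s' Q s s' * V s'.

Lemma bellmanB g Q r1 r2 V1 V2 s :
  bellman g Q r1 V1 s - bellman g Q r2 V2 s =
  bellman g Q (r1 \- r2) (V1 \- V2) s.
Proof.
rewrite /bellman (_ : \sum_s' Q s s' * (V1 \- V2) s' =
  \sum_s' Q s s' * V1 s' - \sum_s' Q s s' * V2 s') /=; first by ring.
by rewrite -sumrB; apply: eq_bigr => s' _; rewrite mulrBr.
Qed.

Lemma substochastic_le Q V c s : substochastic Q -> 0 <= c ->
  (forall s', V s' <= c) -> \sum_s' Q s s' * V s' <= c.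
Proof.
move=> [Q0 Q1] c0 Vc; apply: (@le_trans _ _ (\sum_s' Q s s' * c)).
  by apply: ler_sum => s' _; apply: ler_wpM2l.
by rewrite -mulr_suml -[leRHS]mul1r ler_wpM2r.
Qed.

(** Maximum principle: the inequality is read at a state where [f] is maximal; a negative maximum is
    harmless since [0 <= y]. Most comparisons of values below reduce to it. *)
Lemma substochastic_subsolution g Q f y : 0 <= g < 1 -> substochastic Q ->
  0 <= y -> (forall s, f s <= g * \sum_s' Q s s' * f s' + y) ->
  forall s, f s <= y / (1 - g).
Proof.
move=> /andP[g0 g1] sQ y0 fle s; have g1' : 0 < 1 - g by rewrite subr_gt0.
have [i _ imax] := @arg_maxP _ _ _ s xpredT f isT.
apply: le_trans (imax s isT) _; rewrite ler_pdivlMr//.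
have [fi0|fi0] := leP 0 (f i); last by nra.
have := substochastic_le i sQ fi0 (fun s' => imax s' isT).
have := fle i; nra.
Qed.

Lemma bellman_unique g Q r V1 V2 : 0 <= g < 1 -> substochastic Q ->
  (forall s, V1 s = bellman g Q r V1 s) -> (forall s, V2 s = bellman g Q r V2 s) ->
  forall s, V1 s = V2 s.
Proof.
move=> g01 sQ e1 e2 s.
have le0 W1 W2 : (forall s, W1 s = bellman g Q r W1 s) ->
    (forall s, W2 s = bellman g Q r W2 s) -> W1 s <= W2 s.
  move=> f1 f2; rewrite -subr_le0 -[leRHS](mul0r (1 - g)^-1).
  apply: (@substochastic_subsolution g Q (fun s => W1 s - W2 s)) => // s'.
  by rewrite {1}f1 f2 bellmanB /bellman /=; lra.
by apply/le_anti; rewrite !le0.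
Qed.

Fixpoint value_iteration g Q r n : S -> R :=
  if n is n'.+1 then bellman g Q r (value_iteration g Q r n') else fun=> 0.

Lemma bellman_mono g Q r V1 V2 s : 0 <= g -> substochastic Q ->
  (forall s', V1 s' <= V2 s') -> bellman g Q r V1 s <= bellman g Q r V2 s.
Proof.
move=> g0 [Q0 _] V12; rewrite lerD2l ler_wpM2l//; apply: ler_sum => s' _.
exact: ler_wpM2l.
Qed.

(** Started at 0, the iterates increase and stay bounded; their limit is a fixed point by
    continuity. The convergence is kept in the conclusion because the iterates are the expected
    costs of truncated trajectories. *)
Lemma value_iteration_cvg g Q r : 0 <= g < 1 -> substochastic Q ->
  (forall s, 0 <= r s) ->
  exists2 V, forall s, V s = bellman g Q r V s &
    forall s, value_iteration g Q r n s @[n --> \oo] --> V s.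
Proof.
move=> /andP[g0 g1] sQ r0; set v := value_iteration g Q r.
have g1' : 0 < 1 - g by rewrite subr_gt0.
pose B := \sum_s r s; have B0 : 0 <= B by exact: sumr_ge0.
have rB s : r s <= B by rewrite /B (bigD1 s)//= lerDl sumr_ge0.
have vB n s : v n s <= B / (1 - g).
  elim: n s => [|n IH] s; first by rewrite divr_ge0// ltW.
  suff : bellman g Q r (v n) s <= B / (1 - g) by [].
  have := substochastic_le s sQ (divr_ge0 B0 (ltW g1')) IH.
  rewrite /bellman => /(ler_wpM2l g0); have := rB s.
  have : B / (1 - g) = B + g * (B / (1 - g)) by field; rewrite lt0r_neq0.
  lra.
have vS n s : v n s <= v n.+1 s.
  elim: n s => [|n IH] s; last exact: bellman_mono.
  suff : 0 <= bellman g Q r (fun=> 0) s by [].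
  by rewrite /bellman big1 ?mulr0 ?addr0// => s' _; rewrite mulr0.
have cv s : cvgn (v ^~ s).
  apply: nondecreasing_is_cvgn; first exact/nondecreasing_seqP.
  by exists (B / (1 - g)) => _ [n _ <-].
exists (fun s => limn (v ^~ s)); last by move=> s; exact: cv.
move=> s; have c1 : v n.+1 s @[n --> \oo] --> limn (v ^~ s).
  by rewrite (cvg_shiftS (v ^~ s)); exact: cv.
apply: (cvg_unique _ c1) => //; apply: cvgD; first exact: cvg_cst.
apply: cvgM; first exact: cvg_cst.
apply: (@cvg_sumr R S nat \oo _ (fun s' n => Q s s' * v n s')) => s'.
by apply: cvgM; [exact: cvg_cst|exact: cv].
Qed.

Lemma bellman_solution g Q r : 0 <= g < 1 -> substochastic Q ->
  exists V, forall s, V s = bellman g Q r V s.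
Proof.
move=> g01 sQ.
(* Value iteration asks for nonnegative costs, so [r] is split into a difference of two of them. *)
have [|V1 e1 _] := @value_iteration_cvg g Q (fun s => Num.max (r s) 0) g01 sQ.
  by move=> s; rewrite le_max lexx orbT.
have [|V2 e2 _] := @value_iteration_cvg g Q (fun s => Num.max (r s) 0 - r s) g01 sQ.
  by move=> s; rewrite subr_ge0 le_max lexx.
exists (V1 \- V2) => s; rewrite /= {1}e1 e2 bellmanB; congr (_ + _).
by rewrite /=; ring.
Qed.

Definition bellman_fix g Q r : S -> R :=
  xget (fun=> 0) [set V : S -> R | forall s, V s = bellman g Q r V s].

Lemma bellman_fixE g Q r : 0 <= g < 1 -> substochastic Q ->
  forall s, bellman_fix g Q r s = bellman g Q r (bellman_fix g Q r) s.
Proof.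
move=> g01 sQ; have [V eV] := bellman_solution r g01 sQ.
exact: (@xgetPex _ _ [set V : S -> R | forall s, V s = bellman g Q r V s]
  (ex_intro _ V eV)).
Qed.

Lemma bellman_fix_ge0 g Q r s : 0 <= g < 1 -> substochastic Q ->
  (forall s, 0 <= r s) -> 0 <= bellman_fix g Q r s.
Proof.
move=> g01 sQ r0; rewrite -oppr_le0 -[leRHS](mul0r (1 - g)^-1).
apply: (@substochastic_subsolution g Q (fun s => - bellman_fix g Q r s)) => // s'.
rewrite bellman_fixE// {1}/bellman.
under [X in _ <= g * X + _]eq_bigr do rewrite mulrN.
by rewrite sumrN; have := r0 s'; lra.
Qed.

Lemma bellman_fix_le g Q r B s : 0 <= g < 1 -> substochastic Q -> 0 <= B ->
  (forall s, r s <= B) -> bellman_fix g Q r s <= B / (1 - g).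
Proof.
move=> g01 sQ B0 rB; apply: (substochastic_subsolution g01 sQ B0) => s'.
by rewrite bellman_fixE// /bellman; have := rB s'; lra.
Qed.

(* Fixing the value at one state makes the dependence on its row affine, with
   coefficients that ignore this row. *)
Lemma bellman_leave_one_out g Q r V s0 : 0 <= g < 1 -> substochastic Q ->
  (forall s, V s = bellman g Q r V s) ->
  let Q' := fun s s' => if s == s0 then 0 else Q s s' in
  forall s, V s = bellman_fix g Q' (fun s => if s == s0 then 0 else r s) s +
                  V s0 * bellman_fix g Q' (fun s => (s == s0)%:R) s.
Proof.
move=> g01 sQ eV Q'.
have sQ' : substochastic Q'.
  have [Q0 Q1] := sQ; split=> [s s'|s]; rewrite /Q'.
    by case: ifP.
  have [_|_] := eqVneq s s0; last exact: Q1.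
  by rewrite big1.
(* Once the row at [s0] is 0, the number [V s0] becomes a prescribed cost there. Both sides solve
   this modified equation, whose solution is unique. *)
pose r' s := if s == s0 then V s0 else r s.
apply: (@bellman_unique g Q' r') => // s.
  rewrite {1}eV /bellman /r' /Q'; case: eqP => [->|//].
  by rewrite [in RHS]big1 ?mulr0 ?addr0 ?[RHS]eV// => s' _; rewrite mul0r.
rewrite {1}bellman_fixE// (bellman_fixE _ g01 sQ') /bellman.
rewrite (_ : \sum_s' Q' s s' * (_ + _) =
  \sum_s' Q' s s' * bellman_fix g Q' (fun s => if s == s0 then 0 else r s) s' +
  V s0 * \sum_s' Q' s s' * bellman_fix g Q' (fun s => (s == s0)%:R) s').
  by rewrite /r'; case: eqP => _; rewrite /=; ring.
by rewrite mulr_sumr -big_split; apply: eq_bigr => s' _ /=; ring.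
Qed.

End Substochastic.

(** * Values of policies *)

Lemma measure_partition d (Om : measurableType d) (R : realType)
    (Pr : probability Om R) (I : finType) (X : Om -> I) (E : set Om) :
  (forall i, measurable [set w | X w = i]) -> measurable E ->
  fine (Pr E) = \sum_i fine (Pr (E `&` [set w | X w = i])).
Proof.
move=> mX mE.
have mEX i : measurable (E `&` [set w | X w = i]) by exact: measurableI.
have -> : Pr E = (\sum_i Pr (E `&` [set w | X w = i]))%E.
  rewrite [in RHS](@fsbig_seq _ _ _ I (index_enum I)) ?index_enum_uniq//.
  rewrite -measure_fin_bigcup//.
  - congr (Pr _); apply/seteqP; split=> [w Ew|w [i _ []//]].
    by exists (X w) => //=; exact: mem_index_enum.
  - move=> i j _ _ [w /= [[_ <-] [_ <-]]]; reflexivity.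
rewrite (eq_bigr (fun i => (fine (Pr (E `&` [set w | X w = i])))%:E)).
  by rewrite sumEFin.
by move=> i _; rewrite fineK// fin_num_measure.
Qed.

Section PolicyValue.
Context {R : realType} {S A : finType}.
Variables (M : mdp R S A) (h : (A -> R) -> R) (hbar : R).
Hypothesis h_itv : forall x, simplex x -> 0 <= h x <= hbar.
Local Notation g := (discount M).

Definition policy_kernel (K : S -> A -> S -> R) (pi : S -> A -> R) s s' :=
  \sum_a pi s a * K s a s'.

Definition policy_cost (pi : S -> A -> R) s := dotp (cost M s) (pi s) + h (pi s).

Lemma policy_kernel_substochastic K pi : (forall s a, simplex (K s a)) ->
  is_policy pi -> substochastic (policy_kernel K pi).
Proof.
move=> sK spi; split=> [s s'|s].
  by apply: sumr_ge0 => a _; rewrite mulr_ge0 ?(spi s).1 ?(sK s a).1.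
rewrite exchange_big /= -(spi s).2; apply: ler_sum => a _.
by rewrite -mulr_sumr (sK s a).2 mulr1.
Qed.

Lemma policy_kernelE K pi V s : \sum_s' policy_kernel K pi s s' * V s' =
  dotp (kernel_mul K V s) (pi s).
Proof.
rewrite /policy_kernel /dotp /kernel_mul.
under eq_bigr do rewrite mulr_suml.
rewrite exchange_big; apply: eq_bigr => a _.
by rewrite [RHS]mulr_suml; apply: eq_bigr => s' _; ring.
Qed.

Definition qobj (G : S -> A -> R) s (p : A -> R) :=
  dotp (fun a => cost M s a + g * G s a) p + h p.

Lemma qobj_bellman K pi V s : qobj (kernel_mul K V) s (pi s) =
  bellman g (policy_kernel K pi) (policy_cost pi) V s.
Proof.
by rewrite /qobj dotpDl dotpZl /bellman policy_kernelE /policy_cost; ring.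
Qed.

Lemma policy_evaluationE K pi :
  policy_evaluation M h K pi = bellman_fix g (policy_kernel K pi) (policy_cost pi).
Proof.
rewrite /policy_evaluation /bellman_fix; congr (xget _ _).
apply/seteqP; split=> V VE s; first by rewrite -qobj_bellman; exact: VE.
by rewrite {1}VE -qobj_bellman.
Qed.

Lemma policy_cost_itv pi s : is_policy pi -> 0 <= policy_cost pi s <= 1 + hbar.
Proof.
move=> spi; have /andP[h0 h1] := h_itv (spi s).
have c0 : 0 <= dotp (cost M s) (pi s).
  by apply: dotp_ge => // a; have /andP[] := cost_itv M s a.
have c1 : dotp (cost M s) (pi s) <= 1.
  by apply: dotp_le => // a; have /andP[] := cost_itv M s a.
by rewrite /policy_cost; apply/andP; split; lra.
Qed.

Section Trajectory.
Context d (Om : measurableType d) (Pr : probability Om R).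
Variables (st : nat -> Om -> S) (ac : nat -> Om -> A).
Variables (pi : S -> A -> R) (s : S).
Hypothesis spi : is_policy pi.
Hypothesis traj : trajectory_law M Pr st ac pi s.

Definition prefix (n : nat) (x : nat -> S) (b : nat -> A) : set Om :=
  [set w | forall t, (t <= n)%N -> st t w = x t /\ ac t w = b t].

Definition step (t : nat) (w : Om) : S * A := (st t w, ac t w).

Lemma measurable_step t i : measurable [set w | step t w = i].
Proof.
have [mst mac _] := traj; case: i => x b.
rewrite (_ : [set w | _] = [set w | st t w = x] `&` [set w | ac t w = b]).
  exact: measurableI.
by apply/seteqP; split=> w /=; [case=> -> ->|case=> <- <-].
Qed.

Lemma prefixS n x b : prefix n.+1 x b =
  prefix n x b `&` [set w | step n.+1 w = (x n.+1, b n.+1)].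
Proof.
apply/seteqP; split=> w /=.
  move=> H; split=> [t tn|]; first exact/H/leqW.
  by rewrite /step; have [-> ->] := H n.+1 (leqnn _).
move=> [H [e1 e2]] t; rewrite leq_eqVlt => /predU1P[->//|]; exact: H.
Qed.

Lemma measurable_prefix n x b : measurable (prefix n x b).
Proof.
elim: n => [|n IH]; last by rewrite prefixS; apply: measurableI => //; exact: measurable_step.
rewrite (_ : prefix 0 x b = [set w | step 0 w = (x 0%N, b 0%N)]).
  exact: measurable_step.
apply/seteqP; split=> w /=; first by move=> /(_ 0%N isT) [e1 e2]; rewrite /step e1 e2.
by move=> [e1 e2] t; rewrite leqn0 => /eqP ->.
Qed.

Lemma eq_prefix n x b x' b' : (forall t, (t <= n)%N -> x t = x' t /\ b t = b' t) ->
  prefix n x b = prefix n x' b'.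
Proof.
move=> e; apply/seteqP; split=> w H t tn; have [e1 e2] := e t tn.
  by rewrite -e1 -e2; exact: H.
by rewrite e1 e2; exact: H.
Qed.

(** The transition operator of the state-action chain: the conditional expectation of [f] one step
    later. *)
Definition forward (f : S * A -> R) : S * A -> R :=
  fun i => \sum_x trans M i.1 i.2 x * \sum_b pi x b * f (x, b).

(** The Markov property, read off the finite-dimensional marginals by extending the prefix one step
    at a time. Joint probabilities replace conditional ones because a prefix may have probability
    0. *)
Lemma prefix_forward k n x b f :
  \sum_j fine (Pr (prefix n x b `&` [set w | step (n + k) w = j])) * f j =
  fine (Pr (prefix n x b)) * iter k forward f (x n, b n).
Proof.
elim: k n x b => [|k IH] n x b.
  rewrite (bigD1 (x n, b n))//= big1 ?addr0 => [|j jn].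
    rewrite addn0; congr (fine (Pr _) * _); apply/seteqP; split=> w; first by case.
    by move=> H; split=> //=; rewrite /step; have [-> ->] := H n (leqnn n).
  rewrite (_ : _ `&` _ = set0) ?measure0 ?mul0r//.
  apply/seteqP; split=> // w /= [] /(_ n (leqnn n)) [e1 e2].
  by rewrite addn0 /step e1 e2 => e; rewrite e eqxx in jn.
pose x' y t := if t == n.+1 then y else x t.
pose b' c t := if t == n.+1 then c else b t.
have pS y c : prefix n.+1 (x' y) (b' c) =
    prefix n x b `&` [set w | step n.+1 w = (y, c)].
  rewrite prefixS /x' /b' eqxx; congr (_ `&` _); apply: eq_prefix => t tn.
  by rewrite ltn_eqF.
have mP j t : measurable (prefix n x b `&` [set w | step t w = j]).
  by apply: measurableI; [exact: measurable_prefix|exact: measurable_step].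
have PS y c : fine (Pr (prefix n.+1 (x' y) (b' c))) =
    fine (Pr (prefix n x b)) * (trans M (x n) (b n) y * pi y c).
  have [_ _ law] := traj; rewrite /prefix !law /=.
  rewrite [in LHS]big_nat_recr//= [\prod_(0 <= t < n.+1) trans _ _ _ _]big_nat_recr//=.
  rewrite {1 2}/x' /= {1}/b' /= /x' /b' !eqxx ltn_eqF//.
  rewrite [\prod_(0 <= t < n.+1) _](eq_big_nat _ _ (F2 := fun t => pi (x t) (b t))).
    rewrite [\prod_(0 <= t < n) _](eq_big_nat _ _
      (F2 := fun t => trans M (x t) (b t) (x t.+1))); first by ring.
    by move=> t /andP[_ tn]; rewrite !ltn_eqF// ltnS// ltnW.
  by move=> t /andP[_ tn]; rewrite ltn_eqF.
transitivity (\sum_i \sum_j fine (Pr (prefix n x b `&` [set w | step n.+1 w = i]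
    `&` [set w | step (n.+1 + k) w = j])) * f j).
  rewrite exchange_big; apply: eq_bigr => j _; rewrite -mulr_suml; congr (_ * _).
  rewrite -addSnnS (measure_partition Pr (measurable_step n.+1))//.
  by apply: eq_bigr => i _; rewrite setIAC.
rewrite iterS /forward mulr_sumr.
transitivity (\sum_y \sum_c fine (Pr (prefix n.+1 (x' y) (b' c))) *
    iter k forward f (y, c)).
  rewrite [RHS]pair_bigA; apply: eq_bigr => -[y c] _ /=; rewrite -pS IH.
  by rewrite /x' /b' !eqxx.
apply: eq_bigr => y _; rewrite mulrA mulr_sumr; apply: eq_bigr => c _.
by rewrite PS; ring.
Qed.

Lemma step_expectation k f :
  \sum_j fine (Pr [set w | step k w = j]) * f j =
  \sum_b pi s b * iter k forward f (s, b).
Proof.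
pose pre i := prefix 0 (fun=> i.1) (fun=> i.2).
have preE i : pre i = [set w | step 0 w = i].
  case: i => x b; apply/seteqP; split=> w /=.
    by move=> /(_ 0%N isT) [e1 e2]; rewrite /step e1 e2.
  by move=> [e1 e2] t; rewrite leqn0 => /eqP ->.
transitivity (\sum_i \sum_j fine (Pr (pre i `&` [set w | step k w = j])) * f j).
  rewrite exchange_big; apply: eq_bigr => j _; rewrite -mulr_suml; congr (_ * _).
  rewrite (measure_partition Pr (measurable_step 0)); last exact: measurable_step.
  by apply: eq_bigr => i _; rewrite preE setIC.
transitivity (\sum_x \sum_b ((x == s)%:R * pi x b) * iter k forward f (x, b)).
  rewrite [RHS]pair_bigA; apply: eq_bigr => -[x b] _ /=.
  have := prefix_forward k 0 (fun=> x) (fun=> b) f; rewrite add0n => ->.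
  have [_ _ law] := traj; rewrite /prefix law big_nat1 big_geq// mulr1.
  by [].
rewrite (bigD1 s)//= [X in _ + X]big1 ?addr0.
  by apply: eq_bigr => b _; rewrite eqxx mul1r.
by move=> x /negbTE xs; rewrite big1// => b _; rewrite xs !mul0r.
Qed.

End Trajectory.
End PolicyValue.

(** * The Bellman equation for the value of a policy *)

Section ValueBellman.
Context {R : realType} {S A : finType}.
Variables (M : mdp R S A) (h : (A -> R) -> R) (hbar : R).
Hypothesis h_itv : forall x, simplex x -> 0 <= h x <= hbar.
Local Notation g := (discount M).

Definition step_cost (pi : S -> A -> R) (i : S * A) : R := cost M i.1 i.2 + h (pi i.1).

Lemma step_cost_itv pi i : is_policy pi -> 0 <= step_cost pi i <= 1 + hbar.
Proof.
move=> spi; have /andP[h0 h1] := h_itv (spi i.1).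
have /andP[c0 c1] := cost_itv M i.1 i.2.
by rewrite /step_cost; apply/andP; split; lra.
Qed.

Lemma value_iteration_forward pi n s : is_policy pi ->
  value_iteration g (policy_kernel (trans M) pi) (policy_cost M h pi) n s =
  \sum_(0 <= t < n) g ^+ t * \sum_b pi s b * iter t (forward M pi) (step_cost pi) (s, b).
Proof.
move=> spi; elim: n s => [|n IH] s; first by rewrite big_geq.
rewrite big_nat_recl//= expr0 mul1r /bellman; congr (_ + _).
  rewrite /policy_cost /step_cost /=; under [RHS]eq_bigr do rewrite mulrDr.
  rewrite big_split /= -mulr_suml (spi s).2 mul1r /dotp; congr (_ + _).
  by apply: eq_bigr => b _; rewrite mulrC.
rewrite (eq_bigr (fun x => \sum_(0 <= t < n) policy_kernel (trans M) pi s x *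
  (g ^+ t * \sum_b pi x b * iter t (forward M pi) (step_cost pi) (x, b)))).
  rewrite exchange_big mulr_sumr; apply: eq_bigr => t _.
  rewrite exprS -mulrA; congr (_ * _); rewrite [in RHS]/forward /=.
  transitivity (\sum_x \sum_b g ^+ t * (pi s b * (trans M s b x *
    \sum_c pi x c * iter t (forward M pi) (step_cost pi) (x, c)))).
    apply: eq_bigr => x _; rewrite /policy_kernel mulr_suml.
    by apply: eq_bigr => b _; ring.
  rewrite exchange_big mulr_sumr; apply: eq_bigr => b _.
  by rewrite !mulr_sumr.
by move=> x _; rewrite IH mulr_sumr.
Qed.

(** Costs are nonnegative, so integral and series commute. Each term is an expectation at a fixed
    time, and the partial sums are the iterates of value iteration, whose limit solves the
    equation. *)
Lemma value_bellman dT (OmT : measurableType dT)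
    (PrT : (S -> A -> R) -> S -> probability OmT R)
    (st : nat -> OmT -> S) (ac : nat -> OmT -> A) pi :
  is_policy pi -> (forall s, trajectory_law M (PrT pi s) st ac pi s) ->
  forall s, value M h PrT st ac pi s =
    qobj M h (kernel_mul (trans M) (value M h PrT st ac pi)) s (pi s).
Proof.
move=> spi traj; have /andP[g0 g1] := discount_itv M.
have g01 : 0 <= g < 1 by rewrite (ltW g0).
have r0 s : 0 <= policy_cost M h pi s.
  by have /andP[] := policy_cost_itv M h_itv s spi.
have sQ := policy_kernel_substochastic (trans_simplex M) spi.
have [V VE cV] := value_iteration_cvg g01 sQ r0.
suff valV s : value M h PrT st ac pi s = V s.
  by move=> s; rewrite (funext valV) qobj_bellman -VE.
pose X t w := step_cost pi (step st ac t w).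
have X0 t w : 0 <= X t w by have /andP[] := step_cost_itv (step st ac t w) spi.
have X1 t w : X t w <= 1 + hbar by have /andP[] := step_cost_itv (step st ac t w) spi.
(* The series in [value] is a limit of reals; its convergence along every trajectory identifies it
   with the extended real sum. *)
have cX w : cvgn (series (fun t => g ^+ t * X t w)).
  apply: (@series_le_cvg _ _ (fun t => (1 + hbar) * g ^+ t)) => [t|t|t|].
  - by rewrite mulr_ge0 ?exprn_ge0 ?(ltW g0).
  - by rewrite mulr_ge0 ?exprn_ge0 ?(ltW g0)// (le_trans (X0 0%N w)).
  - by rewrite mulrC ler_wpM2r ?exprn_ge0 ?(ltW g0).
  by apply: is_cvg_geometric_series; rewrite ger0_norm ?(ltW g0).
have mX t i : measurable [set w | step st ac t w = i].
  exact: measurable_step (traj s) t i.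
rewrite /value unlock.
have -> : (fun w => (limn (series (fun t => g ^+ t *
      (cost M (st t w) (ac t w) + h (pi (st t w))))))%:E) =
    (fun w => \sum_(0 <= t <oo) (g ^+ t * X t w)%:E)%E.
  apply/funext => w; rewrite -EFin_lim; last exact: cX.
  by congr (limn _); apply/funext => n /=; rewrite sumEFin.
have XE t w : (g ^+ t * X t w)%:E =
    (\sum_i (g ^+ t * step_cost pi i)%:E * (\1_[set w | step st ac t w = i] w)%:E)%E.
  rewrite (bigD1 (step st ac t w))//= big1 ?adde0; last first.
    move=> i ine; rewrite indicE memNset ?mule0//= => e.
    by rewrite e eqxx in ine.
  by rewrite indicE mem_set// mule1.
pose J t i : OmT -> \bar R := fun w =>
  ((g ^+ t * step_cost pi i)%:E * (\1_[set w | step st ac t w = i] w)%:E)%E.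
have mI t i : measurable_fun setT (J t i).
  apply: emeasurable_funM; first exact: measurable_cst.
  by apply/measurable_EFinP; exact: measurable_indic.
have I0 t i w : (0 <= (g ^+ t * step_cost pi i)%:E *
    (\1_[set w | step st ac t w = i] w)%:E)%E.
  rewrite -EFinM lee_fin !mulr_ge0 ?exprn_ge0 ?(ltW g0)//.
  by have /andP[] := step_cost_itv i spi.
rewrite integral_nneseries//; last first.
- by move=> t w _; rewrite lee_fin mulr_ge0 ?exprn_ge0 ?(ltW g0).
- move=> t; rewrite (funext (XE t)); apply: emeasurable_sum => i; exact: mI.
have -> : (\sum_(0 <= t <oo) \int[PrT pi s]_w (g ^+ t * X t w)%:E)%E =
    (\sum_(0 <= t <oo) (g ^+ t * \sum_b pi s b *
       iter t (forward M pi) (step_cost pi) (s, b))%:E)%E.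
  apply: eq_eseriesr => t _.
  rewrite -(step_expectation (traj s)) mulr_sumr.
  under eq_integral do rewrite XE.
  rewrite ge0_integral_sum//; last by move=> i; exact: mI.
  rewrite -(sumEFin _ xpredT (fun i => g ^+ t *
    (fine (PrT pi s [set w | step st ac t w = i]) * step_cost pi i))).
  apply: eq_bigr => i _; rewrite ge0_integralZl_EFin//.
  - rewrite integral_indic// setIT -[X in (_ * X)%E]fineK ?fin_num_measure//.
    by rewrite -EFinM; congr EFin; ring.
  - by apply/measurable_EFinP; exact: measurable_indic.
  - rewrite mulr_ge0 ?exprn_ge0 ?(ltW g0)//.
    by have /andP[] := step_cost_itv i spi.
have -> : (\sum_(0 <= t <oo) (g ^+ t * \sum_b pi s b *
       iter t (forward M pi) (step_cost pi) (s, b))%:E)%E =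
    limn (EFin \o (fun n => value_iteration g (policy_kernel (trans M) pi)
       (policy_cost M h pi) n s)).
  congr (limn _); apply/funext => n.
  by rewrite /= sumEFin value_iteration_forward.
by rewrite EFin_lim; [rewrite (cvg_lim _ (cV s))|apply/cvg_ex; exists (V s)].
Qed.

End ValueBellman.

(** * Perturbed Markov decision processes *)

Section Perturbation.
Context {R : realType} {S A : finType}.
Variables (M : mdp R S A) (h : (A -> R) -> R).
Local Notation g := (discount M).
Local Notation P := (trans M).

Lemma kernel_mulB (K : S -> A -> S -> R) V1 V2 s a :
  kernel_mul K (V1 \- V2) s a = kernel_mul K V1 s a - kernel_mul K V2 s a.
Proof. by rewrite /kernel_mul -sumrB; apply: eq_bigr => s' _; rewrite mulrBr. Qed.

Lemma kernel_mul_le (K : S -> A -> S -> R) V c s a : simplex (K s a) ->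
  (forall s', V s' <= c) -> kernel_mul K V s a <= c.
Proof.
move=> sK Vc; rewrite /kernel_mul; under eq_bigr do rewrite mulrC.
exact: (@dotp_le _ _ V).
Qed.

Lemma kernel_mul_ge (K : S -> A -> S -> R) V c s a : simplex (K s a) ->
  (forall s', c <= V s') -> c <= kernel_mul K V s a.
Proof.
move=> sK Vc; rewrite /kernel_mul; under eq_bigr do rewrite mulrC.
exact: (@dotp_ge _ _ V).
Qed.

Lemma policy_subsolution pi f y : is_policy pi -> 0 <= y ->
  (forall s, f s <= g * dotp (kernel_mul P f s) (pi s) + y) ->
  forall s, f s <= y / (1 - g).
Proof.
move=> spi y0 fle; have /andP[g0 g1] := discount_itv M.
apply: (@substochastic_subsolution _ _ g (policy_kernel P pi)) => //.
- by rewrite (ltW g0).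
- exact: policy_kernel_substochastic (trans_simplex M) spi.
- by move=> s; rewrite policy_kernelE.
Qed.

Lemma qobjB G1 G2 s p :
  qobj M h G1 s p - qobj M h G2 s p = g * dotp (G1 s \- G2 s) p.
Proof. by rewrite dotpBl /qobj !dotpDl !dotpZl; ring. Qed.

(** Policy improvement: if some [p] did better at [s], switching to [p] at [s] alone would raise no
    value and strictly lower the one at [s], against optimality. *)
Lemma optimal_qobj (V : (S -> A -> R) -> S -> R) pistar :
  (forall pi, is_policy pi -> forall s,
     V pi s = qobj M h (kernel_mul P (V pi)) s (pi s)) ->
  optimal_policy V pistar -> forall s p, simplex p ->
  V pistar s <= qobj M h (kernel_mul P (V pistar)) s p.
Proof.
move=> VE [spis opt] s p sp; rewrite leNgt; apply/negP => lt.
pose pi s' := if s' == s then p else pistar s'.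
have spi : is_policy pi by move=> s'; rewrite /pi; case: ifP.
have /andP[/ltW g0 _] := discount_itv M.
have fE s' : V pi s' - V pistar s' =
    g * dotp (kernel_mul P (V pi \- V pistar) s') (pi s') +
    (qobj M h (kernel_mul P (V pistar)) s' (pi s') - V pistar s').
  rewrite {1}VE// -[X in X - _ = _](subrK (qobj M h (kernel_mul P (V pistar)) s' (pi s'))).
  rewrite qobjB -addrA; congr (_ * dotp _ _ + _).
  by apply/funext => a; rewrite kernel_mulB.
have f0 s' : V pi s' - V pistar s' <= 0.
  rewrite -(mul0r (1 - g)^-1).
  apply: (@policy_subsolution pi (V pi \- V pistar)) => // {}s' /=.
  rewrite fE lerD2l subr_le0 {1}/pi; case: eqP => [->|_]; first exact: ltW.
  by rewrite -VE.
have := fE s; have := opt pi spi s.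
have : g * dotp (kernel_mul P (V pi \- V pistar) s) (pi s) <= 0.
  rewrite mulr_ge0_le0//; apply: dotp_le => // a.
  by apply: kernel_mul_le => //; exact: trans_simplex.
have piE : pi s = p by rewrite /pi eqxx.
by rewrite piE; lra.
Qed.

Variables (omega : (A -> R) -> R) (gomega : (A -> R) -> (A -> R)) (mu : R).
Hypothesis mu0 : 0 < mu.
Hypothesis osc : l1_strongly_convex omega gomega.
Variables (Vs : S -> R) (pis : S -> A -> R).
Hypothesis spis : is_policy pis.
Hypothesis VsE : forall s, Vs s = qobj M h (kernel_mul P Vs) s (pis s).
Hypothesis Vsopt : forall s p, simplex p ->
  Vs s + mu * bregman omega gomega (pis s) p <= qobj M h (kernel_mul P Vs) s p.

Variables (noise : S -> A -> R) (d0 z : R).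
Hypothesis noise_le : forall s a, `|noise s a| <= d0.
Hypothesis d0_z : d0 ^+ 2 <= mu * (1 - g) ^+ 3 * z.

Definition noisy (V : S -> R) s a := kernel_mul P V s a + noise s a.

Lemma noisy_solution pi : is_policy pi ->
  exists W, forall s, W s = qobj M h (noisy W) s (pi s).
Proof.
move=> spi; have /andP[/ltW g0 g1] := discount_itv M.
have g01 : 0 <= g < 1 by rewrite g0 g1.
have [W WE] := bellman_solution
  (fun s => policy_cost M h pi s + g * dotp (noise s) (pi s)) g01
  (policy_kernel_substochastic (trans_simplex M) spi).
exists W => s; rewrite {1}WE.
have -> : qobj M h (noisy W) s (pi s) =
    qobj M h (kernel_mul P W) s (pi s) + g * dotp (noise s) (pi s).
  apply/eqP; rewrite addrC -subr_eq qobjB; apply/eqP; congr (_ * dotp _ _).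
  by apply/funext => a; rewrite /noisy /=; ring.
by rewrite qobj_bellman /bellman; ring.
Qed.

Variable Vt : S -> R.
Hypothesis VtE : forall s, Vt s = qobj M h (noisy Vt) s (pis s).

Let advantage s p := qobj M h (kernel_mul P Vs) s p - Vs s.
Let noisy_advantage s p := qobj M h (noisy Vt) s p - Vt s.

Lemma noisyB V1 V2 s a : noisy V1 s a - noisy V2 s a = kernel_mul P (V1 \- V2) s a.
Proof. by rewrite /noisy kernel_mulB; ring. Qed.

Lemma noisy_qobjB V1 V2 s p : qobj M h (noisy V1) s p - qobj M h (noisy V2) s p =
  g * dotp (kernel_mul P (V1 \- V2) s) p.
Proof.
rewrite qobjB; congr (_ * dotp _ _); apply/funext => a; exact: noisyB.
Qed.

(** This bound is linear in [d0]; it only serves to control the vector that is multiplied by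
    [p \- pis s] in the difference of the advantages. *)
Lemma noisy_value_dist s : `|Vt s - Vs s| <= g * d0 / (1 - g).
Proof.
have /andP[/ltW g0 g1] := discount_itv M.
(* [d0] is nonnegative because it bounds an absolute value, which takes an action; there is one,
   since the simplex over no actions is empty. *)
have d00 : 0 <= g * d0.
  have [a|A0] := pickP (@predT A).
    by move=> _; rewrite mulr_ge0// (le_trans _ (noise_le s a)).
  have [_] := spis s; rewrite big1 ?[in X in X -> _]eq_sym; last first.
    by move=> a; have := A0 a.
  by move/eqP; rewrite eq_sym oner_eq0.
have fE s' : Vt s' - Vs s' = g * dotp (kernel_mul P (Vt \- Vs) s') (pis s') +
    g * dotp (noise s') (pis s').
  rewrite {1}VtE VsE qobjB -mulrDr -dotpDl; congr (_ * dotp _ _).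
  by apply/funext => a; rewrite /noisy /= kernel_mulB; ring.
have n1 s' : dotp (noise s') (pis s') <= d0.
  by apply: dotp_le => // a; exact: le_trans (ler_norm _) (noise_le s' a).
have n2 s' : - d0 <= dotp (noise s') (pis s').
  by apply: dotp_ge => // a; have := noise_le s' a; rewrite ler_norml => /andP[].
rewrite ler_norml; apply/andP; split.
  rewrite lerNl; apply: (@policy_subsolution pis (fun s => - (Vt s - Vs s))) => // s'.
  have -> : kernel_mul P (fun s => - (Vt s - Vs s)) s' =
      (fun a => -1 * kernel_mul P (Vt \- Vs) s' a).
    apply/funext => a; rewrite /kernel_mul mulr_sumr; apply: eq_bigr => i _.
    by rewrite /=; ring.
  rewrite dotpZl fE; have := ler_wpM2l g0 (n2 s'); lra.
apply: (@policy_subsolution pis (fun s => Vt s - Vs s)) => // s'.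
by rewrite {1}fE; have := ler_wpM2l g0 (n1 s'); lra.
Qed.

(* The noise perturbs the advantages only by its product with [p - pis s], and
   that is absorbed by strong convexity: hence an error quadratic in [d0]. *)
Lemma noisy_advantage_dist tau s p : 0 < tau -> simplex p ->
  `|noisy_advantage s p - advantage s p| <=
  tau * advantage s p + (1 - g) * z / (2 * tau).
Proof.
move=> tau0 sp; have /andP[/ltW g0 g1] := discount_itv M.
have g1' : 0 < 1 - g by rewrite subr_gt0.
pose n a := noise s a + kernel_mul P (Vt \- Vs) s a.
(* Both advantages vanish at [pis s], and [h] cancels in their difference, which is therefore linear
   in [p \- pis s]. *)
have -> : noisy_advantage s p - advantage s p = g * dotp n (p \- pis s).
  rewrite (_ : n = noisy Vt s \- kernel_mul P Vs s); last first.
    by apply/funext => a; rewrite /n /noisy /= kernel_mulB; ring.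
  rewrite dotpBl !dotpBr /noisy_advantage /advantage {1}VtE {1}VsE /qobj.
  by rewrite !(dotpDl (cost M s)) !dotpZl; ring.
set x := l1norm (p \- pis s).
have x0 : 0 <= x by exact: l1norm_ge0.
have n_le a : `|n a| <= d0 / (1 - g).
  rewrite (_ : d0 / (1 - g) = d0 + g * d0 / (1 - g)); last first.
    by field; rewrite lt0r_neq0.
  apply: le_trans (ler_normD _ _) _; apply: lerD => //.
  rewrite ler_norml; apply/andP; split.
    apply: kernel_mul_ge => [|s']; first exact: trans_simplex.
    by have := noisy_value_dist s'; rewrite ler_norml => /andP[].
  apply: kernel_mul_le => [|s']; first exact: trans_simplex.
  by have := noisy_value_dist s'; rewrite ler_norml => /andP[].
set y := d0 / (1 - g).
have nx : `|dotp n (p \- pis s)| <= y * x.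
  rewrite ler_norml; apply/andP; split; last exact: ler_dotp_l1norm.
  rewrite lerNl -mulN1r -dotpZl; apply: ler_dotp_l1norm => a.
  by rewrite mulN1r normrN.
have adv : mu * (2^-1 * x ^+ 2) <= advantage s p.
  have := Vsopt s sp; have := bregman_ge osc (spis s) sp.
  by rewrite -(ler_pM2l mu0) /advantage -/x; lra.
have yz : y ^+ 2 <= mu * (1 - g) * z.
  rewrite /y expr_div_n ler_pdivrMr ?exprn_gt0//; apply: le_trans d0_z _.
  by rewrite le_eqVlt; apply/orP; left; apply/eqP; ring.
(* Young's inequality: the square below, divided by [2 * tau * mu]. *)
have key : y * x <= tau * (mu * (2^-1 * x ^+ 2)) + (1 - g) * z / (2 * tau).
  have sq : 0 <= (tau * mu * x - y) ^+ 2 by exact: sqr_ge0.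
  have tm : 0 < 2 * tau * mu by rewrite !mulr_gt0.
  rewrite -(ler_pM2l tm).
  have -> : 2 * tau * mu * (tau * (mu * (2^-1 * x ^+ 2)) + (1 - g) * z / (2 * tau)) =
      (tau * mu * x) ^+ 2 + mu * (1 - g) * z.
    by field; rewrite lt0r_neq0.
  by move: sq; rewrite sqrrB; lra.
rewrite normrM (ger0_norm g0); apply: (@le_trans _ _ (y * x)).
  apply: le_trans nx; rewrite -[leRHS]mul1r ler_wpM2r//; exact: ltW.
by apply: le_trans key _; rewrite lerD2r ler_wpM2l// ltW.
Qed.

(** A value gap is the discounted accumulation of advantages along the policy, so
    [noisy_advantage_dist] carries over from advantages to values. The discount weights add up to
    [1 / (1 - g)], which removes the factor [1 - g] from its constant. *)
Lemma noisy_value_transfer tau pi (V W : S -> R) s : 0 < tau -> is_policy pi ->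
  (forall s, V s = qobj M h (kernel_mul P V) s (pi s)) ->
  (forall s, W s = qobj M h (noisy W) s (pi s)) ->
  W s - Vt s <= (1 + tau) * (V s - Vs s) + z / (2 * tau) /\
  (1 - tau) * (V s - Vs s) <= W s - Vt s + z / (2 * tau).
Proof.
move=> tau0 spi VE WE; have /andP[/ltW g0 g1] := discount_itv M.
have g1' : 0 < 1 - g by rewrite subr_gt0.
have z0 : 0 <= z.
  have : 0 <= mu * (1 - g) ^+ 3 * z by apply: le_trans d0_z; exact: sqr_ge0.
  by rewrite pmulr_rge0// mulr_gt0// exprn_gt0.
have y0 : 0 <= (1 - g) * z / (2 * tau) by rewrite divr_ge0 ?mulr_ge0// ltW// mulr_gt0.
have fE s' : V s' - Vs s' = advantage s' (pi s') +
    g * dotp (kernel_mul P (V \- Vs) s') (pi s').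
  rewrite {1}VE /advantage -[RHS]addrA [- _ + _]addrC addrA; congr (_ - _).
  apply/eqP; rewrite addrC -subr_eq qobjB; apply/eqP; congr (_ * dotp _ _).
  by apply/funext => a; rewrite kernel_mulB.
have FE s' : W s' - Vt s' = noisy_advantage s' (pi s') +
    g * dotp (kernel_mul P (W \- Vt) s') (pi s').
  rewrite {1}WE /noisy_advantage -[RHS]addrA [- _ + _]addrC addrA; congr (_ - _).
  by apply/eqP; rewrite addrC -subr_eq noisy_qobjB.
have dist s' := noisy_advantage_dist s' tau0 (spi s').
have lin c1 c2 s' : kernel_mul P (fun s => c1 * (W \- Vt) s + c2 * (V \- Vs) s) s' =
    (fun a => c1 * kernel_mul P (W \- Vt) s' a) \+
    (fun a => c2 * kernel_mul P (V \- Vs) s' a).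
  apply/funext => a; rewrite /kernel_mul /= !mulr_sumr -big_split.
  by apply: eq_bigr => i _ /=; ring.
have zE : z / (2 * tau) = ((1 - g) * z / (2 * tau)) / (1 - g).
  by field; rewrite !lt0r_neq0.
split; rewrite zE.
  have key := @policy_subsolution pi
    (fun s => 1 * (W \- Vt) s + (- (1 + tau)) * (V \- Vs) s) _ spi y0.
  rewrite -lerBlDl -[W s - _]mul1r -mulNr; apply: key => {}s.
  rewrite lin dotpDl !dotpZl /= fE FE.
  by have := dist s; rewrite ler_norml => /andP[]; lra.
have key := @policy_subsolution pi
  (fun s => (-1) * (W \- Vt) s + (1 - tau) * (V \- Vs) s) _ spi y0.
rewrite -lerBlDl addrC -mulN1r; apply: key => {}s.
rewrite lin dotpDl !dotpZl /= fE FE.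
by have := dist s; rewrite ler_norml => /andP[]; lra.
Qed.

End Perturbation.

(** * The analysis of one epoch *)

(** From [ln (1 + y) <= y] at [y = - 1 / (n + 1)]. Summed up, it bounds a harmonic sum by a
    logarithm. *)
Lemma invn_le_lnB (R : realType) n : (0 < n)%N -> n.+1%:R^-1 <= ln n.+1%:R - ln n%:R :> R.
Proof.
move=> n0; have n0' : 0 < n%:R :> R by rewrite ltr0n.
have h1 : 0 < n%:R / n.+1%:R :> R by rewrite divr_gt0.
have n1 : -1 < - n.+1%:R^-1 :> R by rewrite ltrN2 invf_lt1 ?ltr1n.
have := le_ln1Dx n1.
have -> : 1 - n.+1%:R^-1 = n%:R / n.+1%:R :> R.
  by rewrite -natr1; field; rewrite natr1.
by rewrite ln_div ?posrE// lerNr opprB.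
Qed.

Section Epoch.
Context {R : realType} {S A : finType}.
Variables (M : mdp R S A) (h : (A -> R) -> R).
Local Notation g := (discount M).
Local Notation P := (trans M).
Variables (omega : (A -> R) -> R) (gomega : (A -> R) -> (A -> R)) (mu : R).
Hypothesis mu0 : 0 < mu.
Hypothesis grad : is_gradient_on_simplex omega gomega.
Hypothesis osc : l1_strongly_convex omega gomega.
Hypothesis hsc : convex_relative mu omega h.
Variables (Vs : S -> R) (pis : S -> A -> R).
Hypothesis spis : is_policy pis.
Hypothesis VsE : forall s, Vs s = qobj M h (kernel_mul P Vs) s (pis s).
Hypothesis Vsopt : forall s p, simplex p ->
  Vs s + mu * bregman omega gomega (pis s) p <= qobj M h (kernel_mul P Vs) s p.
Variables (noise : S -> A -> R) (d0 z : R).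
Hypothesis noise_le : forall s a, `|noise s a| <= d0.
Hypothesis d0_z : d0 ^+ 2 <= mu * (1 - g) ^+ 3 * z.
Local Notation noisyM := (noisy M noise).
Variable Vt : S -> R.
Hypothesis VtE : forall s, Vt s = qobj M h (noisyM Vt) s (pis s).

Variables (T : nat) (pit : nat -> S -> A -> R) (Vn : nat -> S -> R).
(** [xi] are the errors of the fresh samples and [e2] their size relative to the drift; [e0] and [x]
    bound [Vn 0 - Vt] from above and below; [u] is the accuracy with which the epoch starts. *)
Variables (xi : nat -> S -> A -> R) (e2 e0 x u : R).
Let G t s a := noisyM (Vn t) s a + xi t s a.
Let eta t := 2 / (mu * t.+1%:R).
Hypothesis T0 : (0 < T)%N.
Hypothesis spit : forall t, (t <= T)%N -> is_policy (pit t).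
Hypothesis pit_min : forall t s p, (t < T)%N -> simplex p ->
  eta t * qobj M h (G t) s (pit t.+1 s) + bregman omega gomega (pit t s) (pit t.+1 s)
  <= eta t * qobj M h (G t) s p + bregman omega gomega (pit t s) p.
Hypothesis VnS : forall t s, (t < T)%N ->
  Vn t.+1 s = Num.min (qobj M h (G t) s (pit t.+1 s)) (Vn t s).
Hypothesis xi0 : forall s a, xi 0%N s a = 0.
Hypothesis xi_le : forall t c, (t < T)%N ->
  (forall s, `|Vn 0%N s - Vn t s| <= c) -> forall s a, `|xi t s a| <= e2 * c.
Hypothesis V0_start : forall s, qobj M h (G 0%N) s (pit 0%N s) <= Vn 0%N s.
Hypothesis V0_le : forall s, Vn 0%N s - Vt s <= e0.
Hypothesis V0_ge : forall s, - x <= Vn 0%N s - Vt s.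
Hypothesis D0_le : forall s, mu * bregman omega gomega (pit 0%N s) (pis s) <= u.
Hypothesis e20 : 0 <= e2.
Hypothesis e00 : 0 <= e0.
Hypothesis x0 : 0 <= x.
Hypothesis u0 : 0 <= u.
Let X := e2 * (e0 + x).
Hypothesis x_ge : (1 - g) * z / 2 + X <= (1 - g) * x.

Let g0 : 0 <= g. Proof. by have /andP[/ltW] := discount_itv M. Qed.
Let g1 : g < 1. Proof. by have /andP[] := discount_itv M. Qed.
Let g1' : 0 < 1 - g. Proof. by rewrite subr_gt0. Qed.
Let X0 : 0 <= X. Proof. by rewrite mulr_ge0// addr_ge0. Qed.
Let eta0 t : 0 < eta t. Proof. by rewrite divr_gt0// mulr_gt0. Qed.

Local Notation breg := (bregman omega gomega).

(** With [tau = 1] the advantage cancels and only the constant remains. *)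
Let noisy_adv_ge s p : simplex p -> Vt s - (1 - g) * z / 2 <= qobj M h (noisyM Vt) s p.
Proof.
move=> sp.
have := noisy_advantage_dist mu0 osc spis VsE Vsopt noise_le d0_z VtE s ltr01 sp.
by rewrite mulr1 mul1r ler_norml => /andP[]; lra.
Qed.

Let qobjG t s p : qobj M h (G t) s p =
  qobj M h (noisyM (Vn t)) s p + g * dotp (xi t s) p.
Proof.
apply/eqP; rewrite addrC -subr_eq qobjB; apply/eqP; congr (_ * dotp _ _).
by apply/funext => a; rewrite /G /=; ring.
Qed.

Let Vn_antitone t s : (t < T)%N -> Vn t.+1 s <= Vn t s.
Proof. by move=> tT; rewrite VnS// ge_min lexx orbT. Qed.

Let Vn_le t t' s : (t <= t')%N -> (t' <= T)%N -> Vn t' s <= Vn t s.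
Proof.
elim: t' => [|t' IH]; first by rewrite leqn0 => /eqP ->.
rewrite leq_eqVlt => /predU1P[->//|tt'] t'T.
by apply: le_trans (Vn_antitone s t'T) (IH tt' (ltnW t'T)).
Qed.

Let dotpP_le V1 V2 c s p : simplex p -> (forall s, V1 s <= V2 s + c) ->
  dotp (kernel_mul P V1 s) p <= dotp (kernel_mul P V2 s) p + c.
Proof.
move=> sp le12; rewrite -lerBlDl -dotpBl; apply: dotp_le => // a.
rewrite /= -kernel_mulB; apply: kernel_mul_le => [|s']; first exact: trans_simplex.
by have := le12 s'; rewrite /=; lra.
Qed.

Let noisy_qobj_le V1 V2 c s p : simplex p -> (forall s, V1 s <= V2 s + c) ->
  qobj M h (noisyM V1) s p <= qobj M h (noisyM V2) s p + g * c.
Proof.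
move=> sp le12; rewrite -lerBlDl noisy_qobjB ler_wpM2l//; apply: dotp_le => // a.
apply: kernel_mul_le => [|s']; first exact: trans_simplex.
by have := le12 s'; rewrite /=; lra.
Qed.

(** The lower bound and the bound [X] on the errors support each other: by the former the drift at
    [t] is at most [e0 + x], hence the error is at most [X], and [x_ge] then gives back the same
    lower bound at [t.+1]. *)
Let Vn_ge t s : (t <= T)%N -> Vt s - x <= Vn t s.
Proof.
elim: t s => [|t IH] s tT; first by have := V0_ge s; lra.
have xit a : `|xi t s a| <= X.
  apply: xi_le => // s'; have := IH s' (ltnW tT); have := V0_le s'.
  have := Vn_le s' (leq0n t) (ltnW tT).
  by rewrite ler_norml => *; apply/andP; split; lra.
rewrite VnS// le_min IH ?(ltnW tT)// andbT qobjG.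
have sp := spit tT s.
have : qobj M h (noisyM Vt) s (pit t.+1 s) <=
    qobj M h (noisyM (Vn t)) s (pit t.+1 s) + g * x.
  by apply: noisy_qobj_le => // s'; have := IH s' (ltnW tT); lra.
have := noisy_adv_ge s sp.
have : - X <= dotp (xi t s) (pit t.+1 s).
  by apply: dotp_ge => // a; have := xit a; rewrite ler_norml => /andP[].
by have := g0; have := g1; have := x_ge; have := X0; nra.
Qed.

Let xi_X t s a : (t < T)%N -> `|xi t s a| <= X.
Proof.
move=> tT; apply: xi_le => // s'; have := Vn_ge s' (ltnW tT); have := V0_le s'.
have := Vn_le s' (leq0n t) (ltnW tT).
by rewrite ler_norml => *; apply/andP; split; lra.
Qed.

Let step_ineq t s p : (t < T)%N -> simplex p ->
  eta t * qobj M h (G t) s (pit t.+1 s) + breg (pit t s) (pit t.+1 s) +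
    (1 + eta t * mu) * breg (pit t.+1 s) p <=
  eta t * qobj M h (G t) s p + breg (pit t s) p.
Proof.
move=> tT sp; apply: (@minimizer_bregman _ _ omega gomega
  (fun p => eta t * qobj M h (G t) s p + breg (pit t s) p)) => //.
- by rewrite addr_ge0// mulr_ge0// ltW.
- apply: convex_relative_prox; first exact: ltW.
  exact: convex_relativeD.
- exact: spit.
- by move=> q; exact: pit_min.
Qed.

Let D t s := breg (pit t s) (pis s).
Local Notation PVs V s := (dotp (kernel_mul P V s) (pis s)).

Let recursion t s : (t < T)%N ->
  t.+2%:R * (Vn t.+1 s - Vt s) + mu * (t.+2%:R * t.+3%:R / 2) * D t.+1 s <=
  t.+2%:R * (g * PVs (Vn t \- Vt) s + X) + mu * (t.+1%:R * t.+2%:R / 2) * D t s.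
Proof.
move=> tT; have := step_ineq s tT (spis s).
have : Vn t.+1 s <= qobj M h (G t) s (pit t.+1 s) by rewrite VnS// ge_min lexx.
have b0 : 0 <= breg (pit t s) (pit t.+1 s).
  by apply: bregman_ge0 => //; [exact: spit (ltnW tT) s|exact: spit].
have qE : qobj M h (G t) s (pis s) = Vt s + g * PVs (Vn t \- Vt) s +
    g * dotp (xi t s) (pis s).
  rewrite qobjG; congr (_ + _); apply/eqP.
  by rewrite addrC -subr_eq -(noisy_qobjB M h noise) VtE.
have xX : g * dotp (xi t s) (pis s) <= X.
  have : dotp (xi t s) (pis s) <= X.
    by apply: dotp_le => // a; exact: le_trans (ler_norm _) (xi_X s a tT).
  by have := g0; have := g1; have := X0; nra.
rewrite qE /D => Vq st.
have m0 : 0 < t.+1%:R :> R by [].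
(* The multiplier is chosen so that [c * eta t] is the weight [t + 2] and the coefficient
   [c * (1 + eta t * mu)] of the new divergence is the value of [c] at [t + 1]: summed over [t], the
   divergences telescope. *)
set c := mu * (t.+1%:R * t.+2%:R / 2).
have e1 : c * eta t = t.+2%:R.
  by rewrite /c /eta; field; rewrite lt0r_neq0// lt0r_neq0.
have e2' : c + c * eta t * mu = mu * (t.+2%:R * t.+3%:R / 2).
  by rewrite e1 /c -[t.+3]addn2 -[t.+2]addn1 -[t.+1]addn1 !natrD; field.
have c0 : 0 <= c by rewrite mulr_ge0 ?(ltW mu0)// divr_ge0.
have st' : eta t * Vn t.+1 s + (1 + eta t * mu) * breg (pit t.+1 s) (pis s) <=
    eta t * (Vt s + g * PVs (Vn t \- Vt) s + X) + breg (pit t s) (pis s).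
  have := ler_wpM2l (ltW (eta0 t)) Vq; have := ler_wpM2l (ltW (eta0 t)) xX.
  by lra.
have := ler_wpM2l c0 st'.
have -> : forall a b d e f : R, (c * (eta t * a + (1 + eta t * mu) * b) <=
    c * (eta t * (d + e + f) + breg (pit t s) (pis s))) =
    (c * eta t * a + (c + c * eta t * mu) * b <=
     c * eta t * (d + e + f) + c * breg (pit t s) (pis s)).
  by move=> *; congr (_ <= _); ring.
by rewrite e2' e1; lra.
Qed.

(** [E] weights the gaps after each step, [F] those before it with the same weights; [F_le_E] pays
    for this shift by one index. *)
Let E n s := \sum_(0 <= t < n) t.+2%:R * (Vn t.+1 s - Vt s).
Let F n s := \sum_(0 <= t < n) t.+2%:R * (Vn t s - Vt s).
Let N n : R := \sum_(0 <= t < n) t.+2%:R.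

Let N_E n : N n = n%:R * n.+3%:R / 2.
Proof.
rewrite /N; elim: n => [|n IH]; first by rewrite big_geq// !mul0r.
rewrite big_nat_recr//= IH -[n.+4]addn4 -[n.+3]addn3 -[n.+2]addn2 -[n.+1]addn1.
by rewrite !natrD; field.
Qed.

Let sum_recursion n s : (n <= T)%N ->
  E n s + mu * (n.+1%:R * n.+2%:R / 2) * D n s <=
  g * PVs (F n) s + X * N n + mu * D 0%N s.
Proof.
rewrite /E /F /N; elim: n => [|n IH] nT.
  rewrite !big_geq// (_ : PVs _ s = 0).
    by rewrite [in leLHS](_ : 1 * 2 / 2 = 1 :> R); [lra|field].
  rewrite (_ : kernel_mul P _ s = fun=> 0) ?dotp_cst//.
  by apply/funext => a; rewrite /kernel_mul big1// => s' _; rewrite big_geq ?mulr0.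
have PF : PVs (fun s => \sum_(0 <= t < n.+1) t.+2%:R * (Vn t s - Vt s)) s =
    PVs (fun s => \sum_(0 <= t < n) t.+2%:R * (Vn t s - Vt s)) s +
    n.+2%:R * PVs (Vn n \- Vt) s.
  rewrite -dotpZl -dotpDl; congr (dotp _ _); apply/funext => a /=.
  rewrite /kernel_mul mulr_sumr -big_split; apply: eq_bigr => s' _.
  by rewrite /= big_nat_recr//= mulrDr; ring.
rewrite PF !big_nat_recr//= .
by have := IH (ltnW nT); have := recursion s nT; lra.
Qed.

(** Summation by parts: consecutive weights differ by 1, so the shift leaves gaps of total weight
    [n + 1], each at most [e0], and a final term that is bounded through [- x]. This is linear in
    [n], against the quadratic [N n]. *)
Let F_le_E n s : (n <= T)%N -> F n s <= E n s + n.+1%:R * (e0 + x).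
Proof.
move=> nT; suff : F n s - E n s + n.+1%:R * (Vn n s - Vt s) <= n.+1%:R * e0.
  have : n.+1%:R * (- x) <= n.+1%:R * (Vn n s - Vt s).
    by rewrite ler_wpM2l//; have := Vn_ge s nT; lra.
  by lra.
rewrite /F /E; elim: n nT => [|n IH] nT; first by rewrite !big_geq// subrr add0r ler_wpM2l.
rewrite !big_nat_recr//=.
have : Vn n s - Vt s <= e0.
  by have := Vn_le s (leq0n n) (ltnW nT); have := V0_le s; lra.
have := IH (ltnW nT); rewrite -[n.+2]addn1 natrD; lra.
Qed.

Let Y := T.+1%:R * (e0 + x) + X * N T + u.

Let N_ge0 n : 0 <= N n. Proof. exact: sumr_ge0. Qed.

Let Y0 : 0 <= Y.
Proof. by rewrite !addr_ge0// mulr_ge0// addr_ge0. Qed.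

Let PF_le s : PVs (F T) s <= PVs (E T) s + T.+1%:R * (e0 + x).
Proof. by apply: dotpP_le => // s'; exact: F_le_E. Qed.

Let D_ge0 t s : (t <= T)%N -> 0 <= D t s.
Proof. by move=> tT; apply: bregman_ge0 => //; exact: spit. Qed.

(** With [PF_le], the summed recursion makes [E T] a subsolution, with cost [Y], of the Bellman
    equation of [pis]. *)
Let E_le s : E T s <= Y / (1 - g).
Proof.
apply: (@policy_subsolution _ _ _ M pis) => // {}s.
have := sum_recursion s (leqnn T); have := D0_le s; have := PF_le s.
have : 0 <= mu * (T.+1%:R * T.+2%:R / 2) * D T s.
  by rewrite !mulr_ge0 ?(ltW mu0) ?invr_ge0// D_ge0.
have c0 : 0 <= T.+1%:R * (e0 + x) by rewrite mulr_ge0// addr_ge0.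
rewrite -/(D 0%N s) => h1 h2 h3 h4.
have := ler_wpM2l g0 h2; have : g * (T.+1%:R * (e0 + x)) <= T.+1%:R * (e0 + x).
  by rewrite ler_piMl// ltW.
by rewrite /Y; lra.
Qed.

Let eT_le s : N T * (Vn T s - Vt s) <= Y / (1 - g).
Proof.
apply: le_trans (E_le s); rewrite /N /E mulr_suml.
rewrite [leLHS]big_seq [leRHS]big_seq; apply: ler_sum => t.
rewrite mem_index_iota => /andP[_ tT]; rewrite ler_wpM2l// lerB//.
exact: Vn_le.
Qed.

Let DT_le s : mu * N T * D T s <= x * N T + Y / (1 - g).
Proof.
have := sum_recursion s (leqnn T); have := D0_le s; have := PF_le s.
have PE : PVs (E T) s <= Y / (1 - g).
  apply: dotp_le => // a; apply: kernel_mul_le => [|s']; first exact: trans_simplex.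
  exact: E_le.
have Ege : - x * N T <= E T s.
  rewrite /N /E mulr_sumr [leLHS]big_seq [leRHS]big_seq; apply: ler_sum => t.
  rewrite mem_index_iota => /andP[_ tT]; rewrite mulrC ler_wpM2l//.
  by have := Vn_ge s tT; lra.
have c0 : 0 <= T.+1%:R * (e0 + x) by rewrite mulr_ge0// addr_ge0.
have ND : mu * N T * D T s <= mu * (T.+1%:R * T.+2%:R / 2) * D T s.
  rewrite ler_wpM2r ?D_ge0// ler_wpM2l ?(ltW mu0)// N_E.
  rewrite -[T.+3]addn3 -[T.+2]addn2 -[T.+1]addn1 !natrD; lra.
rewrite -/(D 0%N s) => h2 h3 h4.
have := ler_wpM2l g0 h2; have : g * (T.+1%:R * (e0 + x)) <= T.+1%:R * (e0 + x).
  by rewrite ler_piMl// ltW.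
have := ler_wpM2l g0 PE.
have : Y / (1 - g) = Y + g * (Y / (1 - g)) by field; rewrite lt0r_neq0.
by rewrite {2}/Y; lra.
Qed.

Let B t s := qobj M h (noisyM (Vn t)) s (pit t.+1 s).

Let bregxx p : breg p p = 0.
Proof.
rewrite /bregman subrr sub0r (_ : p \- p = fun=> 0); last first.
  by apply/funext => a; rewrite /= subrr.
by rewrite /dotp big1 ?oppr0// => a _; rewrite mulr0.
Qed.

(** The first step carries no fresh error, so it can be compared exactly with staying at [pit 0]. *)
Let B0_le s : B 0%N s <= Vn 0%N s.
Proof.
have := pit_min s T0 (spit (leq0n T) s); rewrite bregxx addr0.
have : 0 <= breg (pit 0%N s) (pit 1%N s).
  by apply: bregman_ge0 => //; exact: spit.
move=> b0 st.
have : eta 0%N * qobj M h (G 0%N) s (pit 1%N s) <= eta 0%N * Vn 0%N s.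
  have := ler_wpM2l (ltW (eta0 0)) (V0_start s); lra.
rewrite ler_pM2l// qobjG (_ : dotp (xi 0%N s) _ = 0) ?mulr0 ?addr0//.
by rewrite /dotp big1// => a _; rewrite xi0 mul0r.
Qed.

(* Summation by parts: only [<xi t, pit t - pit t.+1>] accumulates, and it is
   absorbed by the two Bregman terms of the step. *)
Let BS_le t s : (t.+1 < T)%N -> B t.+1 s <= B t s + X ^+ 2 / (2 * mu * t.+2%:R).
Proof.
move=> tT; have sp1 := spit (ltnW tT) s; have sp2 := spit tT s.
have st := step_ineq s tT sp1; rewrite bregxx addr0 in st.
set y := l1norm (pit t.+2 s \- pit t.+1 s).
have y0 : 0 <= y by exact: l1norm_ge0.
have yE : l1norm (pit t.+1 s \- pit t.+2 s) = y.
  by apply: eq_bigr => a _; rewrite /= distrC.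
(* Both directions of the move between the two policies are penalized, and together the two
   divergences are at least [y ^+ 2]. *)
have b1 := bregman_ge osc sp1 sp2; have b2 := bregman_ge osc sp2 sp1.
rewrite -/y in b1; rewrite yE in b2.
have b20 := bregman_ge0 osc sp2 sp1.
have e1 : 0 <= eta t.+1 * mu * breg (pit t.+2 s) (pit t.+1 s).
  by apply: mulr_ge0 => //; apply: mulr_ge0; exact: ltW.
have : eta t.+1 * (qobj M h (G t.+1) s (pit t.+2 s) -
    qobj M h (G t.+1) s (pit t.+1 s)) <= - y ^+ 2 by lra.
rewrite !qobjG => {}st.
have xy : dotp (xi t.+1 s) (pit t.+1 s) - dotp (xi t.+1 s) (pit t.+2 s) <= X * y.
  by rewrite -dotpBr -yE; apply: ler_dotp_l1norm => a; exact: xi_X.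
have mono : qobj M h (noisyM (Vn t.+1)) s (pit t.+1 s) <= B t s.
  rewrite -[leRHS]addr0 -(mulr0 g); apply: noisy_qobj_le => // s'.
  by rewrite addr0; apply: Vn_antitone; exact: ltnW.
suff H : B t.+1 s - qobj M h (noisyM (Vn t.+1)) s (pit t.+1 s) <=
  X ^+ 2 / (2 * mu * t.+2%:R).
  by rewrite -lerBlDl; apply: le_trans H; rewrite lerB.
have xy' : g * (dotp (xi t.+1 s) (pit t.+1 s) - dotp (xi t.+1 s) (pit t.+2 s)) <= X * y.
  have Xy : 0 <= X * y by rewrite mulr_ge0.
  have [d0'|d0'] := leP 0 (dotp (xi t.+1 s) (pit t.+1 s) - dotp (xi t.+1 s) (pit t.+2 s)).
    by apply: le_trans xy; rewrite ler_piMl// ltW.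
  by apply: le_trans Xy; rewrite mulr_ge0_le0// ltW.
have := ler_wpM2l (ltW (eta0 t.+1)) xy' => xy''.
have : eta t.+1 * (B t.+1 s - qobj M h (noisyM (Vn t.+1)) s (pit t.+1 s)) <=
    eta t.+1 * X * y - y ^+ 2 by rewrite /B; lra.
move=> bb; rewrite -(ler_pM2l (eta0 t.+1)).
have -> : eta t.+1 * (X ^+ 2 / (2 * mu * t.+2%:R)) = (eta t.+1 * X / 2) ^+ 2.
  by rewrite /eta; field; rewrite lt0r_neq0// lt0r_neq0.
have : 0 <= (eta t.+1 * X / 2 - y) ^+ 2 by exact: sqr_ge0.
by rewrite sqrrB; lra.
Qed.

Let q := X ^+ 2 * ln T%:R / (2 * mu).

Let B_le i t s : (i <= t)%N -> (t < T)%N -> B t s <= B i s + q.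
Proof.
move=> it tT; set C := X ^+ 2 / (2 * mu).
have C0 : 0 <= C by rewrite divr_ge0 ?sqr_ge0// mulr_ge0// ltW.
have : B t s <= B i s + C * (ln t.+1%:R - ln i.+1%:R).
  elim: t it tT => [|t IH]; first by rewrite leqn0 => /eqP -> _; rewrite subrr mulr0 addr0.
  rewrite leq_eqVlt => /predU1P[<- _|it tT]; first by rewrite subrr mulr0 addr0.
  have := IH it (ltnW tT); have := BS_le s tT.
  have := ler_wpM2l C0 (invn_le_lnB R (ltn0Sn t)).
  have -> : C / t.+2%:R = X ^+ 2 / (2 * mu * t.+2%:R).
    by rewrite /C [in RHS]invfM mulrA.
  move: (X ^+ 2 / _) (ln _) (ln _) (ln _) => K a b c; lra.
have : C * (ln t.+1%:R - ln i.+1%:R) <= C * ln T%:R.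
  rewrite ler_wpM2l// lerBlDr ler_wpDr ?ln_ge0 ?ler1n//.
  by rewrite ler_ln ?posrE ?ltr0n ?ler_nat.
have -> : q = C * ln T%:R by rewrite /q mulrAC.
by move=> le1 le2; apply: le_trans le2 _; rewrite lerD2l.
Qed.

Let q0 : 0 <= q.
Proof.
apply: divr_ge0; last by rewrite mulr_ge0// ltW.
by apply: mulr_ge0; [exact: sqr_ge0|rewrite ln_ge0// ler1n].
Qed.

(** [Vn j] is the minimum of [Vn 0] and of the earlier objectives, which are the [B i] up to one
    error [X]; the sum [q] compares [B t] with each of them. *)
Let B_le_Vn t j s : (t < T)%N -> (j <= t.+1)%N -> B t s <= Vn j s + X + q.
Proof.
move=> tT; elim: j => [|j IH] jt.
  by have := B_le s (leq0n t) tT; have := B0_le s; have := X0; lra.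
have jT : (j < T)%N by exact: leq_ltn_trans tT.
rewrite VnS// -addrA -lerBlDr le_min; apply/andP; split; last first.
  by have := IH (ltnW jt); lra.
rewrite qobjG; have := @B_le j t s jt tT; rewrite /B.
have : - X <= dotp (xi j s) (pit j.+1 s).
  apply: dotp_ge; first exact: spit.
  by move=> a; have := xi_X s a jT; rewrite ler_norml => /andP[].
by move=> n1; have := ler_wpM2l g0 n1; have := g1; have := X0; nra.
Qed.

(** With [T'] the predecessor of [T], [B_le_Vn] makes [Vn T'] a supersolution for the last policy up
    to [X + q], which bounds [W - Vn T']. One more application of the Bellman operator replaces
    [Vn T'] by [Vn T]. *)
Let final_noisy_value W s : (forall s, W s = qobj M h (noisyM W) s (pit T s)) ->
  W s - Vt s <= Vn T s - Vt s + (X + q) / (1 - g).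
Proof.
move=> WE; have [T' TE] : exists T', T = T'.+1 by exists T.-1; rewrite prednK.
have T'T : (T' < T)%N by rewrite TE.
have Xq0 : 0 <= X + q by rewrite addr_ge0.
have WB s' : W s' = B T' s' + g * dotp (kernel_mul P (W \- Vn T') s') (pit T s').
  by apply/eqP; rewrite addrC -subr_eq -(noisy_qobjB M h noise) {1}WE /B -TE.
have Wle : forall s', W s' - Vn T' s' <= (X + q) / (1 - g).
  apply: (@policy_subsolution _ _ _ M (pit T) (W \- Vn T')) => // [|s']; first exact: spit.
  by rewrite /= {1}WB; have := B_le_Vn s' T'T (leqnSn T'); lra.
have : dotp (kernel_mul P (W \- Vn T') s) (pit T s) <= (X + q) / (1 - g).
  apply: dotp_le => [|a]; first exact: spit.
  by apply: kernel_mul_le => //; exact: trans_simplex.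
move=> /(ler_wpM2l g0); have := B_le_Vn s T'T (leqnn T'.+1); rewrite -TE.
have : (X + q) / (1 - g) = X + q + g * ((X + q) / (1 - g)) by field; rewrite lt0r_neq0.
by rewrite WB; lra.
Qed.

(** In units of [u], the gap costs 0.2 for [Vn T - Vt], 0.07 for passing to the value of the last
    policy and 0.01 for the noise; the total divided by [1 - tau = 0.9] is below 1/2. The divergence
    costs 0.06 + 0.2. *)
Lemma epoch_bound V : 18 <= (1 - g) * T%:R ->
  (forall s, V s = qobj M h (kernel_mul P V) s (pit T s)) ->
  e0 <= 111%:R / 100%:R * u -> x <= 6%:R / 100%:R * u ->
  X <= (1 - g) * (6%:R / 100%:R * u) -> q <= (1 - g) * (u / 100%:R) ->
  z <= u / 500%:R ->
  forall s, V s - Vs s <= u / 2 /\ mu * breg (pit T s) (pis s) <= u / 2.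
Proof.
move=> T18 VE e0u xu Xu qu zu s.
have [W WE] := noisy_solution M h noise (spit (leqnn T)).
have tau0 : 0 < 10%:R^-1 :> R by rewrite invr_gt0.
have [_] := noisy_value_transfer mu0 osc spis VsE Vsopt noise_le d0_z VtE s tau0
  (spit (leqnn T)) VE WE.
have := final_noisy_value s WE.
have TR : 18 <= T%:R :> R by have := g0; have : 0 <= T%:R :> R by []; nra.
(* The 18 in [T] enters here, as the weights add up to [T (T + 3) / 2]. *)
have NT : (1 - g) * N T >= 9 * T.+3%:R.
  by rewrite N_E; have : 0 <= T.+3%:R :> R by []; nra.
have NT0 : 0 < N T by rewrite N_E !mulr_gt0// ltr0n.
have Yle : Y / (1 - g) <= N T * (2 / 10%:R * u).
  pose a := (1 - g) * N T * u; pose b := T.+3%:R * u.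
  have h1 : X * N T <= 6%:R / 100%:R * a.
    by have := ler_wpM2r (ltW NT0) Xu; rewrite /a; lra.
  have h2 : T.+1%:R * (e0 + x) <= 117%:R / 100%:R * b.
    rewrite /b mulrCA; apply: ler_pM => //; first by rewrite addr_ge0.
      by rewrite ler_nat ltnW.
    by lra.
  have h3 : 21%:R * u <= b.
    by rewrite /b ler_wpM2r// -[T.+3]addn3 natrD; lra.
  have h4 : 9%:R * b <= a by have := ler_wpM2r u0 NT; rewrite /a /b; lra.
  rewrite ler_pdivrMr// /Y (_ : _ * (1 - g) = 2 / 10%:R * a); last by rewrite /a; ring.
  by move: a b (X * N T) (T.+1%:R * _) h1 h2 h3 h4 u0 => a b c d; lra.
have eT : Vn T s - Vt s <= 2 / 10%:R * u.
  by rewrite -(ler_pM2l NT0); apply: le_trans (eT_le s) Yle.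
have qX : (X + q) / (1 - g) <= 7%:R / 100%:R * u by rewrite ler_pdivrMr//; lra.
have -> : z / (2 * 10%:R^-1) = 5%:R * z by field.
move: ((X + q) / (1 - g)) qX => r qX h1 h2; have := u0.
split; first by lra.
rewrite -/(D T s) -(ler_pM2l NT0) mulrA [N T * mu]mulrC.
apply: le_trans (DT_le s) _; have := ler_wpM2r (ltW NT0) xu.
have := mulr_ge0 (ltW NT0) u0.
by move: (Y / (1 - g)) Yle => y; lra.
Qed.

End Epoch.

(** * Concentration *)

(** [expR (y / 2) <= (1 - y / 2)^-1] is squared. It remains to see that [1 - 3 * y + y ^+ 2] is
    nonnegative, which is where 1/3 comes from. *)
Lemma expR_le_quadratic (R : realType) (y : R) : `|y| <= 1 / 3%:R ->
  expR y <= 1 + y + y ^+ 2.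
Proof.
rewrite ler_norml => /andP[y1 y2].
have c0 : 0 < 1 - y / 2 by lra.
have e1 : expR (y / 2) <= (1 - y / 2)^-1.
  have := expR_ge1Dx (- (y / 2)); rewrite expRN => le1.
  by rewrite -[X in X <= _]invrK lef_pV2 ?posrE ?invr_gt0 ?expR_gt0//.
have -> : expR y = expR (y / 2) ^+ 2 by rewrite -expRM_natl; congr expR; field.
have : expR (y / 2) ^+ 2 <= (1 - y / 2)^-1 ^+ 2.
  by rewrite ler_sqr ?nnegrE ?expR_ge0// invr_ge0 ltW.
move=> /le_trans; apply; rewrite exprVn -[leLHS]mul1r ler_pdivrMr ?exprn_gt0//.
have : 0 <= y ^+ 2 * (1 - 3%:R * y + y ^+ 2) by rewrite mulr_ge0 ?sqr_ge0//; nra.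
have -> : (1 + y + y ^+ 2) * (1 - y / 2) ^+ 2 =
  1 + y ^+ 2 * (1 - 3%:R * y + y ^+ 2) / 4%:R by field.
by lra.
Qed.

(** The linear term has mean 0, and a variable with values in [0, 1] has variance at most 1/4, since
    [f ^+ 2 <= f]. *)
Lemma mgf_le (R : realType) (S : finType) (q f : S -> R) (l : R) :
  simplex q -> (forall s, 0 <= f s <= 1) -> `|l| <= 1 / 3%:R ->
  \sum_s q s * expR (l * (f s - dotp f q)) <= expR (l ^+ 2 / 4%:R).
Proof.
move=> sq f01 l3; set m := dotp f q; have [q0 q1] := sq.
have m01 : 0 <= m <= 1.
  by apply/andP; split; [apply: dotp_ge|apply: dotp_le] => // s; have /andP[] := f01 s.
have step s : q s * expR (l * (f s - m)) <=
    q s * (1 + l * (f s - m) + l ^+ 2 * (f s - m) ^+ 2).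
  rewrite ler_wpM2l// -exprMn; apply: expR_le_quadratic.
  rewrite normrM -[leRHS]mulr1 ler_pM// ler_norml.
  by have := f01 s; move: m01 => /andP[? ?] /andP[? ?]; apply/andP; split; lra.
apply: (le_trans (ler_sum _ (fun s _ => step s))).
apply: (@le_trans _ _ (1 + l ^+ 2 / 4%:R)); last exact: expR_ge1Dx.
have mE : \sum_s q s * f s = m by apply: eq_bigr => s _; rewrite mulrC.
have var : \sum_s q s * (f s - m) ^+ 2 <= 1 / 4%:R.
  have -> : \sum_s q s * (f s - m) ^+ 2 =
      \sum_s (q s * f s ^+ 2 + - (2 * m) * (q s * f s) + m ^+ 2 * q s).
    by apply: eq_bigr => s _; ring.
  rewrite 2!big_split /= -!mulr_sumr mE q1.
  have : \sum_s q s * f s ^+ 2 <= m.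
    rewrite -mE; apply: ler_sum => s _; rewrite ler_wpM2l//.
    by have /andP[f0 f1] := f01 s; rewrite expr2 ler_piMr.
  have : 0 <= (m - 2^-1) ^+ 2 by exact: sqr_ge0.
  by nra.
have -> : \sum_s q s * (1 + l * (f s - m) + l ^+ 2 * (f s - m) ^+ 2) =
    \sum_s ((q s + l * (q s * f s) + - (l * m) * q s) +
            l ^+ 2 * (q s * (f s - m) ^+ 2)).
  by apply: eq_bigr => s _; ring.
rewrite !big_split /= -!mulr_sumr mE q1.
have := ler_wpM2l (sqr_ge0 l) var; lra.
Qed.

(** * Deviations under a finite product measure *)

Section ProductMeasure.
Context {R : realType} {J S : finType}.
Variable p : J -> S -> R.
Hypothesis sp : forall j, simplex (p j).
Implicit Types (x : {ffun J -> S}) (F : {ffun J -> S} -> R).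

Definition weight x := \prod_j p j (x j).

Definition mean F := \sum_x weight x * F x.

Definition upd x j s : {ffun J -> S} := [ffun i => if i == j then s else x i].

Lemma weight_ge0 x : 0 <= weight x.
Proof. by apply: prodr_ge0 => j _; have [] := sp j. Qed.

Lemma ler_mean F1 F2 : (forall x, F1 x <= F2 x) -> mean F1 <= mean F2.
Proof. by move=> le12; apply: ler_sum => x _; rewrite ler_wpM2l// weight_ge0. Qed.

Lemma mean_cst c : mean (fun=> c) = c.
Proof.
rewrite /mean -mulr_suml /weight.
rewrite -(bigA_distr_bigA (fun j s => p j s)) /= big1 ?mul1r// => j _.
by have [] := sp j.
Qed.

Lemma meanZ c F : mean (fun x => c * F x) = c * mean F.
Proof. by rewrite /mean mulr_sumr; apply: eq_bigr => x _; ring. Qed.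

Lemma meanD F1 F2 : mean (fun x => F1 x + F2 x) = mean F1 + mean F2.
Proof. by rewrite /mean -big_split; apply: eq_bigr => x _; rewrite mulrDr. Qed.

Lemma mean_sum (I : finType) (F : I -> {ffun J -> S} -> R) :
  mean (fun x => \sum_i F i x) = \sum_i mean (F i).
Proof.
rewrite /mean exchange_big; apply: eq_bigr => x _; exact: mulr_sumr.
Qed.

Lemma weight_upd x j s : weight (upd x j s) * p j (x j) = weight x * p j s.
Proof.
rewrite /weight (bigD1 j)//= [in RHS](bigD1 j)//= ffunE eqxx.
rewrite (eq_bigr (fun i => p i (x i))); first by ring.
by move=> i /negbTE ij; rewrite ffunE ij.
Qed.

(** Exchanging coordinate [j] with an independent copy [s] is an involution that preserves the joint
    weight. This does the work of conditioning on the other coordinates. *)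
Lemma mean_resample F j : mean F = mean (fun x => \sum_s p j s * F (upd x j s)).
Proof.
pose phi (q : {ffun J -> S} * S) := (upd q.1 j q.2, q.1 j).
have phiK : involutive phi.
  move=> [x s]; rewrite /phi /= ffunE eqxx; congr pair.
  by apply/ffunP => i; rewrite !ffunE; case: eqP => [->|].
transitivity (\sum_(q : {ffun J -> S} * S) weight q.1 * p j q.2 * F q.1).
  rewrite -(pair_bigA _ (fun x s => weight x * p j s * F x)) /=.
  apply: eq_bigr => x _; rewrite -mulr_suml -mulr_sumr.
  by have [_ ->] := sp j; rewrite mulr1.
rewrite (reindex_inj (inv_inj phiK)) /=.
transitivity (\sum_(q : {ffun J -> S} * S) weight q.1 * p j q.2 * F (upd q.1 j q.2)).
  by apply: eq_bigr => q _; rewrite weight_upd.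
rewrite -(pair_bigA _ (fun x s => weight x * p j s * F (upd x j s))) /=.
apply: eq_bigr => x _; rewrite mulr_sumr.
by apply: eq_bigr => s _; rewrite mulrA.
Qed.

Definition deviation (r : seq J) (q : S -> R) (f : {ffun J -> S} -> S -> R) x :=
  \sum_(j <- r) (f x (x j) - dotp (f x) q).

(* [f x] is a random function that is independent of the coordinates in [r]. *)
Lemma deviation_mgf (r : seq J) q f (l : R) : uniq r -> simplex q ->
  (forall j, j \in r -> p j = q) ->
  (forall x s, 0 <= f x s <= 1) ->
  (forall x j s, j \in r -> f (upd x j s) = f x) -> `|l| <= 1 / 3%:R ->
  mean (fun x => expR (l * deviation r q f x)) <=
  expR ((size r)%:R * (l ^+ 2 / 4%:R)).
Proof.
move=> + sq + f01 + l3; elim: r => [|j r IH] /=.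
  move=> _ _ _; rewrite /deviation mul0r.
  under [X in mean X]funext => x do rewrite big_nil mulr0 expR0.
  by rewrite mean_cst expR0.
move=> /andP[jr ur] pq findep; rewrite (mean_resample _ j).
have fj x s : f (upd x j s) = f x by apply: findep; rewrite mem_head.
have dev x s : deviation (j :: r) q f (upd x j s) =
    f x s - dotp (f x) q + deviation r q f x.
  rewrite /deviation big_cons fj ffunE eqxx; congr (_ + _).
  apply: eq_big_seq => i ir; rewrite ffunE; case: eqP => // ij.
  by rewrite ij (negbTE jr) in ir.
apply: (@le_trans _ _ (mean (fun x =>
    expR (l ^+ 2 / 4%:R) * expR (l * deviation r q f x)))).
  apply: ler_mean => x.
  rewrite (eq_bigr (fun s => q s * expR (l * (f x s - dotp (f x) q)) *
    expR (l * deviation r q f x))).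
    by rewrite -mulr_suml ler_wpM2r ?expR_ge0// mgf_le.
  by move=> s _; rewrite dev mulrDr expRD mulrA pq// mem_head.
rewrite meanZ -[(size r).+1%:R]natr1 mulrDl mul1r addrC expRD ler_wpM2l ?expR_ge0//.
apply: IH => // [i ir|x i s ir]; first by rewrite pq// in_cons ir orbT.
by rewrite findep// in_cons ir orbT.
Qed.

(** Chernoff's bound with [l = 2 * e]: each sample contributes [e ^+ 2 - 2 * e ^+ 2] to the
    exponent, and [e <= 1/6] keeps [l] within 1/3. *)
Lemma deviation_tail (r : seq J) q f (e : R) : uniq r -> simplex q ->
  (forall j, j \in r -> p j = q) ->
  (forall x s, 0 <= f x s <= 1) ->
  (forall x j s, j \in r -> f (upd x j s) = f x) -> 0 <= e <= 1 / 6%:R ->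
  mean (fun x => ((size r)%:R * e < deviation r q f x)%R%:R) <=
  expR (- ((size r)%:R * e ^+ 2)).
Proof.
move=> ur sq pq f01 findep /andP[e0 e6].
have l3 : `|2 * e| <= 1 / 3%:R by rewrite ger0_norm; lra.
have mgf := deviation_mgf ur sq pq f01 findep l3.
set m := (size r)%:R in mgf *.
apply: (@le_trans _ _ (mean (fun x =>
    expR (- (m * (2 * e ^+ 2))) * expR (2 * e * deviation r q f x)))).
  apply: ler_mean => x; rewrite -expRD.
  case: ltP => [lt|_]; last exact: expR_ge0.
  rewrite [leLHS]mulr1n -[leLHS]expR0 ler_expR.
  have -> : - (m * (2 * e ^+ 2)) + 2 * e * deviation r q f x =
    2 * e * (deviation r q f x - m * e) by ring.
  by rewrite mulr_ge0 ?mulr_ge0// subr_ge0 ltW.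
rewrite meanZ; apply: le_trans (ler_wpM2l (expR_ge0 _) mgf) _.
by rewrite -expRD ler_expR le_eqVlt; apply/orP; left; apply/eqP; field.
Qed.

Lemma deviation_tail2 (r : seq J) q f (e : R) : uniq r -> simplex q ->
  (forall j, j \in r -> p j = q) ->
  (forall x s, 0 <= f x s <= 1) ->
  (forall x j s, j \in r -> f (upd x j s) = f x) -> 0 <= e <= 1 / 6%:R ->
  mean (fun x => ((size r)%:R * e < `|deviation r q f x|)%R%:R) <=
  2 * expR (- ((size r)%:R * e ^+ 2)).
Proof.
move=> ur sq pq f01 findep e06.
pose f' x s := 1 - f x s.
have f'01 x s : 0 <= f' x s <= 1.
  by rewrite /f'; have /andP[? ?] := f01 x s; apply/andP; split; lra.
have f'indep x j s : j \in r -> f' (upd x j s) = f' x.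
  by move=> jr; rewrite /f' findep.
have dev' x : deviation r q f' x = - deviation r q f x.
  have dE : dotp (f' x) q = 1 - dotp (f x) q.
    by rewrite (_ : f' x = (fun=> 1) \- f x)// dotpBl dotp_cst.
  rewrite /deviation -[RHS]sumrN; apply: eq_bigr => j _.
  by rewrite dE /f'; ring.
have t1 := deviation_tail ur sq pq f01 findep e06.
have t2 := deviation_tail ur sq pq f'01 f'indep e06.
rewrite [2 * _]mulr_natl mulr2n; apply: le_trans (lerD t1 t2).
rewrite /mean -big_split; apply: ler_sum => x _ /=.
rewrite -mulrDr ler_wpM2l ?weight_ge0// dev'.
rewrite -natrD ler_nat ltr_normr.
by do 2 case: (_ < _).
Qed.

End ProductMeasure.

(** * The drawn samples as a point of a finite product space *)

Section Samples.
Context {R : realType} {S A : finType} (M : mdp R S A).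
Context d (Om : measurableType d) (Pr : probability Om R).
Variables (K T : nat) (m1 m2 : nat -> nat).

Definition sample_size k t := if t == 0%N then m1 k else m2 k.

Definition sample_index : Type := (nat * nat * S * A * nat)%type.

Definition drawn (j : sample_index) :=
  let: (k, t, _, _, i) := j in [/\ (k < K)%N, (t < T)%N & (i < sample_size k t)%N].

Lemma finite_drawn : finite_set (drawn : set (nat * nat * S * A * nat)).
Proof.
pose N := \sum_(k < K) (m1 k + m2 k).
apply: (@sub_finite_set _ _
    (((`I_K `*` `I_T) `*` [set: S]) `*` [set: A] `*` `I_N)).
  move=> [[[[k t] s] a] i] /= [kK tT im]; do !split=> //.
  apply: (leq_trans im); rewrite /N (bigD1 (Ordinal kK))//= /sample_size.
  by apply: leq_trans (leq_addr _ _); case: eqP => _; rewrite ?leq_addr ?leq_addl.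
by do !(apply: finite_setX => //); exact: finite_II.
Qed.

Variable xi : nat -> nat -> S -> A -> nat -> Om -> S.
Hypothesis hxi : fresh_samples M Pr K T m1 m2 xi.

Variables (J : finType) (v : J -> nat * nat * S * A * nat).
Hypothesis v_inj : injective v.
Hypothesis v_drawn : forall j, drawn (v j).

Definition sample_law (j : J) : S -> R := let: (_, _, s, a, _) := v j in trans M s a.

Definition sample (w : Om) : {ffun J -> S} :=
  [ffun j => let: (k, t, s, a, i) := v j in xi k t s a i w].

Lemma sample_law_simplex j : simplex (sample_law j).
Proof. rewrite /sample_law; case: (v j) => [[[[k t] s] a] i]; exact: trans_simplex. Qed.

Let sampleE x : [set w | sample w = x] = \bigcap_j
  [set w | (let: (k, t, s, a, i) := v j in xi k t s a i) w = x j].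
Proof.
apply/seteqP; split=> [w /= wx j _|w H] /=.
  rewrite -wx ffunE; by case: (v j) => [[[[k t] s] a] i].
apply/ffunP => j; rewrite ffunE -H//.
by case: (v j) => [[[[k t] s] a] i].
Qed.

Lemma measurable_sample x : measurable [set w | sample w = x].
Proof.
rewrite sampleE; apply: fin_bigcap_measurable => [|j _]; first exact: finite_finset.
have [mxi _ _] := hxi; have := v_drawn j.
by case: (v j) => [[[[k t] s] a] i] dr; exact: mxi.
Qed.

Lemma sample_weight x : fine (Pr [set w | sample w = x]) = weight sample_law x.
Proof.
have [_ pxi ixi] := hxi.
(* The values of [x] transported along [v]; by injectivity each of these sets is a singleton on the
   range of [v]. *)
pose B (i : nat * nat * S * A * nat) : set S := [set y | forall j, v j = i -> y = x j].
pose X := fun j : nat * nat * S * A * nat => let: (k, t, s, a, i) := j in xi k t s a i.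
have BE j : X (v j) @^-1` B (v j) = [set w | X (v j) w = x j].
  by apply/seteqP; split=> w /=; [apply|move=> -> j' /v_inj ->].
have un : uniq [seq v j | j <- enum J] by rewrite map_inj_uniq ?enum_uniq.
have dr i : i \in [seq v j | j <- enum J] -> drawn i.
  by move=> /mapP[j _ ->].
have := ixi _ B un dr.
have -> : \bigcap_(i in [set` [seq v j | j <- enum J]]) (X i @^-1` B i) =
    [set w | sample w = x].
  rewrite sampleE; apply/seteqP; split=> w H.
    move=> j _; have : (X (v j) @^-1` B (v j)) w.
      by apply: H; rewrite /= map_f ?mem_enum.
    by rewrite BE.
  move=> i /= /mapP[j _ ->]; have := H j I.
  by move=> e j' /v_inj ->.
move=> ->; rewrite big_map big_enum /= /weight.
rewrite (eq_bigr (fun j => (sample_law j (x j))%:E)); last first.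
  move=> j _; have := BE j; rewrite /X => ->.
  rewrite /sample_law; have := v_drawn j.
  by case: (v j) => [[[[k t] s] a] i] dr'; exact: pxi.
by rewrite prodEFin.
Qed.

Lemma measurable_sample_event (E : set {ffun J -> S}) :
  measurable [set w | E (sample w)].
Proof.
rewrite (_ : [set w | E (sample w)] = \bigcup_(x in E) [set w | sample w = x]).
  apply: fin_bigcup_measurable => [|x _]; first exact: finite_finset.
  exact: measurable_sample.
by apply/seteqP; split=> w /=; [exists (sample w)|move=> [x Ex] /= ->].
Qed.

Lemma sample_event_prob (E : set {ffun J -> S}) :
  Pr [set w | E (sample w)] = (mean sample_law (fun x => `[< E x >]%:R))%:E.
Proof.
rewrite -[LHS]fineK; last by rewrite fin_num_measure//; exact: measurable_sample_event.
congr EFin; rewrite (measure_partition Pr measurable_sample); last first.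
  exact: measurable_sample_event.
apply: eq_bigr => x _; rewrite -sample_weight.
case: asboolP => Ex; rewrite ?mulr1 ?mulr0.
  by congr (fine (Pr _)); apply/seteqP; split=> [w []//|w /= wx]; split=> //=; rewrite wx.
rewrite (_ : _ `&` _ = set0) ?measure0//.
by apply/seteqP; split=> // w /= [Ew wx]; apply: Ex; rewrite -wx.
Qed.

Variable w : nat * nat * S * A * nat -> J.
Hypothesis wK : forall i, drawn i -> v (w i) = i.

Definition sample_fun (x : {ffun J -> S}) k t s a i : S := x (w (k, t, s, a, i)).

Lemma sample_funE om k t s a i : drawn (k, t, s, a, i) ->
  sample_fun (sample om) k t s a i = xi k t s a i om.
Proof. by move=> dr; rewrite /sample_fun ffunE wK. Qed.

Lemma empirical_kernel_mul (m : nat) (y : S -> A -> nat -> S) (f : S -> R) s a :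
  kernel_mul (empirical_kernel m y) f s a = m%:R^-1 * \sum_(i < m) f (y s a i).
Proof.
rewrite /kernel_mul /empirical_kernel.
under eq_bigr do rewrite -mulrA mulr_suml.
rewrite -mulr_sumr exchange_big; congr (_ * _); apply: eq_bigr => i _.
rewrite (bigD1 (y s a i))//= eqxx mul1r big1 ?addr0// => s' /negbTE.
by rewrite eq_sym => ->; rewrite mul0r.
Qed.

(** [f] may depend on every sample except those averaged in the row at [(k, t, s, a)]; this is what
    adaptive use requires. *)
Lemma empirical_kernel_tail k t s a (f : {ffun J -> S} -> S -> R) (e : R) :
  (k < K)%N -> (t < T)%N -> (0 < sample_size k t)%N ->
  (forall x s', 0 <= f x s' <= 1) ->
  (forall x i s', (i < sample_size k t)%N ->
     f (upd x (w (k, t, s, a, i)) s') = f x) -> 0 <= e <= 1 / 6%:R ->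
  mean sample_law (fun x => (e < `|kernel_mul (empirical_kernel (sample_size k t)
      (sample_fun x k t)) (f x) s a - kernel_mul (trans M) (f x) s a|)%R%:R) <=
  2 * expR (- ((sample_size k t)%:R * e ^+ 2)).
Proof.
move=> kK tT m0 f01 findep e06; set m := sample_size k t.
pose r := [seq w (k, t, s, a, i) | i <- iota 0 m].
have dr i : (i < m)%N -> drawn (k, t, s, a, i) by [].
have sr : size r = m by rewrite size_map size_iota.
have ur : uniq r.
  rewrite map_inj_in_uniq ?iota_uniq// => i i'; rewrite !mem_iota => im im' e'.
  have := wK (dr i im); rewrite e' wK; last exact: dr.
  by case.
have rP j : j \in r -> exists2 i, (i < m)%N & j = w (k, t, s, a, i).
  by move=> /mapP[i]; rewrite mem_iota => im ->; exists i.
have := @deviation_tail2 R J S sample_law sample_law_simplex r (trans M s a) f e ur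
  (trans_simplex M s a) _ f01 _ e06.
rewrite sr => tail; apply: le_trans (tail _ _).
- rewrite le_eqVlt; apply/orP; left; apply/eqP; congr mean; apply/funext => x.
  congr (_%:R); congr nat_of_bool.
  have m0' : 0 < m%:R :> R by rewrite ltr0n.
  rewrite empirical_kernel_mul -[RHS](ltr_pM2l _ _ _ (x := m%:R^-1)) ?invr_gt0//.
  rewrite mulKf ?lt0r_neq0// -[X in X * `|_|]gtr0_norm ?invr_gt0// -normrM.
  congr (_ < `|_|); rewrite /deviation big_map sumrB mulrBr; congr (_ - _).
    by rewrite -[X in iota 0 X]subn0 big_mkord.
  rewrite big_const_seq count_predT size_iota iter_addr addr0.
  rewrite -[dotp _ _ *+ m]mulr_natl.
  rewrite mulKf ?lt0r_neq0// /kernel_mul /dotp.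
  by apply: eq_bigr => s' _; rewrite mulrC.
- by move=> j /rP[i im ->]; rewrite /sample_law wK//; exact: dr.
- by move=> x j s' /rP[i im ->]; exact: findep.
Qed.

End Samples.

(** * The algorithm *)

Section Algorithm.
Context {R : realType} {S A : finType}.
Variables (M : mdp R S A) (h : (A -> R) -> R) (hbar : R).
Variables (omega : (A -> R) -> R) (gomega : (A -> R) -> (A -> R)).
Variables (T : nat) (m1 m2 : nat -> nat) (eta : nat -> nat -> R).
Local Notation g := (discount M).
Local Notation P := (trans M).
Local Notation sampling := (nat -> nat -> S -> A -> nat -> S).
Local Notation inner := (svmd_inner M h omega gomega m1 m2 eta).
Local Notation estimate := (svmd_estimate m1 m2).
Local Notation svmdM := (svmd M h hbar omega gomega T m1 m2 eta).
Implicit Types (xi : sampling) (k t : nat).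

Lemma eq_empirical_kernel (m : nat) (y y' : S -> A -> nat -> S) s a :
  (forall i, (i < m)%N -> y s a i = y' s a i) ->
  empirical_kernel m y s a = empirical_kernel m y' s a :> (S -> R).
Proof.
move=> e; apply/funext => s'; rewrite /empirical_kernel; congr (_ * _).
by apply: eq_bigr => i _; rewrite e.
Qed.

Lemma empirical_kernel_simplex (m : nat) (y : S -> A -> nat -> S) s a :
  (0 < m)%N -> simplex (empirical_kernel m y s a : S -> R).
Proof.
move=> m0; have m0' : 0 < m%:R :> R by rewrite ltr0n.
split=> [s'|].
  by rewrite mulr_ge0 ?invr_ge0 ?ler0n// sumr_ge0// => i _; rewrite ler0n.
have := @empirical_kernel_mul R S A m y (fun=> 1) s a; rewrite /kernel_mul.
under eq_bigr do rewrite mulr1.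
move=> ->; rewrite big_const_ord iter_addr addr0 -[1 *+ m]/(m%:R).
by rewrite mulVf// lt0r_neq0.
Qed.

(** Given [pi0] and [V0], the first [n] steps use only iterations below [n]. Thus the samples of a
    later iteration [n] are independent of the drift they are applied to. *)
Lemma eq_svmd_inner xi xi' k pi0 V0 n :
  (forall t s a i, (t < n)%N -> (i < sample_size m1 m2 k t)%N ->
     xi k t s a i = xi' k t s a i) ->
  inner xi k pi0 V0 n = inner xi' k pi0 V0 n.
Proof.
elim: n => [//|n IH] e /=.
rewrite IH; last by move=> t s a i tn; apply: e; exact: leqW.
suff : forall V, estimate xi k V0 n V = estimate xi' k V0 n V.
  by move=> est; case: (inner xi' k pi0 V0 n) => pi V; rewrite est.
move=> V; rewrite /svmd_estimate.
have -> : svmd_kernel0 m1 xi k = svmd_kernel0 m1 xi' k :> (S -> A -> S -> R).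
  by apply/funext => s; apply/funext => a; apply: eq_empirical_kernel => i im; apply: e.
case: eqP => // /eqP n0.
have -> // : empirical_kernel (m2 k) (xi k n) = empirical_kernel (m2 k) (xi' k n)
    :> (S -> A -> S -> R).
apply/funext => s; apply/funext => a; apply: eq_empirical_kernel => i im; apply: e => //.
by rewrite /sample_size (negbTE n0).
Qed.

Definition start_value xi k : S -> R :=
  if k == 0%N then fun=> (1 + hbar) / (1 - g)
  else policy_evaluation M h (svmd_kernel0 m1 xi k) (svmdM xi k).

Lemma eq_svmd xi xi' k : (0 < T)%N ->
  (forall k' t s a i, (k' < k)%N -> (t < T)%N -> (i < sample_size m1 m2 k' t)%N ->
     xi k' t s a i = xi' k' t s a i) ->
  svmdM xi k = svmdM xi' k.
Proof.
move=> T0; elim: k => [//|k IH] e /=.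
rewrite IH; last by move=> k' t s a i kk; apply: e; exact: leqW.
have -> : svmd_kernel0 m1 xi k = svmd_kernel0 m1 xi' k :> (S -> A -> S -> R).
  by apply/funext => s; apply/funext => a; apply: eq_empirical_kernel => i im; apply: e.
by rewrite (@eq_svmd_inner xi xi')// => t s a i tT im; exact: e.
Qed.

Hypothesis h_cont : continuous_on_simplex h.
Hypothesis grad : is_gradient_on_simplex omega gomega.
Hypothesis A0 : (0 < #|A|)%N.

Lemma uniform_policy_simplex : is_policy (uniform_policy : S -> A -> R).
Proof.
have A0' : 0 < #|A|%:R :> R by rewrite ltr0n.
move=> s; split=> [a|]; first by rewrite invr_ge0.
by rewrite sumr_const -[_ *+ _]mulr_natl mulfV// lt0r_neq0.
Qed.

Lemma svmd_innerS xi k pi0 V0 n :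
  inner xi k pi0 V0 n.+1 =
  let pi := (inner xi k pi0 V0 n).1 in let V := (inner xi k pi0 V0 n).2 in
  let pi' := fun s => argmin_simplex (pi s) (fun p =>
    eta k n * qobj M h (estimate xi k V0 n V) s p + bregman omega gomega (pi s) p) in
  (pi', fun s => Num.min (qobj M h (estimate xi k V0 n V) s (pi' s)) (V s)).
Proof. by rewrite /=; case: (inner xi k pi0 V0 n). Qed.

Let step_argmin (G : S -> A -> R) s (pi : A -> R) (c : R) :
  let p := argmin_simplex pi
    (fun p => c * qobj M h G s p + bregman omega gomega pi p) in
  simplex p /\ forall y, simplex y ->
    c * qobj M h G s p + bregman omega gomega pi p <=
    c * qobj M h G s y + bregman omega gomega pi y.
Proof.
apply: argmin_simplexP; first by exists (uniform_policy s); exact: uniform_policy_simplex.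
apply: continuous_onD; last exact: bregman_continuous.
apply: continuous_onZ; apply: continuous_onD => //.
by apply: continuous_onT; exact: continuous_dotp.
Qed.

Lemma svmd_inner_policy xi k pi0 V0 n :
  is_policy pi0 -> is_policy (inner xi k pi0 V0 n).1.
Proof.
move=> spi0; elim: n => [//|n IH] s; rewrite svmd_innerS /=.
by have [] := step_argmin (estimate xi k V0 n (inner xi k pi0 V0 n).2) s
  ((inner xi k pi0 V0 n).1 s) (eta k n).
Qed.

Lemma svmd_policy xi k : is_policy (svmdM xi k).
Proof.
elim: k => [|k IH]; first exact: uniform_policy_simplex.
exact: svmd_inner_policy.
Qed.

Lemma svmd_inner_min xi k pi0 V0 n s p : simplex p ->
  let pi := (inner xi k pi0 V0 n).1 in let V := (inner xi k pi0 V0 n).2 in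
  let G := estimate xi k V0 n V in let pi' := (inner xi k pi0 V0 n.+1).1 in
  eta k n * qobj M h G s (pi' s) + bregman omega gomega (pi s) (pi' s) <=
  eta k n * qobj M h G s p + bregman omega gomega (pi s) p.
Proof.
move=> sp; rewrite svmd_innerS /=.
by have [_] := step_argmin (estimate xi k V0 n (inner xi k pi0 V0 n).2) s
  ((inner xi k pi0 V0 n).1 s) (eta k n); apply.
Qed.

End Algorithm.

(** * Policy evaluation with one state left out *)

Section LeaveOneOut.
Context {R : realType} {S A : finType}.
Variables (M : mdp R S A) (h : (A -> R) -> R) (hbar : R).
Hypothesis h_itv : forall x, simplex x -> 0 <= h x <= hbar.
Local Notation g := (discount M).
Implicit Types (K : S -> A -> S -> R) (pi : S -> A -> R).

Definition loo_kernel K pi s0 s s' : R :=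
  if s == s0 then 0 else policy_kernel K pi s s'.

(** The factor in front scales the solution into [0, 1], as the deviation bound requires. *)
Definition loo_const K pi s0 s : R :=
  (1 - g) / (1 + hbar) *
  bellman_fix g (loo_kernel K pi s0)
    (fun s => if s == s0 then 0 else policy_cost M h pi s) s.

(** The expected discount at the first visit to [s0], for the chain of [K] and [pi] started at
    [s]. *)
Definition loo_coef K pi s0 s : R :=
  bellman_fix g (loo_kernel K pi s0) (fun s => (s == s0)%:R) s.

Lemma eq_loo_kernel K K' pi s0 : (forall s, s != s0 -> K s = K' s) ->
  loo_kernel K pi s0 = loo_kernel K' pi s0.
Proof.
move=> e; apply/funext => s; apply/funext => s'; rewrite /loo_kernel /policy_kernel.
by case: eqP => // /eqP ss; apply: eq_bigr => a _; rewrite e.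
Qed.

Let g01 : 0 <= g < 1. Proof. by have /andP[/ltW-> ->] := discount_itv M. Qed.
Let g1' : 0 < 1 - g. Proof. by rewrite subr_gt0; have /andP[] := g01. Qed.

Lemma loo_kernel_substochastic K pi s0 : (forall s a, simplex (K s a)) ->
  is_policy pi -> substochastic (loo_kernel K pi s0).
Proof.
move=> sK spi; have [Q0 Q1] := policy_kernel_substochastic sK spi.
split=> [s s'|s]; rewrite /loo_kernel; first by case: ifP.
by have [_|_] := eqVneq s s0; [rewrite big1|exact: Q1].
Qed.

Lemma hbar_ge0 pi (s : S) : is_policy pi -> 0 <= hbar.
Proof. by move=> spi; have /andP[] := h_itv (spi s); exact: le_trans. Qed.

Lemma loo_const_itv K pi s0 s : (forall s a, simplex (K s a)) ->
  is_policy pi -> 0 <= loo_const K pi s0 s <= 1.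
Proof.
move=> sK spi; have sQ := loo_kernel_substochastic s0 sK spi.
have H0 : 0 < 1 + hbar by have := hbar_ge0 s spi; lra.
have c0 : 0 <= (1 - g) / (1 + hbar) by rewrite divr_ge0// ltW.
apply/andP; split.
  rewrite mulr_ge0// bellman_fix_ge0// => s'; case: ifP => // _.
  by have /andP[] := policy_cost_itv M h_itv s' spi.
rewrite (_ : 1 = (1 - g) / (1 + hbar) * ((1 + hbar) / (1 - g))); last first.
  by field; rewrite !lt0r_neq0.
rewrite ler_wpM2l// bellman_fix_le//; first exact: ltW.
move=> s'; case: ifP => _; first exact: ltW.
by have /andP[] := policy_cost_itv M h_itv s' spi.
Qed.

Lemma loo_coef_itv K pi s0 s : (forall s a, simplex (K s a)) ->
  is_policy pi -> 0 <= loo_coef K pi s0 s <= 1.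
Proof.
move=> sK spi; have sQ := loo_kernel_substochastic s0 sK spi.
have [Q0 Q1] := sQ; have /andP[g0 g1] := g01.
apply/andP; split; first by apply: bellman_fix_ge0 => // s'; rewrite ler0n.
rewrite -subr_le0 -(mul0r (1 - g)^-1).
apply: (substochastic_subsolution (f := fun s => loo_coef K pi s0 s - 1) g01 sQ) => // {}s.
rewrite {1}/loo_coef bellman_fixE// /bellman -/(loo_coef K pi s0).
have [->|ss] := eqVneq s s0.
  rewrite !big1 ?mulr0; [by rewrite !addr0 subrr| |] => s' _; by rewrite /loo_kernel eqxx mul0r.
under [X in _ <= g * X + _]eq_bigr do rewrite mulrBr mulr1.
rewrite sumrB mulrBr; have := ler_wpM2l g0 (Q1 s); rewrite mulr1.
have -> : (nat_of_bool false)%:R = 0 :> R by [].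
by move: g1; rewrite /loo_coef; lra.
Qed.

(* [K]'s row at [s0] enters the solution of the Bellman equation only through
   the scalar [V s0], so two deviations of fixed vectors control that of [V]. *)
Lemma evaluation_noise_le K pi s0 a (e : R) : (forall s a, simplex (K s a)) ->
  is_policy pi ->
  `|kernel_mul K (loo_const K pi s0) s0 a -
    kernel_mul (trans M) (loo_const K pi s0) s0 a| <= e ->
  `|kernel_mul K (loo_coef K pi s0) s0 a -
    kernel_mul (trans M) (loo_coef K pi s0) s0 a| <= e ->
  `|kernel_mul K (policy_evaluation M h K pi) s0 a -
    kernel_mul (trans M) (policy_evaluation M h K pi) s0 a| <=
  2 * ((1 + hbar) / (1 - g)) * e.
Proof.
move=> sK spi; rewrite policy_evaluationE; set V := bellman_fix _ _ _.
have sQ := policy_kernel_substochastic sK spi.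
have H0 : 0 < 1 + hbar by have := hbar_ge0 s0 spi; lra.
have VE := @bellman_leave_one_out _ _ g _ (policy_cost M h pi) V s0 g01 sQ
  (bellman_fixE _ g01 sQ).
have V0 : 0 <= V s0.
  by apply: bellman_fix_ge0 => // s; have /andP[] := policy_cost_itv M h_itv s spi.
have V1 : V s0 <= (1 + hbar) / (1 - g).
  apply: bellman_fix_le => //; first exact: ltW.
  by move=> s; have /andP[] := policy_cost_itv M h_itv s spi.
set B := (1 + hbar) / (1 - g) in V1 *.
have mulV (Q : S -> A -> S -> R) : kernel_mul Q V s0 a =
    B * kernel_mul Q (loo_const K pi s0) s0 a +
    V s0 * kernel_mul Q (loo_coef K pi s0) s0 a.
  rewrite /kernel_mul !mulr_sumr -big_split; apply: eq_bigr => s' _ /=.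
  rewrite {1}VE /loo_const -/(loo_coef K pi s0 s') -/(loo_kernel K pi s0) /B.
  by field; rewrite !lt0r_neq0.
rewrite !mulV; move: (kernel_mul K _ _ _) (kernel_mul K _ _ _) => a2 a1.
move: (kernel_mul _ _ _ _) (kernel_mul _ _ _ _) => b2 b1 l1 l2.
rewrite (_ : _ - _ = B * (a1 - b1) + V s0 * (a2 - b2)); last by ring.
apply: (le_trans (ler_normD _ _)).
rewrite [`|B * _|]normrM [`|V s0 * _|]normrM (ger0_norm V0).
have B0 : 0 <= B by rewrite divr_ge0// ltW.
rewrite (ger0_norm B0) (_ : 2 * B * e = B * e + B * e); last by ring.
by apply: lerD; [rewrite ler_wpM2l|apply: ler_pM].
Qed.

End LeaveOneOut.

Section Linfty.
Context {R : realType} {S : finType}.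
Implicit Types V : S -> R.

Lemma linfty_ge V s : `|V s| <= linfty V.
Proof. exact: (le_bigmax _ (fun s => `|V s|)). Qed.

Lemma linfty_ge0 V : 0 <= linfty V.
Proof. exact: bigmax_ge_id. Qed.

Lemma linfty_le V c : 0 <= c -> (forall s, `|V s| <= c) -> linfty V <= c.
Proof. by move=> c0 Vc; apply: bigmax_le. Qed.

End Linfty.

(** * One epoch of the algorithm *)

Section SvmdEpoch.
Context {R : realType} {S A : finType}.
Variables (M : mdp R S A) (h : (A -> R) -> R) (hbar : R).
Hypothesis h_itv : forall x, simplex x -> 0 <= h x <= hbar.
Hypothesis h_cont : continuous_on_simplex h.
Variables (omega : (A -> R) -> R) (gomega : (A -> R) -> (A -> R)) (mu : R).
Hypothesis mu0 : 0 < mu.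
Hypothesis grad : is_gradient_on_simplex omega gomega.
Hypothesis osc : l1_strongly_convex omega gomega.
Hypothesis hsc : convex_relative mu omega h.
Hypothesis A0 : (0 < #|A|)%N.
Variables (T : nat) (m1 m2 : nat -> nat) (eta : nat -> nat -> R).
Local Notation g := (discount M).
Local Notation P := (trans M).
Variables (Vf : (S -> A -> R) -> S -> R) (pis : S -> A -> R).
Hypothesis VfE : forall pi, is_policy pi -> forall s,
  Vf pi s = qobj M h (kernel_mul P (Vf pi)) s (pi s).
Hypothesis opt : optimal_policy Vf pis.
Variable xi : nat -> nat -> S -> A -> nat -> S.
Variable k : nat.
Local Notation pi0 := (svmd M h hbar omega gomega T m1 m2 eta xi k).
Local Notation V0 := (start_value M h hbar omega gomega T m1 m2 eta xi k).
Local Notation inner := (svmd_inner M h omega gomega m1 m2 eta xi k pi0 V0).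
Local Notation K0 := (svmd_kernel0 m1 xi k).

Let g0 : 0 <= g. Proof. by have /andP[/ltW] := discount_itv M. Qed.
Let g1 : g < 1. Proof. by have /andP[] := discount_itv M. Qed.
Let g1' : 0 < 1 - g. Proof. by rewrite subr_gt0. Qed.

Let spis : is_policy pis. Proof. by have [] := opt. Qed.

(** Optimality makes [pis s] a minimizer of the one-step objective, which inherits relative strong
    convexity from [h]: the objective grows at least like the divergence. *)
Lemma optimal_bregman s p : simplex p ->
  Vf pis s + mu * bregman omega gomega (pis s) p <=
  qobj M h (kernel_mul P (Vf pis)) s p.
Proof.
move=> sp; rewrite VfE//.
apply: (@minimizer_bregman _ _ omega gomega (qobj M h (kernel_mul P (Vf pis)) s)) => //.
- exact: ltW.
- exact: convex_relativeD.
- by move=> z sz; rewrite -VfE//; exact: optimal_qobj.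
Qed.

Lemma value_itv pi s : is_policy pi -> 0 <= Vf pi s <= (1 + hbar) / (1 - g).
Proof.
move=> spi; have sQ := policy_kernel_substochastic (trans_simplex M) spi.
have g01 : 0 <= g < 1 by rewrite g0 g1.
have E : forall s, Vf pi s = bellman_fix g (policy_kernel P pi) (policy_cost M h pi) s.
  apply: (bellman_unique (r := policy_cost M h pi) g01 sQ) => s'.
    by rewrite {1}VfE// qobj_bellman.
  exact: bellman_fixE.
have H0 := hbar_ge0 h_itv s spi.
rewrite E; apply/andP; split.
  by apply: bellman_fix_ge0 => // s'; have /andP[] := policy_cost_itv M h_itv s' spi.
apply: bellman_fix_le => //; first by lra.
by move=> s'; have /andP[] := policy_cost_itv M h_itv s' spi.
Qed.

Definition noise0 s a : R := kernel_mul K0 V0 s a - kernel_mul P V0 s a.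

Definition drift t : S -> R := fun s => V0 s - (inner t).2 s.

(** Normalized by its maximum, so that a deviation bound for functions into [0, 1] becomes an error
    proportional to the drift. A zero drift is divided by 0, which gives 0. *)
Definition unit_drift t : S -> R := fun s => drift t s / linfty (drift t).

Lemma unit_drift_itv t s : 0 <= unit_drift t s <= 1.
Proof.
have d0 : 0 <= drift t s.
  rewrite subr_ge0; elim: t => [//|t IH].
  by rewrite svmd_innerS /= ge_min IH orbT.
rewrite /unit_drift divr_ge0 ?linfty_ge0//=.
have := linfty_ge (drift t) s; rewrite ger0_norm// => dl.
have [->|l0] := eqVneq (linfty (drift t)) 0; first by rewrite invr0 mulr0.
by rewrite ler_pdivrMr ?mul1r// lt0r l0 linfty_ge0.
Qed.

Definition noise t s a : R := if t == 0%N then 0 else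
  kernel_mul (empirical_kernel (m2 k) (xi k t)) ((inner t).2 \- V0) s a -
  kernel_mul P ((inner t).2 \- V0) s a.

Lemma svmd_estimateE t s a : svmd_estimate m1 m2 xi k V0 t (inner t).2 s a =
  noisy M noise0 (inner t).2 s a + noise t s a.
Proof.
rewrite /svmd_estimate /noisy /noise0 /noise; case: eqP => [->|_] /=; first by ring.
by rewrite [kernel_mul P (_ \- _) s a]kernel_mulB; ring.
Qed.

Lemma noise_drift_le t (e c : R) s a : 0 <= e ->
  `|kernel_mul (empirical_kernel (m2 k) (xi k t)) (unit_drift t) s a -
    kernel_mul P (unit_drift t) s a| <= e ->
  (forall s, `|drift t s| <= c) -> `|noise t s a| <= e * c.
Proof.
move=> e0 dev dc; have c0 : 0 <= c by apply: le_trans (dc s).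
have lc : linfty (drift t) <= c by exact: linfty_le.
rewrite /noise; case: eqP => _; first by rewrite normr0 mulr_ge0.
have dE s' : ((inner t).2 \- V0) s' = - linfty (drift t) * unit_drift t s'.
  rewrite /unit_drift /=; have [l0|l0] := eqVneq (linfty (drift t)) 0.
    have := linfty_ge (drift t) s'; rewrite l0 normr_le0 => /eqP.
    by rewrite /drift => d0; rewrite oppr0 mul0r -opprB d0 oppr0.
  by rewrite mulrCA mulNr mulfV// mulrN1 /drift opprB.
have mulE Q : kernel_mul Q ((inner t).2 \- V0) s a =
    - linfty (drift t) * kernel_mul Q (unit_drift t) s a.
  rewrite /kernel_mul mulr_sumr; apply: eq_bigr => s' _.
  by rewrite dE; ring.
rewrite !mulE -mulrBr normrM normrN (ger0_norm (linfty_ge0 _)) mulrC.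
by apply: ler_pM => //; exact: linfty_ge0.
Qed.

(** [V0] is constant in this epoch, and every stochastic kernel fixes constants. *)
Lemma noise0_first_epoch : k = 0%N -> (0 < m1 k)%N -> forall s a, noise0 s a = 0.
Proof.
move=> k0 m0 s a; rewrite /noise0.
have -> : V0 = fun=> (1 + hbar) / (1 - g) by rewrite /start_value k0.
have c (Q : S -> A -> S -> R) : simplex (Q s a) ->
    kernel_mul Q (fun=> (1 + hbar) / (1 - g)) s a = (1 + hbar) / (1 - g).
  by move=> [_ Q1]; rewrite /kernel_mul -mulr_suml Q1 mul1r.
rewrite !c ?subrr//; first exact: trans_simplex.
exact: empirical_kernel_simplex.
Qed.

Lemma start_valueE s : k <> 0%N -> (0 < m1 k)%N -> V0 s = qobj M h (noisy M noise0 V0) s (pi0 s).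
Proof.
move=> /eqP/negbTE k0 m0.
have sp : is_policy pi0 by exact: svmd_policy.
have sK s' a' : simplex (K0 s' a' : S -> R) by exact: empirical_kernel_simplex.
have g01 : 0 <= g < 1 by rewrite g0 g1.
have -> : noisy M noise0 V0 = kernel_mul K0 V0.
  by apply/funext => s'; apply/funext => a; rewrite /noisy /noise0; ring.
rewrite qobj_bellman /start_value k0 policy_evaluationE; apply: bellman_fixE => //.
exact: policy_kernel_substochastic.
Qed.

Lemma svmd_epoch (u d0 e2 : R) : (0 < T)%N -> 18 <= (1 - g) * T%:R ->
  (0 < m1 k)%N ->
  (forall t, (t < T)%N -> eta k t = 2 / (mu * t.+1%:R)) ->
  (forall s, Vf pi0 s - Vf pis s <= u) ->
  (forall s, mu * bregman omega gomega (pi0 s) (pis s) <= u) ->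
  (k = 0%N -> (1 + hbar) / (1 - g) <= u) ->
  0 < u ->
  (forall s a, `|noise0 s a| <= d0) ->
  d0 ^+ 2 <= mu * (1 - g) ^+ 3 * (u / 500%:R) ->
  0 <= e2 -> e2 <= (1 - g) ^+ 2 / 20%:R ->
  (e2 * (117%:R / 100%:R * u)) ^+ 2 * ln T%:R / (2 * mu) <= (1 - g) * (u / 100%:R) ->
  (forall t s a, (0 < t)%N -> (t < T)%N ->
    `|kernel_mul (empirical_kernel (m2 k) (xi k t)) (unit_drift t) s a -
      kernel_mul P (unit_drift t) s a| <= e2) ->
  let pi1 := svmd M h hbar omega gomega T m1 m2 eta xi k.+1 in
  forall s, Vf pi1 s - Vf pis s <= u / 2 /\
    mu * bregman omega gomega (pi1 s) (pis s) <= u / 2.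
Proof.
move=> T0 T18 m10 etaE gap0 breg0 k0u u0 noise0_le d0u e20 e2g qle dev pi1 s.
have spi0 : is_policy pi0 by exact: svmd_policy.
have [Vt VtE] := noisy_solution M h noise0 spis.
have VsE s' : Vf pis s' = qobj M h (kernel_mul P (Vf pis)) s' (pis s') by exact: VfE.
(* In the first epoch [Vt] is the optimal value and [V0] its a priori bound. Later, [tau = 1/10]
   gives [1.1 u + u / 100] from above, and [tau = 1] gives [- u / 1000] from below. *)
have gap s' : V0 s' - Vt s' <= 111%:R / 100%:R * u /\
    - (6%:R / 100%:R * u) <= V0 s' - Vt s'.
  have [k0|k0] := eqVneq k 0%N.
    have n0 := noise0_first_epoch k0 m10.
    have VtV : forall s, Vt s = Vf pis s.
      have g01 : 0 <= g < 1 by rewrite g0 g1.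
      apply: (@bellman_unique _ _ g _ (policy_cost M h pis) _ _ g01
        (policy_kernel_substochastic (trans_simplex M) spis)) => s1.
        rewrite -qobj_bellman {1}VtE; congr (qobj M h _ _ _).
        by apply/funext => s2; apply/funext => a; rewrite /noisy n0 addr0.
      by rewrite -qobj_bellman -VfE.
    have -> : V0 s' = (1 + hbar) / (1 - g) by rewrite /start_value k0.
    rewrite VtV; have /andP[] := value_itv s' spis; have := k0u k0.
    by move: ((1 + hbar) / (1 - g)) u0 => B u0; split; lra.
  have VE s1 := @start_valueE s1 (elimN eqP k0) m10.
  have tau0 : 0 < 10%:R^-1 :> R by rewrite invr_gt0.
  have [+ _] := noisy_value_transfer mu0 osc spis VsE optimal_bregman noise0_le
    d0u VtE s' tau0 spi0 (VfE spi0) VE.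
  have [_ +] := noisy_value_transfer mu0 osc spis VsE optimal_bregman noise0_le
    d0u VtE s' ltr01 spi0 (VfE spi0) VE.
  have := gap0 s'; have : u / 500%:R / (2 * 10%:R^-1) = u / 100%:R by field.
  by move=> ->; move: u0 => u0; split; lra.
have e20u : e2 * (111%:R / 100%:R * u + 6%:R / 100%:R * u) = e2 * (117%:R / 100%:R * u).
  by congr (_ * _); field.
(* Here 1.17 / 20 is 0.0585; adding the 0.001 of [z / 2] stays within the 0.06 allowed for the lower
   bound. *)
have Xle : e2 * (117%:R / 100%:R * u) <= (1 - g) ^+ 2 * (117%:R / 2000%:R * u).
  have := ler_wpM2r (ltW u0) e2g; lra.
have gg : (1 - g) ^+ 2 * u <= (1 - g) * u.
  by rewrite ler_wpM2r ?(ltW u0)// expr2 ler_piMr ?(ltW g1')//; have := g0; lra.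
have gu : 0 <= (1 - g) * u by rewrite mulr_ge0// ltW.
apply: (@epoch_bound R S A M h omega gomega mu mu0 grad osc hsc (Vf pis) pis spis
  VsE optimal_bregman noise0 d0 (u / 500%:R) noise0_le d0u Vt VtE T
  (fun t => (inner t).1) (fun t => (inner t).2) noise e2 (111%:R / 100%:R * u)
  (6%:R / 100%:R * u) u T0).
- by move=> t _; exact: svmd_inner_policy.
- move=> t s' p tT sp; rewrite -etaE//.
  have := @svmd_inner_min _ _ _ M h omega gomega m1 m2 eta h_cont grad A0 xi k pi0 V0 t s' p sp.
  rewrite /= (_ : svmd_estimate m1 m2 xi k V0 t (inner t).2 =
    fun s a => noisy M noise0 (inner t).2 s a + noise t s a)//.
  by apply/funext => s1; apply/funext => a; exact: svmd_estimateE.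
- move=> t s' tT.
  rewrite (_ : (fun s a => noisy M noise0 (inner t).2 s a + noise t s a) =
    svmd_estimate m1 m2 xi k V0 t (inner t).2) ?svmd_innerS//.
  by apply/funext => s1; apply/funext => a; rewrite svmd_estimateE.
- by [].
- move=> t c tT dc s' a.
  have [->|t0] := posnP t; first by rewrite normr0 mulr_ge0// (le_trans _ (dc s')).
  by apply: noise_drift_le => //; exact: dev.
(* In the first epoch [V0] is an a priori bound, which the Bellman operator does not raise; later
   [V0] solves its equation exactly. *)
- move=> s' /=; have [k0|k0] := eqVneq k 0%N.
    have V0E : V0 = fun=> (1 + hbar) / (1 - g) by rewrite /start_value k0.
    rewrite V0E.
    have -> : (fun s a => noisy M noise0 (fun=> (1 + hbar) / (1 - g)) s a + noise 0 s a) =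
        kernel_mul P (fun=> (1 + hbar) / (1 - g)).
      apply/funext => s1; apply/funext => a.
      by rewrite /noisy noise0_first_epoch// /noise eqxx !addr0.
    rewrite qobj_bellman /bellman.
    have /andP[_] := policy_cost_itv M h_itv s' spi0.
    have H0 := hbar_ge0 h_itv s' spi0.
    have B0 : 0 <= (1 + hbar) / (1 - g) by rewrite divr_ge0 ?(ltW g1')//; lra.
    have := substochastic_le s' (policy_kernel_substochastic (trans_simplex M) spi0) B0
      (fun _ => lexx _).
    move=> /(ler_wpM2l g0).
    have : (1 + hbar) / (1 - g) = 1 + hbar + g * ((1 + hbar) / (1 - g)).
      by field; rewrite lt0r_neq0.
    by move: ((1 + hbar) / (1 - g)) => B; lra.
  rewrite [leRHS](start_valueE s' (elimN eqP k0) m10) le_eqVlt; apply/orP; left; apply/eqP.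
  congr (qobj M h _ _ _); apply/funext => s1; apply/funext => a.
  by rewrite /noise eqxx addr0.
- by move=> s'; have [] := gap s'.
- by move=> s'; have [] := gap s'.
- exact: breg0.
- exact: e20.
- by rewrite !mulr_ge0// ?invr_ge0// ltW.
- by rewrite !mulr_ge0// ?invr_ge0// ltW.
- exact: ltW.
- by rewrite e20u; lra.
- exact: T18.
- by apply: VfE; exact: svmd_inner_policy.
- by [].
- by [].
- by rewrite e20u; lra.
- by rewrite e20u.
- by lra.
Qed.

End SvmdEpoch.

(** * Accuracies granted by the sample sizes *)

Section SampleSizes.
Context {R : realType}.

(** Already [ln 4] is at least 1/2 + 1/3 + 1/4. *)
Lemma ln_ge1 (T : nat) : (18 <= T)%N -> 1 <= ln T%:R :> R.
Proof.
move=> T18; have le1 n : (0 < n)%N -> n.+1%:R^-1 <= ln n.+1%:R - ln n%:R :> R.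
  exact: invn_le_lnB.
have T0 : (0 : R) < T%:R by rewrite ltr0n (leq_trans _ T18).
apply: (@le_trans _ _ (ln 4)); last by rewrite ler_ln ?posrE// ler_nat (leq_trans _ T18).
have := le1 1%N isT; have := le1 2%N isT; have := le1 3%N isT.
by rewrite ln1; lra.
Qed.

(** The radius solves [m1 * e ^+ 2 = L], which makes the tail [expR (- L)]. The 1 in the maximum
    gives [e ^+ 2 <= 1/200]; the other argument gives the quadratic bound, where 200 * 64 / 500
    exceeds the square of the factor 2. *)
Lemma m1_bound (g H mu u L : R) (T m1 : nat) : 0 < 1 - g -> 0 < H -> 0 < mu -> 0 < u ->
  0 < L -> 0 <= ln T%:R :> R ->
  200 * Num.max (64 * H ^+ 2 / mu * (1 - g) ^- 5 * u^-1 * (ln T%:R + 1)) 1 * L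
    <= m1%:R ->
  let e := Num.sqrt (L / m1%:R) in
  [/\ (0 < m1)%N, 0 <= e <= 1 / 6%:R, m1%:R * e ^+ 2 = L &
    (2 * (H / (1 - g)) * e) ^+ 2 <= mu * (1 - g) ^+ 3 * (u / 500%:R)].
Proof.
move=> g1 H0 mu0 u0 L0 lT hm e.
have mx1 : 200 * L <= m1%:R.
  apply: le_trans hm; rewrite ler_wpM2r ?(ltW L0)// ler_peMr//.
  by rewrite le_max lexx orbT.
have m0 : 0 < m1%:R :> R by apply: lt_le_trans mx1; rewrite mulr_gt0.
have e2 : e ^+ 2 = L / m1%:R by rewrite sqr_sqrtr// divr_ge0// ltW.
split.
- by rewrite -(@ltr0n R).
- rewrite sqrtr_ge0 /=.
  rewrite -(@ler_pXn2r R 2)// ?nnegrE ?sqrtr_ge0// e2 ler_pdivrMr//; lra.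
- by rewrite e2 mulrC divfK// lt0r_neq0.
rewrite exprMn e2 [_ * (L / _)]mulrA ler_pdivrMr//.
set c := 64 * H ^+ 2 / mu * (1 - g) ^- 5 * u^-1 in hm.
have c0 : 0 < c by rewrite !mulr_gt0 ?invr_gt0 ?exprn_gt0.
have hc : 200 * c * L <= m1%:R.
  apply: le_trans hm; rewrite ler_wpM2r ?(ltW L0)// ler_wpM2l//.
  by rewrite le_max ler_peMr ?(ltW c0)//; lra.
have k0 : 0 <= mu * (1 - g) ^+ 3 * (u / 500%:R).
  apply: mulr_ge0; last by apply: divr_ge0; [exact: ltW|exact: ler0n].
  by apply: mulr_ge0; [exact: ltW|apply: exprn_ge0; exact: ltW].
apply: le_trans (ler_wpM2l k0 hc).
have -> : mu * (1 - g) ^+ 3 * (u / 500%:R) * (200 * c * L) =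
  128%:R / 5%:R * (H / (1 - g)) ^+ 2 * L.
  by rewrite /c; field; rewrite !lt0r_neq0.
have : 0 <= (H / (1 - g)) ^+ 2 * L by rewrite mulr_ge0 ?sqr_ge0// ltW.
by move: (H / (1 - g)) => a; lra.
Qed.

(** The coefficient of [(1 - g) ^- 4 * L] is at least 400, because [D0 >= 1/2] and [ln T + 1 >= 2];
    its square root is the 20. The last bound controls the harmonic sum of an epoch:
    [(1 - g) * u <= H + mu * D0] lets the same coefficient absorb [u / mu]. *)
Lemma m2_bound (g H mu u D0 L : R) (T m2 : nat) : 0 < 1 - g -> g >= 0 -> 0 < H ->
  0 < mu -> 0 < u -> 2^-1 <= D0 ->
  0 < L -> 1 <= ln T%:R :> R -> (1 - g) * u <= H + mu * D0 ->
  (400 * (H + mu * D0) / mu * (ln T%:R + 1) + 16) * (1 - g) ^- 4 * L <= m2%:R ->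
  let e := Num.sqrt (L / m2%:R) in
  [/\ (0 < m2)%N, 0 <= e, e <= (1 - g) ^+ 2 / 20%:R, m2%:R * e ^+ 2 = L &
    (e * (117%:R / 100%:R * u)) ^+ 2 * ln T%:R / (2 * mu) <= (1 - g) * (u / 100%:R)].
Proof.
move=> g1 g0 H0 mu0 u0 D0h L0 lT uH hm e.
have HD : 0 < H + mu * D0 by rewrite addr_gt0// mulr_gt0//; lra.
have [N [NE N0 N16]] : exists N : R, [/\ N = 400, 0 < N & N = 16 * 25].
  by exists 400; split; [by []|rewrite ltr0n|ring].
rewrite -NE in hm; set c := N * (H + mu * D0) / mu * (ln T%:R + 1) + 16 in hm.
have HDm : 2^-1 <= (H + mu * D0) / mu.
  by rewrite ler_pdivlMr//; have := ler_wpM2l (ltW mu0) D0h; lra.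
have cE : c = N * ((H + mu * D0) / mu * (ln T%:R + 1)) + 16 by rewrite /c !mulrA.
have l0 : 0 <= ln T%:R :> R by lra.
have cl : N * ((H + mu * D0) / mu * ln T%:R) <= c.
  rewrite cE; apply: ler_wpDr => //; rewrite ler_wpM2l ?(ltW N0)//.
  by rewrite ler_wpM2l ?lerDl//; apply: divr_ge0; exact: ltW.
have c400 : N <= c.
  rewrite cE; apply: ler_wpDr => //; rewrite ler_peMr ?(ltW N0)//.
  have l2 : 2 <= ln T%:R + 1 :> R by lra.
  by have := ler_pM _ _ HDm l2; rewrite mulVf//; apply; rewrite ?invr_ge0.
have c0 : 0 < c by lra.
have cm0 : 0 < c * (1 - g) ^- 4 * L by rewrite !mulr_gt0 ?invr_gt0 ?exprn_gt0.
have m0 : 0 < m2%:R :> R by exact: lt_le_trans hm.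
have e2 : e ^+ 2 = L / m2%:R by rewrite sqr_sqrtr// divr_ge0// ltW.
have e2c : c * e ^+ 2 <= (1 - g) ^+ 4.
  rewrite e2 mulrA ler_pdivrMr// mulrC -ler_pdivrMl ?exprn_gt0//.
  by apply: le_trans hm; rewrite le_eqVlt; apply/orP; left; apply/eqP; ring.
split.
- by rewrite -(@ltr0n R).
- exact: sqrtr_ge0.
- have g2 : 0 <= (1 - g) ^+ 2 by exact: sqr_ge0.
  have e0 : 0 <= e by exact: sqrtr_ge0.
  rewrite -(@ler_pXn2r R 2) ?nnegrE//; last by apply: divr_ge0.
  have := ler_wpM2r (sqr_ge0 e) c400; rewrite NE.
  rewrite expr_div_n -exprM; move: ((1 - g) ^+ (2 * 2)) (e ^+ 2) e2c => a b; lra.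
- by rewrite e2 mulrC divfK// lt0r_neq0.
have q1 : N * ((H + mu * D0) / mu * ln T%:R) * e ^+ 2 <= (1 - g) ^+ 4.
  by apply: le_trans e2c; rewrite ler_wpM2r ?sqr_ge0.
have q2 : N * (((1 - g) * u) / mu * ln T%:R) * e ^+ 2 <= (1 - g) ^+ 4.
  apply: le_trans q1; rewrite ler_wpM2r ?sqr_ge0// ler_wpM2l ?(ltW N0)//.
  by rewrite ler_wpM2r// ler_wpM2r ?invr_ge0 ?(ltW mu0).
have q3 : N * (u / mu * ln T%:R) * e ^+ 2 <= (1 - g) ^+ 3.
  rewrite -(ler_pM2l g1); apply: le_trans (_ : (1 - g) ^+ 4 <= _); last by rewrite -exprS.
  by apply: le_trans q2; rewrite le_eqVlt; apply/orP; left; apply/eqP; ring.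
have q4 : (1 - g) ^+ 3 <= 1 - g.
  by rewrite exprS ler_piMr ?(ltW g1)// exprn_ile1 ?(ltW g1)//; lra.
have q5 := ler_wpM2r (ltW u0) (le_trans q3 q4).
rewrite NE in q5.
have -> : (e * (117%:R / 100%:R * u)) ^+ 2 * ln T%:R / (2 * mu) =
    (117%:R / 100%:R) ^+ 2 / 800%:R * (400 * (u / mu * ln T%:R) * e ^+ 2 * u).
  by field; rewrite lt0r_neq0.
have : 0 <= (1 - g) * u by rewrite mulr_ge0// ltW.
move: (400 * (u / mu * ln T%:R) * e ^+ 2 * u) q5 => y; lra.
Qed.

End SampleSizes.

(** * Halving of the error over the epochs *)

Section Contraction.
Context {R : realType} {S A : finType}.
Variables (M : mdp R S A) (h : (A -> R) -> R) (hbar : R).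
Hypothesis h_itv : forall x, simplex x -> 0 <= h x <= hbar.
Hypothesis h_cont : continuous_on_simplex h.
Variables (omega : (A -> R) -> R) (gomega : (A -> R) -> (A -> R)) (mu : R).
Hypothesis mu0 : 0 < mu.
Hypothesis grad : is_gradient_on_simplex omega gomega.
Hypothesis osc : l1_strongly_convex omega gomega.
Hypothesis hsc : convex_relative mu omega h.
Hypothesis S0 : (0 < #|S|)%N.
Hypothesis A0 : (0 < #|A|)%N.
Variables (K T : nat) (m1 m2 : nat -> nat) (eta : nat -> nat -> R).
Local Notation g := (discount M).
Local Notation P := (trans M).
Variables (Vf : (S -> A -> R) -> S -> R) (pis : S -> A -> R).
Hypothesis VfE : forall pi, is_policy pi -> forall s,
  Vf pi s = qobj M h (kernel_mul P (Vf pi)) s (pi s).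
Hypothesis opt : optimal_policy Vf pis.
Variables (D0 : R) (u : nat -> R) (L1 L2 : R).
Hypothesis D0_ge : 2^-1 <= D0.
Hypothesis hD0 : forall pi : S -> A -> R, is_policy pi ->
  linfty (bregman_policy omega gomega uniform_policy pi) <= D0.
Hypothesis hu : forall k, u k = 2 ^- k * Num.max ((1 + hbar) / (1 - g)) (mu * D0).
Hypothesis T18 : 18 <= (1 - g) * T%:R.
Hypothesis heta : forall k t, (k < K)%N -> (t < T)%N -> eta k t = 2 / (mu * t.+1%:R).
Hypothesis L1_gt0 : 0 < L1.
Hypothesis L2_gt0 : 0 < L2.
Hypothesis hm1 : forall k, (k < K)%N ->
  200 * Num.max (64 * (1 + hbar) ^+ 2 / mu * (1 - g) ^- 5 * (u k)^-1 * (ln T%:R + 1)) 1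
    * L1 <= (m1 k)%:R.
Hypothesis hm2 : forall k, (k < K)%N ->
  (400 * (1 + hbar + mu * D0) / mu * (ln T%:R + 1) + 16) * (1 - g) ^- 4 * L2
    <= (m2 k)%:R.

Let g0 : 0 <= g. Proof. by have /andP[/ltW] := discount_itv M. Qed.
Let g1' : 0 < 1 - g. Proof. by rewrite subr_gt0; have /andP[] := discount_itv M. Qed.
Let spis : is_policy pis. Proof. by have [] := opt. Qed.

Let H0 : 0 < 1 + hbar.
Proof.
by have /card_gt0P[s _] := S0; have := hbar_ge0 h_itv s spis; lra.
Qed.

Let B0 : 0 < (1 + hbar) / (1 - g). Proof. by rewrite divr_gt0. Qed.

Let u_gt0 k : 0 < u k.
Proof. by rewrite hu mulr_gt0 ?invr_gt0 ?exprn_gt0// lt_max B0. Qed.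

Lemma T_ge18 : (18 <= T)%N.
Proof.
rewrite -(@ler_nat R); apply: le_trans T18 _; rewrite ler_piMl//.
by rewrite lerBlDr lerDl.
Qed.

Let T0 : (0 < T)%N. Proof. exact: leq_trans T_ge18. Qed.

Let lT : 1 <= ln T%:R :> R. Proof. exact: ln_ge1 T_ge18. Qed.

Let u_le k : (1 - g) * u k <= 1 + hbar + mu * D0.
Proof.
have m0 : 0 <= mu * D0 by rewrite mulr_ge0 ?(ltW mu0)//; have := D0_ge; lra.
apply: (@le_trans _ _ ((1 - g) * Num.max ((1 + hbar) / (1 - g)) (mu * D0))).
  rewrite ler_wpM2l ?(ltW g1')// hu ler_piMl ?le_max ?(ltW B0)//.
  by rewrite invf_le1 ?exprn_gt0// exprn_ege1// ler1n.
have [_|_] := leP ((1 + hbar) / (1 - g)) (mu * D0); last first.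
  by rewrite mulrC divfK ?lt0r_neq0//; lra.
apply: (@le_trans _ _ (mu * D0)); last by rewrite lerDr ltW.
by rewrite ler_piMl// lerBlDr lerDl.
Qed.

Definition radius1 k := Num.sqrt (L1 / (m1 k)%:R).
Definition radius2 k := Num.sqrt (L2 / (m2 k)%:R).

Lemma radius1_spec k : (k < K)%N ->
  [/\ (0 < m1 k)%N, 0 <= radius1 k <= 1 / 6%:R, (m1 k)%:R * radius1 k ^+ 2 = L1 &
    (2 * ((1 + hbar) / (1 - g)) * radius1 k) ^+ 2 <=
    mu * (1 - g) ^+ 3 * (u k / 500%:R)].
Proof.
by move=> kK; apply: m1_bound (hm1 kK) => //; exact: le_trans lT.
Qed.

Lemma radius2_spec k : (k < K)%N ->
  [/\ (0 < m2 k)%N, 0 <= radius2 k, radius2 k <= (1 - g) ^+ 2 / 20%:R,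
    (m2 k)%:R * radius2 k ^+ 2 = L2 &
    (radius2 k * (117%:R / 100%:R * u k)) ^+ 2 * ln T%:R / (2 * mu)
      <= (1 - g) * (u k / 100%:R)].
Proof. by move=> kK; exact: (m2_bound g1' g0 H0 mu0 (u_gt0 k) D0_ge) (hm2 kK). Qed.

(** Every epoch halves both bounds. They hold at the start because [u 0] dominates the largest
    possible value as well as [mu * D0]. *)
Lemma svmd_contract (xi : nat -> nat -> S -> A -> nat -> S) :
  let pihat := svmd M h hbar omega gomega T m1 m2 eta xi in
  (forall k s a, (k < K)%N ->
    let K0 := svmd_kernel0 m1 xi k in
    let dev f := `|kernel_mul K0 f s a - kernel_mul P f s a| in
    dev (loo_const M h hbar K0 (pihat k) s) <= radius1 k /\
    dev (loo_coef M K0 (pihat k) s) <= radius1 k) ->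
  (forall k t s a, (k < K)%N -> (0 < t)%N -> (t < T)%N ->
    let f := unit_drift M h hbar omega gomega T m1 m2 eta xi k t in
    `|kernel_mul (empirical_kernel (m2 k) (xi k t)) f s a - kernel_mul P f s a|
      <= radius2 k) ->
  forall k, (k <= K)%N -> forall s, Vf (pihat k) s - Vf pis s <= u k /\
    mu * bregman omega gomega (pihat k s) (pis s) <= u k.
Proof.
move=> pihat dev1 dev2; elim=> [|k IH] kK s.
  have u0E : u 0%N = Num.max ((1 + hbar) / (1 - g)) (mu * D0).
    by rewrite hu expr0 invr1 mul1r.
  split; rewrite u0E le_max; apply/orP; [left|right].
    have /andP[_ V1] := value_itv h_itv VfE s (uniform_policy_simplex A0).
    by have /andP[V0 _] := value_itv h_itv VfE s spis; rewrite /pihat /=; lra.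
  rewrite ler_wpM2l ?(ltW mu0)//; apply: le_trans (hD0 spis).
  exact: le_trans (ler_norm _) (linfty_ge _ s).
have uS : u k.+1 = u k / 2 by rewrite !hu exprS invfM; ring.
rewrite uS; have [m10 /andP[r0 _] _ r1] := radius1_spec kK.
have [m20 e20 e2g _ e2q] := radius2_spec kK.
apply: (svmd_epoch h_itv h_cont mu0 grad osc hsc A0 VfE opt (d0 := 2 *
  ((1 + hbar) / (1 - g)) * radius1 k) (e2 := radius2 k)) => //.
- by move=> t tT; exact: heta.
- by move=> s'; have [] := IH (ltnW kK) s'.
- by move=> s'; have [] := IH (ltnW kK) s'.
- by move=> ->; rewrite hu expr0 invr1 mul1r le_max lexx.
(* The first epoch starts from a constant and has no noise; later ones start from a policy
   evaluation under the very same samples. *)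
- move=> s' a; have [k0|k0] := eqVneq k 0%N.
    rewrite noise0_first_epoch// normr0; apply: mulr_ge0 => //.
    by apply: mulr_ge0 => //; exact: ltW.
  have [c1 c2] := dev1 k s' a kK.
  rewrite /noise0 /start_value (negbTE k0); apply: evaluation_noise_le c1 c2 => //.
    by move=> s1 a1; exact: empirical_kernel_simplex.
  exact: svmd_policy.
- by move=> t s' a t0 tT; exact: dev2.
Qed.

End Contraction.

(** * The failure probability *)

Section SampleIndependence.
Context {R : realType} {S A : finType}.
Variables (M : mdp R S A) (h : (A -> R) -> R) (hbar : R).
Variables (omega : (A -> R) -> R) (gomega : (A -> R) -> (A -> R)).
Variables (K T : nat) (m1 m2 : nat -> nat) (eta : nat -> nat -> R).
Local Notation g := (discount M).
Local Notation P := (trans M).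
Local Notation drawnS := (@drawn S A K T m1 m2).
Local Notation size_of := (sample_size m1 m2).
Variables (J : finType) (v : J -> nat * nat * S * A * nat).
Variable w : nat * nat * S * A * nat -> J.
Hypothesis wK : forall i, drawnS i -> v (w i) = i.
Local Notation sf := (sample_fun w).
Local Notation svmdx x := (svmd M h hbar omega gomega T m1 m2 eta (sf x)).

Variables (x : {ffun J -> S}) (k t : nat) (s : S) (a : A) (i : nat) (y : S).
Hypothesis kK : (k < K)%N.
Hypothesis tT : (t < T)%N.
Hypothesis im : (i < size_of k t)%N.
Local Notation x' := (upd x (w (k, t, s, a, i)) y).

Let T0 : (0 < T)%N. Proof. exact: leq_ltn_trans tT. Qed.

(** Indices are compared without the action, since leaving out a state discards its rows for all
    actions at once. *)
Let sf_upd k' t' s' a' i' : drawnS (k', t', s', a', i') ->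
  (k', t', s') <> (k, t, s) -> sf x' k' t' s' a' i' = sf x k' t' s' a' i'.
Proof.
move=> dr ne; rewrite /sample_fun ffunE; case: eqP => // e.
have := wK dr; rewrite e wK//; case=> *; exfalso; apply: ne; congruence.
Qed.

Lemma svmd_upd : svmdx x' k = svmdx x k.
Proof.
apply: eq_svmd => // k' t' s' a' i' kk t'T i'm; apply: sf_upd.
  by split=> //; exact: ltn_trans kK.
by case=> e; rewrite e ltnn in kk.
Qed.

Lemma loo_kernel_upd (pi : S -> A -> R) : t = 0%N ->
  loo_kernel (svmd_kernel0 m1 (sf x') k) pi s = loo_kernel (svmd_kernel0 m1 (sf x) k) pi s.
Proof.
move=> t0; apply: eq_loo_kernel => s' ss; apply/funext => a'.
apply: eq_empirical_kernel => i' i'm; apply: sf_upd; first by split.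
by case=> _ e; rewrite e eqxx in ss.
Qed.

Lemma loo_const_upd : t = 0%N ->
  loo_const M h hbar (svmd_kernel0 m1 (sf x') k) (svmdx x' k) s =
  loo_const M h hbar (svmd_kernel0 m1 (sf x) k) (svmdx x k) s.
Proof.
by move=> t0; apply/funext => s'; rewrite svmd_upd /loo_const loo_kernel_upd.
Qed.

Lemma loo_coef_upd : t = 0%N ->
  loo_coef M (svmd_kernel0 m1 (sf x') k) (svmdx x' k) s =
  loo_coef M (svmd_kernel0 m1 (sf x) k) (svmdx x k) s.
Proof.
by move=> t0; apply/funext => s'; rewrite svmd_upd /loo_coef loo_kernel_upd.
Qed.

(** The drift at [t] is built from earlier epochs and from iterations below [t]; for [t > 0] the
    latter include the one behind [V_0]. *)
Lemma unit_drift_upd : (0 < t)%N ->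
  unit_drift M h hbar omega gomega T m1 m2 eta (sf x') k t =
  unit_drift M h hbar omega gomega T m1 m2 eta (sf x) k t.
Proof.
move=> t0.
have KE : svmd_kernel0 m1 (sf x') k = svmd_kernel0 m1 (sf x) k :> (S -> A -> S -> R).
  apply/funext => s'; apply/funext => a'; apply: eq_empirical_kernel => i' i'm.
  by apply: sf_upd => //; case=> e; rewrite -e in t0.
have VE : start_value M h hbar omega gomega T m1 m2 eta (sf x') k =
    start_value M h hbar omega gomega T m1 m2 eta (sf x) k.
  by rewrite /start_value KE svmd_upd.
have DE : drift M h hbar omega gomega T m1 m2 eta (sf x') k t =
    drift M h hbar omega gomega T m1 m2 eta (sf x) k t.
  apply/funext => s'; rewrite /drift VE svmd_upd.
  rewrite (@eq_svmd_inner _ _ _ M h omega gomega m1 m2 eta (sf x') (sf x))//.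
  move=> t' s1 a1 i1 tt i1m; apply: sf_upd.
    by split=> //; exact: ltn_trans tT.
  by case=> e; rewrite e ltnn in tt.
by apply/funext => s'; rewrite /unit_drift DE.
Qed.

End SampleIndependence.

(** * Union bound over all deviations *)

Section UnionBound.
Context {R : realType} {S A : finType}.
Variables (M : mdp R S A) (h : (A -> R) -> R) (hbar : R).
Hypothesis h_itv : forall x, simplex x -> 0 <= h x <= hbar.
Hypothesis h_cont : continuous_on_simplex h.
Variables (omega : (A -> R) -> R) (gomega : (A -> R) -> (A -> R)).
Hypothesis grad : is_gradient_on_simplex omega gomega.
Hypothesis S0 : (0 < #|S|)%N.
Hypothesis A0 : (0 < #|A|)%N.
Variables (K T : nat) (m1 m2 : nat -> nat) (eta : nat -> nat -> R).
Local Notation g := (discount M).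
Local Notation P := (trans M).
Local Notation drawnS := (@drawn S A K T m1 m2).
Variables (J : finType) (v : J -> nat * nat * S * A * nat).
Variable w : nat * nat * S * A * nat -> J.
Hypothesis wK : forall i, drawnS i -> v (w i) = i.
Local Notation sf := (sample_fun w).
Local Notation svmdx x := (svmd M h hbar omega gomega T m1 m2 eta (sf x)).
Variables (r1 r2 : nat -> R) (delta : R).
Hypothesis K0 : (0 < K)%N.
Hypothesis T1 : (1 < T)%N.
Hypothesis delta0 : 0 < delta.
Hypothesis r1P : forall k, (k < K)%N ->
  [/\ (0 < m1 k)%N, 0 <= r1 k <= 1 / 6%:R & (m1 k)%:R * r1 k ^+ 2 =
      ln (24%:R * K%:R * #|S|%:R * #|A|%:R * delta^-1)].
Hypothesis r2P : forall k, (k < K)%N ->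
  [/\ (0 < m2 k)%N, 0 <= r2 k <= 1 / 6%:R & (m2 k)%:R * r2 k ^+ 2 =
      ln (4%:R * K%:R * T.-1%:R * #|S|%:R * #|A|%:R * delta^-1)].

Let dev (k t : nat) (f : {ffun J -> S} -> S -> R) s a x : R :=
  `|kernel_mul (empirical_kernel (sample_size m1 m2 k t) (sf x k t)) (f x) s a -
    kernel_mul P (f x) s a|.

Let fconst k s x := loo_const M h hbar (svmd_kernel0 m1 (sf x) k) (svmdx x k) s.
Let fcoef k s x := loo_coef M (svmd_kernel0 m1 (sf x) k) (svmdx x k) s.
Let fdrift k t x := unit_drift M h hbar omega gomega T m1 m2 eta (sf x) k t.

(** Failures are counted rather than united, so that the union bound is linearity of [mean]. *)
Let bad1 (k : 'I_K) s a x : nat :=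
  ((r1 k < dev k 0 (fconst k s) s a x)%R + (r1 k < dev k 0 (fcoef k s) s a x)%R)%N.
Let bad2 (k : 'I_K) (t : 'I_T.-1) s a x : nat :=
  (r2 k < dev k t.+1 (fdrift k t.+1) s a x)%R.

Let bad x : nat := (\sum_k \sum_s \sum_a bad1 k s a x +
  \sum_k \sum_t \sum_s \sum_a bad2 k t s a x)%N.

Let mu := sample_law M v.

Let svmdx_policy x k : is_policy (svmdx x k). Proof. exact: svmd_policy. Qed.

Let mean_bad1 (k : 'I_K) s a : mean mu (fun x => (bad1 k s a x)%:R) <=
  4%:R * (24%:R * K%:R * #|S|%:R * #|A|%:R * delta^-1)^-1.
Proof.
have [m0 r16 rL] := r1P (ltn_ord k).
have T0 : (0 < T)%N by exact: ltnW.
have sK x s' a' : simplex (svmd_kernel0 m1 (sf x) k s' a' : S -> R).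
  exact: empirical_kernel_simplex.
have tail (f : {ffun J -> S} -> S -> R) : (forall x s', 0 <= f x s' <= 1) ->
    (forall x i y, (i < sample_size m1 m2 k 0)%N ->
       f (upd x (w (k : nat, 0%N, s, a, i)) y) = f x) ->
    mean mu (fun x => (r1 k < dev k 0 f s a x)%R%:R) <=
    2 * expR (- ((m1 k)%:R * r1 k ^+ 2)).
  move=> f01 findep.
  exact: (@empirical_kernel_tail R S A M K T m1 m2 J v w wK k 0%N s a f (r1 k)
    (ltn_ord k) T0 m0 f01 findep r16).
rewrite rL in tail; set c := 2 * expR _ in tail.
have t1 : mean mu (fun x => (r1 k < dev k 0 (fconst k s) s a x)%R%:R) <= c.
  apply: tail => [x s'|x i y im]; first exact: loo_const_itv.
  exact: (@loo_const_upd R S A M h hbar omega gomega K T m1 m2 eta J v w wK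
    x k 0%N s a i y).
have t2 : mean mu (fun x => (r1 k < dev k 0 (fcoef k s) s a x)%R%:R) <= c.
  apply: tail => [x s'|x i y im]; first exact: loo_coef_itv.
  exact: (@loo_coef_upd R S A M h hbar omega gomega K T m1 m2 eta J v w wK
    x k 0%N s a i y).
have -> : (fun x => (bad1 k s a x)%:R) =
    (fun x => (r1 k < dev k 0 (fconst k s) s a x)%R%:R +
              (r1 k < dev k 0 (fcoef k s) s a x)%R%:R : R).
  by apply/funext => x; rewrite /bad1 natrD.
rewrite meanD; apply: le_trans (lerD t1 t2) _.
rewrite /c expRN lnK; last first.
  by rewrite posrE !mulr_gt0 ?ltr0n ?invr_gt0.
by move: (_^-1) => q; lra.
Qed.

Let mean_bad2 (k : 'I_K) (t : 'I_T.-1) s a : mean mu (fun x => (bad2 k t s a x)%:R) <=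
  2 * (4%:R * K%:R * T.-1%:R * #|S|%:R * #|A|%:R * delta^-1)^-1.
Proof.
have [m0 r26 rL] := r2P (ltn_ord k).
have tT : (t.+1 < T)%N by rewrite -ltn_predRL.
have f01 x s' : 0 <= fdrift k t.+1 x s' <= 1 by exact: unit_drift_itv.
have := @empirical_kernel_tail R S A M K T m1 m2 J v w wK k t.+1 s a _ (r2 k)
  (ltn_ord k) tT m0 f01 (fun x i y im =>
    unit_drift_upd M h hbar omega gomega eta wK x s a y (ltn_ord k) tT im (ltn0Sn _)) r26.
rewrite [sample_size _ _ _ _]/= rL expRN lnK//.
by rewrite posrE !mulr_gt0 ?ltr0n ?invr_gt0// ltn_predRL.
Qed.

(** For the first batches two functions with two tails each cost 4/24 of [delta]; for the fresh ones
    two tails cost 2/4. The total is 2/3. *)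
Let mean_bad : mean mu (fun x => (bad x)%:R) <= delta.
Proof.
have -> : (fun x => (bad x)%:R) = (fun x => \sum_k \sum_s \sum_a (bad1 k s a x)%:R +
    \sum_k \sum_t \sum_s \sum_a (bad2 k t s a x)%:R : R).
  apply/funext => x; rewrite /bad natrD !natr_sum; congr (_ + _); apply: eq_bigr => k _.
    by rewrite natr_sum; apply: eq_bigr => s _; rewrite natr_sum.
  rewrite natr_sum; apply: eq_bigr => t _; rewrite natr_sum.
  by apply: eq_bigr => s _; rewrite natr_sum.
have n0 (n : nat) : (0 < n)%N -> (n%:R : R) != 0 by move=> n0; rewrite pnatr_eq0 -lt0n.
have T10 : (0 < T.-1)%N by rewrite ltn_predRL.
rewrite meanD.
have -> : mean mu (fun x => \sum_k \sum_s \sum_a (bad1 k s a x)%:R) =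
    \sum_k \sum_s \sum_a mean mu (fun x => (bad1 k s a x)%:R).
  rewrite mean_sum; apply: eq_bigr => k _; rewrite mean_sum; apply: eq_bigr => s _.
  by rewrite mean_sum.
have -> : mean mu (fun x => \sum_k \sum_t \sum_s \sum_a (bad2 k t s a x)%:R) =
    \sum_k \sum_t \sum_s \sum_a mean mu (fun x => (bad2 k t s a x)%:R).
  rewrite mean_sum; apply: eq_bigr => k _; rewrite mean_sum; apply: eq_bigr => t _.
  by rewrite mean_sum; apply: eq_bigr => s _; rewrite mean_sum.
have b1 : \sum_k \sum_s \sum_a mean mu (fun x => (bad1 k s a x)%:R) <= delta / 6%:R.
  apply: (@le_trans _ _ (\sum_(k < K) \sum_(s : S) \sum_(a : A)
    4%:R * (24%:R * K%:R * #|S|%:R * #|A|%:R * delta^-1)^-1)).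
    by apply: ler_sum => k _; apply: ler_sum => s _; apply: ler_sum => a _.
  rewrite !sumr_const !card_ord -!mulrnA -[_ *+ _]mulr_natl !natrM.
  rewrite le_eqVlt; apply/orP; left; apply/eqP; field.
  by rewrite !n0// lt0r_neq0.
have b2 : \sum_k \sum_t \sum_s \sum_a mean mu (fun x => (bad2 k t s a x)%:R)
    <= delta / 2.
  apply: (@le_trans _ _ (\sum_(k < K) \sum_(t < T.-1) \sum_(s : S) \sum_(a : A)
    2 * (4%:R * K%:R * T.-1%:R * #|S|%:R * #|A|%:R * delta^-1)^-1)).
    apply: ler_sum => k _; apply: ler_sum => t _; apply: ler_sum => s _.
    by apply: ler_sum => a _.
  rewrite !sumr_const !card_ord -!mulrnA -[_ *+ _]mulr_natl !natrM.
  rewrite le_eqVlt; apply/orP; left; apply/eqP; field.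
  by rewrite !n0// lt0r_neq0.
by have := delta0; lra.
Qed.

Lemma union_bound (good : set {ffun J -> S}) :
  (forall x,
    (forall k s a, (k < K)%N ->
      let K0 := svmd_kernel0 m1 (sf x) k in
      let dev f := `|kernel_mul K0 f s a - kernel_mul P f s a| in
      dev (loo_const M h hbar K0 (svmdx x k) s) <= r1 k /\
      dev (loo_coef M K0 (svmdx x k) s) <= r1 k) ->
    (forall k t s a, (k < K)%N -> (0 < t)%N -> (t < T)%N ->
      let f := unit_drift M h hbar omega gomega T m1 m2 eta (sf x) k t in
      `|kernel_mul (empirical_kernel (m2 k) (sf x k t)) f s a - kernel_mul P f s a|
        <= r2 k) ->
    good x) ->
  1 - delta <= mean mu (fun x => `[< good x >]%:R).
Proof.
move=> goodP; rewrite lerBlDr; apply: le_trans (lerD (lexx _) mean_bad).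
have smu j : simplex (mu j) by exact: sample_law_simplex.
rewrite -meanD -[leLHS](mean_cst smu); apply: (ler_mean smu) => x.
have [b0|b0] := posnP (bad x); last first.
  by apply: ler_wpDl; rewrite ?ler0n// ler1n.
rewrite b0 addr0 asboolT//; apply: goodP.
  move=> k s a kK; move/eqP: b0; rewrite addn_eq0 => /andP[+ _].
  rewrite sum_nat_eq0 => /forallP/(_ (Ordinal kK)) /=.
  rewrite sum_nat_eq0 => /forallP/(_ s) /=.
  rewrite sum_nat_eq0 => /forallP/(_ a) /=.
  by rewrite addn_eq0 !eqb0 -!leNgt => /andP[].
move=> k [//|t] s a kK _ tT; move/eqP: b0; rewrite addn_eq0 => /andP[_].
have tT' : (t < T.-1)%N by rewrite ltn_predRL.
rewrite sum_nat_eq0 => /forallP/(_ (Ordinal kK)) /=.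
rewrite sum_nat_eq0 => /forallP/(_ (Ordinal tT')) /=.
rewrite sum_nat_eq0 => /forallP/(_ s) /=.
rewrite sum_nat_eq0 => /forallP/(_ a) /=.
by rewrite eqb0 -leNgt.
Qed.

End UnionBound.

(** * The single-action case and a lower bound on [D0] *)

Section SmallFacts.
Context {R : realType} {S A : finType}.

Lemma simplex_unique (p q : A -> R) : (#|A| <= 1)%N -> simplex p -> simplex q -> p = q.
Proof.
move=> A1 [_ p1] [_ q1]; apply/funext => a.
have big1a (f : A -> R) : \sum_b f b = f a.
  rewrite (bigD1 a)//= big1 ?addr0// => b ba.
  by have /card_le1_eqP/(_ b a isT isT) eba := A1; rewrite eba eqxx in ba.
by rewrite -(big1a p) -(big1a q) p1 q1.
Qed.

(** A vertex of the simplex has l1 distance at least 1 from the uniform distribution: one coordinate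
    differs by at least 1/2, and the others have to compensate. *)
Lemma bregman_radius_ge omega (gomega : (A -> R) -> A -> R) (D0 : R) (s : S) :
  l1_strongly_convex omega gomega -> (1 < #|A|)%N ->
  (forall pi : S -> A -> R, is_policy pi ->
     linfty (bregman_policy omega gomega uniform_policy pi) <= D0) ->
  2^-1 <= D0.
Proof.
move=> osc A1 hD0; have A0 : (0 < #|A|)%N by exact: ltnW.
have /card_gt0P[a _] := A0.
pose p b : R := (b == a)%:R.
have sp : simplex p.
  split=> [b|]; first exact: ler0n.
  by rewrite (bigD1 a)//= /p eqxx big1 ?addr0// => b /negbTE ->.
have su := uniform_policy_simplex (R := R) (S := S) A0.
apply: le_trans (hD0 (fun=> p) (fun=> sp)); apply: le_trans (linfty_ge _ s).
apply: le_trans (ler_norm _); rewrite /bregman_policy.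
apply: le_trans (bregman_ge osc (su s) sp).
rewrite -[leLHS]mulr1 ler_wpM2l ?invr_ge0// -[leLHS](expr1n _ 2).
rewrite ler_pXn2r ?nnegrE ?l1norm_ge0//.
set d := p \- uniform_policy s.
have d0 : \sum_b d b = 0 by rewrite sumrB sp.2 (su s).2 subrr.
have da : 2^-1 <= d a.
  rewrite /d /p /uniform_policy /= eqxx.
  have : #|A|%:R^-1 <= 2^-1 :> R by rewrite lef_pV2 ?posrE ?ltr0n// ler_nat.
  move=> q2; rewrite lerBrDr; apply: le_trans (lerD (lexx _) q2) _.
  by rewrite [leRHS]mulr1n; lra.
move: d0; rewrite (bigD1 a)//= => /eqP; rewrite addrC addr_eq0 => /eqP dE.
rewrite /l1norm (bigD1 a)//=.
have : `|\sum_(b | b != a) d b| <= \sum_(b | b != a) `|d b| by exact: ler_norm_sum.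
rewrite dE normrN; have := ler_norm (d a); lra.
Qed.

End SmallFacts.

Lemma finite_setEcodom (I : choiceType) (D : set I) : finite_set D ->
  exists (J : finType) (v : J -> I), injective v /\ D = range v.
Proof.
move=> /finite_seqP[s ->]; exists (seq_sub s), val; split; first exact: val_inj.
apply/seteqP; split=> [i /= si|_ [j _ <-]]; last exact: valP.
by exists (SeqSub si).
Qed.

Lemma ln_natV_gt0 (R : realType) (n : nat) (delta : R) : (0 < n)%N ->
  0 < delta < 1 -> 0 < ln (n%:R * delta^-1).
Proof.
move=> n0 /andP[d0 d1]; rewrite ln_gt0//.
apply: (@lt_le_trans _ _ (1 * delta^-1)); first by rewrite mul1r invf_gt1.
by rewrite ler_wpM2r ?invr_ge0 ?(ltW d0)// ler1n.
Qed.

Lemma halving_le (R : realType) (K : nat) (u0 eps : R) : 0 < u0 -> 0 < eps ->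
  K%:Z = Num.ceil (ln (u0 / eps) / ln 2) -> 2 ^- K * u0 <= eps.
Proof.
move=> u00 eps0 hK; have l2 : 0 < ln 2 :> R by rewrite ln_gt0// ltr1n.
have := ceil_ge (ln (u0 / eps) / ln 2); rewrite -hK -pmulrn ler_pdivrMr//.
rewrite mulr_natl -lnXn// ler_ln ?posrE ?divr_gt0 ?exprn_gt0//.
by rewrite ler_pdivrMr// ler_pdivrMl ?exprn_gt0.
Qed.

(** * Transfer from the finite product space to the probability space *)

Unset Implicit Arguments.

Theorem theorem3 (R : realType) (S A : finType) (M : mdp R S A)
  (hS : (0 < #|S|)%N) (hA : (0 < #|A|)%N)
  (* regularizer and distance generating function *)
  (h : (A -> R) -> R) (hbar : R)
  (h_itv : forall x, simplex x -> 0 <= h x <= hbar)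
  (h_cont : continuous_on_simplex h) (h_convex : convex_on_simplex h)
  (omega : (A -> R) -> R) (gomega : (A -> R) -> (A -> R))
  (omega_C1 : continuously_differentiable_on_simplex omega gomega)
  (omega_sc : l1_strongly_convex omega gomega)
  (mu : R) (mu_gt0 : 0 < mu) (h' : (A -> R) -> (A -> R))
  (h_sc : strongly_convex_wrt_bregman S h h' mu omega gomega)
  (* state-action trajectories, for every policy and initial state *)
  (dT : measure_display) (OmT : measurableType dT)
  (PrT : (S -> A -> R) -> S -> probability OmT R)
  (st : nat -> OmT -> S) (ac : nat -> OmT -> A)
  (traj : forall pi : S -> A -> R, is_policy pi -> forall s,
     trajectory_law M (PrT pi s) st ac pi s)
  (pistar : S -> A -> R)
  (pistar_opt : optimal_policy (value M h PrT st ac) pistar)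
  (* parameters of the algorithm *)
  (delta eps D0 : R) (delta_itv : 0 < delta < 1) (eps_gt0 : 0 < eps)
  (hD0 : forall pi : S -> A -> R, is_policy pi ->
     linfty (bregman_policy omega gomega uniform_policy pi) <= D0)
  (u : nat -> R)
  (hu : forall k, u k =
     2 ^- k * Num.max ((1 + hbar) / (1 - discount M)) (mu * D0))
  (K T : nat) (K_gt0 : (0 < K)%N)
  (hK : K%:Z = Num.ceil (ln (u 0%N / eps) / ln 2))
  (hT : T%:Z = Num.ceil (18 / (1 - discount M)))
  (eta : nat -> nat -> R)
  (heta : forall k t, (k < K)%N -> (t < T)%N -> eta k t = 2 / (mu * t.+1%:R))
  (m1 m2 : nat -> nat)
  (hm1 : forall k, (k < K)%N ->
     200 * Num.max (64 * (1 + hbar) ^+ 2 / mu * (1 - discount M) ^- 5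
                    * (u k)^-1 * (ln T%:R + 1)) 1
       * ln (24 * K%:R * #|S|%:R * #|A|%:R * delta^-1) <= (m1 k)%:R)
  (hm2 : forall k, (k < K)%N ->
     (400 * (1 + hbar + mu * D0) / mu * (ln T%:R + 1) + 16)
       * (1 - discount M) ^- 4
       * ln (4 * K%:R * T.-1%:R * #|S|%:R * #|A|%:R * delta^-1) <= (m2 k)%:R)
  (* samples *)
  (d : measure_display) (Om : measurableType d) (Pr : probability Om R)
  (xi : nat -> nat -> S -> A -> nat -> Om -> S)
  (hxi : fresh_samples M Pr K T m1 m2 xi) :
  let V := value M h PrT st ac in
  let pihat (w : Om) := svmd M h hbar omega gomega T m1 m2 eta
                          (fun k t s a i => xi k t s a i w) K in
  let good := [set w : Om |
    linfty (V (pihat w) \- V pistar) <= eps /\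
    linfty (bregman_policy omega gomega (pihat w) pistar)
      <= eps / (mu * (1 - discount M))] in
  measurable good /\ ((1 - delta)%:E <= Pr good)%E.
Proof.
have /andP[g0 g1] := discount_itv M; have g1' : 0 < 1 - discount M by rewrite subr_gt0.
have /card_gt0P[s0 _] := hS; have [spis _] := pistar_opt.
have uK : u K <= eps.
  have -> : u K = 2 ^- K * u 0%N by rewrite !hu expr0 invr1 mul1r.
  apply: halving_le => //; rewrite hu mulr_gt0 ?invr_gt0 ?exprn_gt0// lt_max divr_gt0//.
  by have := hbar_ge0 h_itv s0 spis; lra.
have T18 : 18 <= (1 - discount M) * T%:R.
  by have := ceil_ge (18 / (1 - discount M)); rewrite -hT -pmulrn ler_pdivrMr// mulrC.
(* [done] tries [discriminate], which would evaluate these two equations. *)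
clear hK hT.
move=> V pihat good; have [grad _] := omega_C1.
have hsc := strongly_convex_relative s0 h_sc.
have /andP[delta0 delta1] := delta_itv.
have VfE pi : is_policy pi -> forall s,
    V pi s = qobj M h (kernel_mul (trans M) (V pi)) s (pi s).
  by move=> spi; apply: (value_bellman h_itv spi); exact: traj.
have [_ Vopt] := pistar_opt.
have pihat_policy w : is_policy (pihat w) by exact: svmd_policy.
have radius0 : 0 <= eps / (mu * (1 - discount M)).
  by rewrite divr_ge0 ?(ltW eps_gt0)// mulr_ge0// ltW.
(* With one action all policies coincide. The case is separate because [D0] may then be 0, below the
   1/2 needed for the fresh samples. *)
have [A1|A1] := leqP #|A| 1.
  suff -> : good = setT.
    by split=> //; rewrite probability_setT lee_fin lerBlDr lerDl ltW.
  apply/seteqP; split=> // w _.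
  have e : pihat w = pistar.
    by apply/funext => s; apply: simplex_unique => //; exact: pihat_policy.
  rewrite /good /mkset e; split.
    by apply: linfty_le => [|s]; rewrite ?(ltW eps_gt0)// /= subrr normr0 ltW.
  apply: linfty_le => // s; rewrite /bregman_policy /bregman subrr sub0r normrN.
  rewrite (_ : dotp _ _ = 0) ?normr0//.
  by rewrite /dotp big1// => a _; rewrite /= subrr mulr0.
have Tn := T_ge18 T18.
have T1 : (1 < T)%N by exact: leq_trans Tn.
have T0 : (0 < T)%N by exact: ltnW.
have D0_ge := bregman_radius_ge s0 omega_sc A1 hD0.
have [L1 L1E] : exists L, L = ln (24 * K%:R * #|S|%:R * #|A|%:R * delta^-1).
  by exists (ln (24 * K%:R * #|S|%:R * #|A|%:R * delta^-1)).
have [L2 L2E] : exists L,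
    L = ln (4 * K%:R * T.-1%:R * #|S|%:R * #|A|%:R * delta^-1).
  by exists (ln (4 * K%:R * T.-1%:R * #|S|%:R * #|A|%:R * delta^-1)).
rewrite -L1E in hm1; rewrite -L2E in hm2.
have L1_gt0 : 0 < L1.
  by rewrite L1E -!natrM ln_natV_gt0// !muln_gt0 K_gt0 hS hA.
have L2_gt0 : 0 < L2.
  by rewrite L2E -!natrM ln_natV_gt0// !muln_gt0 K_gt0 hS hA ltn_predRL T1.
have r1P := radius1_spec h_itv mu_gt0 hS pistar_opt hu T18 L1_gt0 hm1.
have r2P := radius2_spec h_itv mu_gt0 hS pistar_opt D0_ge hu T18 L2_gt0 hm2.
have [j0 hj0] : exists j : nat * nat * S * A * nat, drawn K T m1 m2 j.
  have /card_gt0P[a0 _] := hA; exists (0%N, 0%N, s0, a0, 0%N).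
  by have [m10 _ _ _] := r1P 0%N K_gt0.
have [J [v [v_inj vE]]] := finite_setEcodom (@finite_drawn S A K T m1 m2).
have v_drawn j : drawn K T m1 m2 (v j) by rewrite vE; exists j.
have exw i : exists j, drawn K T m1 m2 i -> v j = i.
  have [|ndi] := pselect (drawn K T m1 m2 i).
    by rewrite vE => -[j _ <-]; exists j.
  have [j _ _] : range v j0 by rewrite -vE.
  by exists j => /ndi.
have [w wK] := choice exw.
pose svmdx x := svmd M h hbar omega gomega T m1 m2 eta (sample_fun w x) K.
pose goodx : set {ffun J -> S} := [set x |
    linfty (V (svmdx x) \- V pistar) <= eps /\
    linfty (bregman_policy omega gomega (svmdx x) pistar)
      <= eps / (mu * (1 - discount M))].
(* The output depends on the drawn samples only, so the event can be moved to the finite space. *)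
have pihatE om : pihat om = svmdx (sample xi v om).
  apply: eq_svmd => // k t s a i kK tT im.
  by rewrite (sample_funE xi wK).
have -> : good = [set om | goodx (sample xi v om)].
  by apply/seteqP; split=> om; rewrite /good /goodx /= pihatE.
split; first exact: (measurable_sample_event hxi v_drawn).
rewrite (sample_event_prob hxi v_inj v_drawn) lee_fin.
apply: (union_bound h_itv h_cont grad hS hA wK K_gt0 T1 delta0
  (r1 := radius1 m1 L1) (r2 := radius2 m2 L2)).
- by move=> k kK; have [a b c _] := r1P k kK; split; [exact: a|exact: b|rewrite -L1E; exact: c].
- move=> k kK; have [m20 r20 r2g r2L _] := r2P k kK.
  split; [exact: m20| |rewrite -L2E; exact: r2L].
  rewrite r20 /=; apply: (le_trans r2g).
  have : (1 - discount M) ^+ 2 <= 1 by rewrite exprn_ile1 ?(ltW g1')//; lra.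
  by lra.
move=> x dev1 dev2.
have fin := svmd_contract h_itv h_cont mu_gt0 grad omega_sc hsc hS hA VfE pistar_opt
  D0_ge hD0 hu T18 heta L1_gt0 L2_gt0 hm1 hm2 dev1 dev2 (leqnn K).
split.
  apply: linfty_le => [|s]; first exact: ltW.
  have [gap _] := fin s; rewrite ger0_norm; first exact: le_trans uK.
  by rewrite subr_ge0 Vopt//; exact: svmd_policy.
apply: linfty_le => // s; have [_ br] := fin s.
have b0 : 0 <= bregman omega gomega (svmdx x s) (pistar s).
  by apply: bregman_ge0 => //; exact: svmd_policy.
rewrite ger0_norm// ler_pdivlMr ?mulr_gt0// mulrA.
apply: le_trans uK; apply: le_trans br.
by rewrite [_ * mu]mulrC ler_piMr ?mulr_ge0 ?(ltW mu_gt0)//; lra.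
Qed.
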